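(* Let $(f_n)_{n=1}^\infty$ be a regular polynomial sequence, $f_n(z)=\sum_{j=0}^{d_n}a_{n,j}z^j$ with $d_n\ge 2$ and $a_{n,d_n}\neq 0$, and let $P_j$ denote the $j$-th monic orthogonal polynomial with respect to the equilibrium measure $\mu_{J_{(f_n)}}$ of the Julia set $J_{(f_n)}$. Then: (a) $\displaystyle P_1(z)=z+\frac{1}{d_1}\frac{a_{1,d_1-1}}{a_{1,d_1}}.$ (b) For every $l\in\mathbb{N}$, $\displaystyle P_{d_1\cdots d_l}(z)=\frac{1}{(a_{1,d_1})^{d_2\cdots d_l}(a_{2,d_2})^{d_3\cdots d_l}\cdots a_{l,d_l}}\left(F_l(z)+\frac{1}{d_{l+1}}\frac{a_{l+1,d_{l+1}-1}}{a_{l+1,d_{l+1}}}\right).$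
   Context: A sequence of complex polynomials $f_n(z)=\sum_{j=0}^{d_n}a_{n,j}z^j$ with $d_n\ge2$, $a_{n,d_n}\ne0$ for all $n\in\mathbb{N}$ is called a regular polynomial sequence, written $(f_n)\in\mathcal{R}$, if there are positive real numbers $A_1,A_2,A_3$ such that for all $n\in\mathbb{N}$: $|a_{n,d_n}|\ge A_1$; $|a_{n,j}|\le A_2|a_{n,d_n}|$ for $j=0,1,\ldots,d_n-1$; and $\log|a_{n,d_n}|\le A_3 d_n$. Put $F_0(z)=z$ and $F_n=f_n\circ F_{n-1}$, so $F_n=f_n\circ\cdots\circ f_1$; $F_l$ has degree $d_1\cdots d_l$ and leading coefficient $(a_{1,d_1})^{d_2\cdots d_l}(a_{2,d_2})^{d_3\cdots d_l}\cdots a_{l,d_l}$. The Fatou set of $(f_n)$ is the set of points of $\overline{\mathbb{C}}$ at which (i.e. on some neighbourhood of which) the sequence $(F_n)_{n\ge1}$ is normal in the sense of Montel, and the Julia set $J_{(f_n)}$ is its complement in $\overline{\mathbb{C}}$. For $(f_n)\in\mathcal{R}$, $J_{(f_n)}$ is a compact non-polar subset of $\mathbb{C}$; $\mu_{J_{(f_n)}}$ denotes its equilibrium measure (logarithmic potential theory). The monic orthogonal polynomial $P_j$ is the monic polynomial of degree $j$ orthogonal to $1,z,\ldots,z^{j-1}$ in $L^2(\mu_{J_{(f_n)}})$, i.e. $\int P_j(z)\overline{z^k}\,d\mu_{J_{(f_n)}}(z)=0$ for $0\le k\le j-1$. *)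

(* Defs.v *)
From HB Require Import structures.
From mathcomp Require Import all_boot all_order all_algebra.
From mathcomp Require Import all_classical all_reals all_analysis.
From mathcomp Require Import complex ring lra.

Set Implicit Arguments.
Unset Strict Implicit.
Unset Printing Implicit Defensive.

Import Order.TTheory GRing.Theory Num.Theory numFieldNormedType.Exports.
Local Open Scope classical_set_scope.
Local Open Scope ring_scope.

(* The real-valued modulus; [`|z|] is the same number, but as an element of R[i]. *)
Definition cabs (R : realType) (z : R[i]) : R := Normc.normc z.

(* [None] is the point at infinity. *)
Definition sphere (R : realType) : Type := option R[i].

HB.instance Definition _ (R : realType) := Choice.copy (sphere R) (option R[i]).

Section chordal_metric.
Variable R : realType.
Implicit Types (a b c : R[i]) (z w : sphere R).

Definition chordal z w : R :=
  match z, w with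
  | Some a, Some b =>
      2 * cabs (a - b) /
        (Num.sqrt (1 + cabs a ^+ 2) * Num.sqrt (1 + cabs b ^+ 2))
  | Some a, None | None, Some a => 2 / Num.sqrt (1 + cabs a ^+ 2)
  | None, None => 0
  end.

Let h a : R := Num.sqrt (1 + cabs a ^+ 2).

Let cabs_ge0 a : 0 <= cabs a.
Proof. by case: a => x y; exact: sqrtr_ge0. Qed.

Let h_gt0 a : 0 < h a.
Proof. by rewrite sqrtr_gt0 ltr_pwDl ?sqr_ge0. Qed.

Let h_sqr a : h a ^+ 2 = 1 + cabs a ^+ 2.
Proof. by rewrite sqr_sqrtr// addr_ge0// sqr_ge0. Qed.

Let cabs_le_h a : cabs a <= h a.
Proof.
rewrite -(@ler_pXn2r _ 2)// ?nnegrE ?(ltW (h_gt0 a))//.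
by rewrite h_sqr lerDr.
Qed.

Let cabsB a b : cabs (a - b) = cabs (b - a).
Proof. by rewrite -opprB /cabs normcN. Qed.

Let cabs_sqr a : cabs a ^+ 2 = complex.Re a ^+ 2 + complex.Im a ^+ 2.
Proof. by case: a => x y /=; rewrite sqr_sqrtr// addr_ge0// sqr_ge0. Qed.

Let cabs_conj_le a b : cabs (1 + conjc a * b) <= h a * h b.
Proof.
rewrite -(@ler_pXn2r _ 2)// ?nnegrE ?mulr_ge0 ?(ltW (h_gt0 _))//.
rewrite exprMn !h_sqr !cabs_sqr; case: a => x y; case: b => u v /=.
rewrite -subr_ge0.
suff -> : (1 + (x ^+ 2 + y ^+ 2)) * (1 + (u ^+ 2 + v ^+ 2)) -
    ((1 + (x * u - - y * v)) ^+ 2 + (0 + (x * v + - y * u)) ^+ 2) =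
    (x - u) ^+ 2 + (y - v) ^+ 2 by rewrite addr_ge0// sqr_ge0.
ring.
Qed.

Let h_lip a b : h b <= cabs (a - b) + h a.
Proof.
have ab0 := cabs_ge0 (a - b); have ha0 := ltW (h_gt0 a).
rewrite -(@ler_pXn2r _ 2)// ?nnegrE ?addr_ge0 ?(ltW (h_gt0 b))//.
have bab : cabs b <= cabs a + cabs (a - b).
  by rewrite cabsB -{1}(subrKC a b); exact: le_normcD.
have bab2 : cabs b ^+ 2 <= (cabs a + cabs (a - b)) ^+ 2.
  by rewrite ler_pXn2r// nnegrE ?addr_ge0// cabs_ge0.
have aab : cabs a * cabs (a - b) <= h a * cabs (a - b).
  by rewrite ler_wpM2r.
have := h_sqr a; have := h_sqr b; nra.
Qed.

Let tri a b c : cabs (a - c) * h b <= cabs (a - b) * h c + cabs (b - c) * h a.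
Proof.
rewrite -(ler_pM2r (h_gt0 b)).
suff : cabs (a - c) * h b ^+ 2 <=
    cabs (a - b) * (h b * h c) + cabs (b - c) * (h b * h a) by nra.
have -> : cabs (a - c) * h b ^+ 2 =
    cabs ((a - b) * (1 + conjc b * c) + (b - c) * (1 + conjc b * a)).
  have -> : (a - b) * (1 + conjc b * c) + (b - c) * (1 + conjc b * a) =
    (a - c) * (1 + b * conjc b) by ring.
  rewrite /cabs Normc.normcM -/(cabs _) -/(cabs _); congr (_ * _).
  rewrite h_sqr; case: b => x y.
  rewrite cabs_sqr /= /cabs /=.
  have -> : 0 + (x * - y + y * x) = 0 by ring.
  rewrite expr0n addr0 sqrtr_sqr ger0_norm; first by ring.
  by have := sqr_ge0 x; have := sqr_ge0 y; nra.
apply: le_trans (le_normcD _ _) _; rewrite !Normc.normcM.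
by apply: lerD; apply: ler_wpM2l; rewrite ?cabs_ge0 ?cabs_conj_le//;
  exact: cabs_ge0.
Qed.

Let chordalxx z : chordal z z = 0.
Proof. by case: z => //= a; rewrite subrr /cabs Normc.normc0 mulr0 mul0r. Qed.

Let chordal_eq0 z w : chordal z w = 0 -> z = w.
Proof.
have n0 a : 2 / h a <> 0.
  by apply/eqP; rewrite gt_eqF// divr_gt0.
case: z => [a|]; case: w => [b|] //=; [|by move/n0..].
move/eqP; rewrite mulf_eq0 invr_eq0 [X in _ || X]gt_eqF ?mulr_gt0 ?h_gt0//.
by rewrite orbF mulf_eq0 pnatr_eq0/= => /eqP /Normc.eq0_normc /subr0_eq ->.
Qed.

Let chordal_sym z w : chordal z w = chordal w z.
Proof.
case: z => [a|]; case: w => [b|] //=.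
by rewrite cabsB (mulrC (Num.sqrt _)).
Qed.

Let chordal_triangle w z x : chordal z x <= chordal z w + chordal w x.
Proof.
have h0 a : h a != 0 by rewrite gt_eqF.
case: z => [a|]; case: w => [b|]; case: x => [c|] /=; rewrite -/(h _) ?addr0 ?add0r//.
- rewrite -subr_ge0.
  have -> : 2 * cabs (a - b) / (h a * h b) + 2 * cabs (b - c) / (h b * h c) -
      2 * cabs (a - c) / (h a * h c) =
      2 * (cabs (a - b) * h c + cabs (b - c) * h a - cabs (a - c) * h b) /
      (h a * h b * h c) by field; rewrite !h0.
  rewrite divr_ge0 ?mulr_ge0 ?subr_ge0 ?tri//; exact/ltW.
- rewrite -subr_ge0.
  have -> : 2 * cabs (a - b) / (h a * h b) + 2 / h b - 2 / h a =
      2 * (cabs (a - b) + h a - h b) / (h a * h b) by field; rewrite !h0.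
  rewrite divr_ge0 ?mulr_ge0 ?subr_ge0 ?h_lip//; exact/ltW.
- rewrite -subr_ge0.
  have -> : 2 / h a + 2 / h c - 2 * cabs (a - c) / (h a * h c) =
      2 * (h a + h c - cabs (a - c)) / (h a * h c) by field; rewrite !h0.
  rewrite divr_ge0 ?mulr_ge0 ?subr_ge0//; try exact/ltW.
  apply: le_trans (le_normcD _ _) _.
  by rewrite normcN lerD// cabs_le_h.
- rewrite -subr_ge0.
  have -> : 2 / h b + 2 * cabs (b - c) / (h b * h c) - 2 / h c =
      2 * (cabs (b - c) + h c - h b) / (h b * h c) by field; rewrite !h0.
  rewrite divr_ge0 ?mulr_ge0 ?subr_ge0//; try exact/ltW.
  by rewrite cabsB h_lip.
- by rewrite addr_ge0// divr_ge0// ltW.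
Qed.

HB.instance Definition _ := @isMetric.Build R (sphere R) chordal
  chordalxx chordal_eq0 chordal_sym chordal_triangle.

End chordal_metric.

Section julia.
Variable R : realType.

Definition normal_on (U : set (sphere R)) (G : set (sphere R -> sphere R)) :=
  forall u : nat -> sphere R -> sphere R, (forall n, G (u n)) ->
  exists s : nat -> nat, {homo s : m n / (m < n)%N} /\
  exists g : sphere R -> sphere R,
  forall z, U z -> exists2 V, nbhs z V & {uniform V, (u \o s) @ \oo --> g}.

(* The extension of p to the sphere that fixes infinity, which is the
   continuous one when p is not constant. *)
Definition sphere_map (p : {poly R[i]}) (z : sphere R) : sphere R :=
  if z is Some a then Some p.[a] else None.

Implicit Types f : nat -> {poly R[i]}.

(* Sequences (f_n) are indexed from n = 1: the value f 0 is never used. *)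

Definition deg (p : {poly R[i]}) : nat := (size p).-1.

Definition regular f := exists A1 A2 A3 : R, [/\ 0 < A1, 0 < A2, 0 < A3 &
  forall n, (0 < n)%N ->
  [/\ (2 <= deg (f n))%N,
      A1 <= cabs (lead_coef (f n)),
      forall j, (j < deg (f n))%N ->
        cabs (f n)`_j <= A2 * cabs (lead_coef (f n)) &
      ln (cabs (lead_coef (f n))) <= A3 * (deg (f n))%:R]].

Fixpoint comp_seq f (n : nat) : {poly R[i]} :=
  if n is m.+1 then f m.+1 \Po comp_seq f m else 'X.

Definition fatou f : set (sphere R) :=
  [set z | exists2 U, open_nbhs z U &
    normal_on U [set sphere_map (comp_seq f n) | n in [set n | (0 < n)%N]]].

Definition julia f : set (sphere R) := ~` fatou f.

End julia.

(* R[i] has its norm topology only through the alias R[i]^o. *)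
Notation borelC R := (g_sigma_algebraType (@open R[i]^o)).

Section equilibrium.
Variable R : realType.
Implicit Types (mu nu : probability (borelC R) R) (K : set R[i]).

(* [lne 0 = -oo], so the kernel [log (1 / |z - w|)] is [+oo] on the diagonal. *)
Definition energy mu : \bar R :=
  (\int[mu]_z \int[mu]_w - lne (cabs ((z : R[i]) - (w : R[i])))%:E)%E.

(* K is non-polar exactly when it carries a probability measure of finite
   energy, and only then does it have an equilibrium measure. *)
Definition is_equilibrium_measure K mu :=
  [/\ mu K = 1%E, (energy mu < +oo)%E &
      forall nu, nu K = 1%E -> (energy mu <= energy nu)%E].

Definition cintegral mu (g : R[i] -> R[i]) : R[i] :=
  Complex (Rintegral mu setT (fun z => complex.Re (g z)))
          (Rintegral mu setT (fun z => complex.Im (g z))).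

Definition is_monic_orthopoly mu (j : nat) (P : {poly R[i]}) :=
  [/\ P \is monic, size P = j.+1 &
      forall k, (k < j)%N -> cintegral mu (fun z => P.[z] * conjc (z ^+ k)) = 0].

(* [0] if there is no monic orthogonal polynomial of degree j. *)
Definition monic_orthopoly mu (j : nat) : {poly R[i]} :=
  xget 0 [set P | is_monic_orthopoly mu j P].

End equilibrium.

(* Main.v *)
Require Import Defs.
From HB Require Import structures.
From mathcomp Require Import all_boot all_order all_algebra.
From mathcomp Require Import all_classical all_reals all_analysis.
From mathcomp Require Import measurable_realfun complex ring lra.

Set Implicit Arguments.
Unset Strict Implicit.
Unset Printing Implicit Defensive.

Import Order.TTheory GRing.Theory Num.Theory numFieldNormedType.Exports.
Local Open Scope classical_set_scope.
Local Open Scope ring_scope.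

(* The equilibrium measure mu of K = J is invariant under averaging over the
   fibres of p = F_m.  Indeed K is a union of fibres of p; let nu be the average
   of mu over these fibres and write I for the mutual logarithmic energy.  If
   zeta_j(z) are the points of the fibre of z, then
   sum_j log |u - zeta_j(z)| = log |p(u) - p(z)| + c depends on u only through
   p(u), so that I(nu, nu) = I(nu, mu); this is finite because minimality bounds
   the potential of mu.  Hence I(mu - nu) = I(mu, mu) - I(nu, nu) <= 0.  On the
   other hand, with s = |z - w|^2, the kernel - log s is a limit of integrals
   over r of 1 / (r + s), which is a geometric series of sums of squares
   phi(z) phi(w); this makes the energy of signed measures of total mass 0
   nonnegative, and zero only if all moments in z and its conjugate vanish.
   So mu and nu have the same moments.

   Now let g = f_(l+1), of degree d, and F = F_l, of degree N.  Over a fibre of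
   g o F the sum of F is -N g_(d-1) / g_d, so the integral of F with respect to
   mu is - g_(d-1) / (d g_d) = - c.  Over a fibre of F the power sums of order
   k < N are constant, so the integral of (F + c) conj(z^k) is a multiple of the
   integral of F + c, which is 0. *)

(** * Bounded measurable functions and the energy form *)

(** The logarithmic kernel is unbounded and an energy may be infinite, so I(mu - nu) cannot simply
    be expanded. The algebra is carried out with the bounded kernels - log (t + s) / 2, t > 0, and
    the true energies enter only through inequalities and monotone convergence as t tends to 0. A
    constant C is added to make the kernels nonnegative: this gives access to Tonelli and does not
    affect signed measures of total mass 0.

    Equal moments are enough, since every function to be integrated is a polynomial in z and its
    conjugate; no identification of mu with nu as measures is attempted.

    For nu to be a measure, the roots of p - p(z) have to be selected measurably in z. That J is a
    union of fibres rests on polynomials being open maps: normality is local, so a neighbourhood of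
    one point of a fibre must be carried to a neighbourhood of another.

    The invariance is used at two levels: along F_(l+1) for the mean of F_l, and along F_l for
    orthogonality. The case l = 0 is included and gives P_1. *)

Section bounded_measurable.
Context d (T : measurableType d) (R : realType).
Implicit Types (f g : T -> R) (P : probability T R).

Definition bounded_measurable f :=
  measurable_fun setT f /\ exists M, forall x, `|f x| <= M.

Lemma bounded_measurable_cst c : bounded_measurable (fun=> c).
Proof. by split=> //; exists `|c|. Qed.

Lemma bounded_measurableD f g : bounded_measurable f -> bounded_measurable g ->
  bounded_measurable (fun x => f x + g x).
Proof.
move=> [mf [M fM]] [mg [N gN]]; split; first exact: measurable_funD.
by exists (M + N) => x; rewrite (le_trans (ler_normD _ _))// lerD.
Qed.

Lemma bounded_measurableM f g : bounded_measurable f -> bounded_measurable g ->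
  bounded_measurable (fun x => f x * g x).
Proof.
move=> [mf [M fM]] [mg [N gN]]; split; first exact: measurable_funM.
by exists (M * N) => x; rewrite normrM ler_pM.
Qed.

Lemma bounded_measurableN f : bounded_measurable f ->
  bounded_measurable (fun x => - f x).
Proof.
move=> /(bounded_measurableM (bounded_measurable_cst (-1))).
by under eq_fun do rewrite mulN1r.
Qed.

Lemma bounded_measurableX f n : bounded_measurable f ->
  bounded_measurable (fun x => f x ^+ n).
Proof.
move=> bf; elim: n => [|n IH]; first exact: bounded_measurable_cst.
by under eq_fun do rewrite exprS; exact: bounded_measurableM.
Qed.

Lemma bounded_measurable_sum (I : Type) (s : seq I) (f : I -> T -> R) :
  (forall i, bounded_measurable (f i)) ->
  bounded_measurable (fun x => \sum_(i <- s) f i x).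
Proof.
move=> bf; elim: s => [|i s IH].
  by under eq_fun do rewrite big_nil; exact: bounded_measurable_cst.
by under eq_fun do rewrite big_cons; exact: bounded_measurableD.
Qed.

Lemma bounded_measurable_prod (I : Type) (s : seq I) (f : I -> T -> R) :
  (forall i, bounded_measurable (f i)) ->
  bounded_measurable (fun x => \prod_(i <- s) f i x).
Proof.
move=> bf; elim: s => [|i s IH].
  by under eq_fun do rewrite big_nil; exact: bounded_measurable_cst.
by under eq_fun do rewrite big_cons; exact: bounded_measurableM.
Qed.

Lemma bounded_measurable_integrable P f : bounded_measurable f ->
  P.-integrable setT (EFin \o f).
Proof.
move=> [mf [M fM]]; apply: measurable_bounded_integrable => //.
  by rewrite [X in (X < _)%E](@probability_setT _ _ _ P) ltry.
exists M; split; first exact: num_real.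
by move=> y My x _; exact: le_trans (fM x) (ltW My).
Qed.

Lemma Rintegral_cstT P (c : R) : \int[P]_x c = c.
Proof.
by rewrite Rintegral_cst// [X in fine X](@probability_setT _ _ _ P) mulr1.
Qed.

Lemma Rintegral_bounded P f M : bounded_measurable f ->
  (forall x, `|f x| <= M) -> `|\int[P]_x f x| <= M.
Proof.
move=> bf fM; apply: le_trans.
  exact/le_normr_Rintegral/bounded_measurable_integrable.
rewrite -[M](Rintegral_cstT P).
apply: le_Rintegral => //; [|exact/bounded_measurable_integrable/bounded_measurable_cst].
apply: integrable_norm; exact: bounded_measurable_integrable.
Qed.

End bounded_measurable.

Lemma bounded_measurable_comp d d' (T : measurableType d)
    (T' : measurableType d') (R : realType) (f : T -> R) (h : T' -> T) :
  measurable_fun setT h -> bounded_measurable f -> bounded_measurable (f \o h).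
Proof.
by move=> mh [mf [M fM]]; split; [exact: measurableT_comp|exists M => x /=].
Qed.

Section energy_form.
Context d (T : measurableType d) (R : realType).
Variables al be : probability T R.
Implicit Types k l : T * T -> R.

(* The double integral of k against the signed measure [al - be]. *)
Definition energy_form k : R :=
  (\int[(al \x al)%E]_x k x - \int[(al \x be)%E]_x k x)
  - (\int[(be \x al)%E]_x k x - \int[(be \x be)%E]_x k x).

Local Notation D := energy_form.

Lemma energy_formD k l : bounded_measurable k -> bounded_measurable l ->
  D (fun x => k x + l x) = D k + D l.
Proof.
move=> bk bl; rewrite /D !RintegralD//; try exact: bounded_measurable_integrable.
set a1 := Rintegral _ _ k; set a2 := Rintegral _ _ l.
set b1 := Rintegral _ _ k; set b2 := Rintegral _ _ l.
set c1 := Rintegral _ _ k; set c2 := Rintegral _ _ l.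
set d1 := Rintegral _ _ k; set d2 := Rintegral _ _ l.
by ring.
Qed.

Lemma energy_formZ c k : bounded_measurable k ->
  D (fun x => c * k x) = c * D k.
Proof.
move=> bk; rewrite /D !RintegralZl//; try exact: bounded_measurable_integrable.
by ring.
Qed.

Lemma energy_formB k l : bounded_measurable k -> bounded_measurable l ->
  D (fun x => k x - l x) = D k - D l.
Proof.
move=> bk bl; rewrite /D !RintegralB//; try exact: bounded_measurable_integrable.
set a1 := Rintegral _ _ k; set a2 := Rintegral _ _ l.
set b1 := Rintegral _ _ k; set b2 := Rintegral _ _ l.
set c1 := Rintegral _ _ k; set c2 := Rintegral _ _ l.
set d1 := Rintegral _ _ k; set d2 := Rintegral _ _ l.
by ring.
Qed.

Lemma energy_form_sum (I : Type) (s : seq I) (k : I -> T * T -> R) :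
  (forall i, bounded_measurable (k i)) ->
  D (fun x => \sum_(i <- s) k i x) = \sum_(i <- s) D (k i).
Proof.
move=> bk; elim: s => [|i s IH].
  rewrite big_nil; under eq_fun do rewrite big_nil.
  by rewrite /D !Rintegral_cstT !subr0.
rewrite big_cons -IH; under eq_fun do rewrite big_cons.
by rewrite energy_formD//; exact: bounded_measurable_sum.
Qed.

Lemma energy_form_cst c : D (fun=> c) = 0.
Proof. by rewrite /D !Rintegral_cstT !subrr. Qed.

Lemma energy_form_bounded k M : bounded_measurable k ->
  (forall x, `|k x| <= M) -> `|D k| <= 4 * M.
Proof.
move=> bk kM; have h P := Rintegral_bounded P bk kM.
rewrite /D; have := h (al \x al)%E; have := h (al \x be)%E.
have := h (be \x al)%E; have := h (be \x be)%E.
by rewrite !ler_norml; move=> /andP[? ?] /andP[? ?] /andP[? ?] /andP[? ?]; lra.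
Qed.

Lemma Rintegral_product (P Q : probability T R) (f g : T -> R) :
  bounded_measurable f -> bounded_measurable g ->
  \int[(P \x Q)%E]_x (f x.1 * g x.2) = \int[P]_x f x * \int[Q]_x g x.
Proof.
move=> bf bg.
have b : bounded_measurable (fun x : T * T => f x.1 * g x.2).
  apply: bounded_measurableM.
    exact: (bounded_measurable_comp (h := fst)).
  exact: (bounded_measurable_comp (h := snd)).
rewrite /Rintegral -integral12_prod_meas1; last first.
  exact: (bounded_measurable_integrable (P \x Q)%E b).
have fP := integrable_fin_num measurableT (bounded_measurable_integrable P bf).
have fQ := integrable_fin_num measurableT (bounded_measurable_integrable Q bg).
rewrite -fineM//; congr fine.
transitivity (\int[P]_x ((f x)%:E * \int[Q]_y (g y)%:E))%E.
  apply: eq_integral => x _; rewrite /fubini_F/=.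
  under eq_integral do rewrite EFinM.
  by rewrite integralZl//; exact: bounded_measurable_integrable.
rewrite -(fineK fQ) integralZr//; exact: bounded_measurable_integrable.
Qed.

(** Fubini turns a product kernel into the square of a single integral against [al - be]. Every
    positivity statement below comes from this. *)
Lemma energy_form_product (f : T -> R) : bounded_measurable f ->
  D (fun x => f x.1 * f x.2) = (\int[al]_x f x - \int[be]_x f x) ^+ 2.
Proof. by move=> bf; rewrite /D !Rintegral_product//; ring. Qed.

End energy_form.

(** * Positive kernels *)

Section positive_kernels.
Context d (T : measurableType d) (R : realType).
Implicit Types (k l p : T * T -> R) (f : T -> R).

(** Positive definiteness of finite rank, with the feature maps given explicitly: for a product of
    two kernels the features are then simply multiplied in pairs, which is the Schur product
    theorem. *)
Definition featured k := exists (I : finType) (phi : I -> T -> R),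
  (forall i, bounded_measurable (phi i)) /\
  forall x, k x = \sum_i phi i x.1 * phi i x.2.

(* Uniform limits of finite sums of squares [phi (x) phi]. *)
Definition positive_kernel k := bounded_measurable k /\
  forall e, 0 < e -> exists2 p, featured p & forall x, `|k x - p x| <= e.

Lemma bounded_measurable_square f : bounded_measurable f ->
  bounded_measurable (fun x : T * T => f x.1 * f x.2).
Proof.
move=> bf; apply: bounded_measurableM.
  exact: (bounded_measurable_comp (h := fst)).
exact: (bounded_measurable_comp (h := snd)).
Qed.

Lemma featured_bounded_measurable k : featured k -> bounded_measurable k.
Proof.
move=> [I [phi [bphi /funext ->]]]; apply: bounded_measurable_sum => i.
exact: bounded_measurable_square.
Qed.

Lemma featuredD k l : featured k -> featured l ->
  featured (fun x => k x + l x).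
Proof.
move=> [I [phi [bphi kE]]] [J [psi [bpsi lE]]].
exists (I + J)%type, (fun u => match u with inl i => phi i | inr j => psi j end).
by split=> [[]//|x]; rewrite big_sumType/= kE lE.
Qed.

Lemma featuredM k l : featured k -> featured l ->
  featured (fun x => k x * l x).
Proof.
move=> [I [phi [bphi kE]]] [J [psi [bpsi lE]]].
exists (I * J)%type, (fun u x => phi u.1 x * psi u.2 x).
split=> [u|x]; first exact: bounded_measurableM.
rewrite kE lE big_distrlr/= pair_big/=; apply: eq_bigr => u _.
by rewrite mulrACA.
Qed.

Lemma positive_featured k : featured k -> positive_kernel k.
Proof.
move=> fk; split; first exact: featured_bounded_measurable.
by move=> e e0; exists k => // x; rewrite subrr normr0 ltW.
Qed.

Lemma positive_square f : bounded_measurable f ->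
  positive_kernel (fun x => f x.1 * f x.2).
Proof.
move=> bf; apply: positive_featured.
by exists unit, (fun=> f); split=> // x; rewrite (big_pred1 tt)//; case.
Qed.

Lemma positive_cst c : 0 <= c -> positive_kernel (fun=> c).
Proof.
move=> c0; rewrite [X in positive_kernel X](_ : _ = fun=> Num.sqrt c * Num.sqrt c).
  exact/(positive_square (f := fun=> Num.sqrt c))/bounded_measurable_cst.
by apply/funext => x; rewrite -expr2 sqr_sqrtr.
Qed.

Lemma positiveD k l : positive_kernel k -> positive_kernel l ->
  positive_kernel (fun x => k x + l x).
Proof.
move=> [bk pk] [bl pl]; split; first exact: bounded_measurableD.
move=> e e0; have [p fp kp] := pk _ (divr_gt0 e0 (ltr0n _ 2)).
have [q fq lq] := pl _ (divr_gt0 e0 (ltr0n _ 2)).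
exists (fun x => p x + q x); first exact: featuredD.
move=> x; rewrite opprD addrACA (le_trans (ler_normD _ _))//.
by rewrite (le_trans (lerD (kp x) (lq x)))// -splitr.
Qed.

Lemma positiveM k l : positive_kernel k -> positive_kernel l ->
  positive_kernel (fun x => k x * l x).
Proof.
move=> [bk pk] [bl pl]; split; first exact: bounded_measurableM.
move=> e e0; have [_ [M kM]] := bk; have [_ [N lN]] := bl.
pose C := `|M| + `|N| + 1.
have C0 : 0 < C by rewrite ltr_wpDl// addr_ge0.
(* The bound 1 gives [|q| <= |N| + 1]; then k l - p q is at most (|M| + |N| + 1) dl = C dl. *)
pose dl := Num.min 1 (e / C).
have d0 : 0 < dl by rewrite lt_min ltr01 divr_gt0.
have [p fp kp] := pk _ d0; have [q fq lq] := pl _ d0.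
exists (fun x => p x * q x); first exact: featuredM.
move=> x.
have -> : k x * l x - p x * q x = k x * (l x - q x) + q x * (k x - p x) by ring.
have qN : `|q x| <= `|N| + 1.
  rewrite -[q x](subKr (l x)) (le_trans (ler_normB _ _))// lerD//.
    by rewrite (le_trans (lN x))// ler_norm.
  by rewrite (le_trans (lq x))// ge_min lexx.
have kM' : `|k x| <= `|M| by rewrite (le_trans (kM x))// ler_norm.
rewrite (le_trans (ler_normD _ _))// !normrM.
apply: (@le_trans _ _ (`|M| * dl + (`|N| + 1) * dl)).
  by rewrite lerD// ler_pM.
rewrite -mulrDl addrA -/C (le_trans (y := C * (e / C)))//.
  by rewrite ler_pM2l// ge_min lexx orbT.
by rewrite mulrC divfK// gt_eqF.
Qed.

Lemma positiveX k n : positive_kernel k -> positive_kernel (fun x => k x ^+ n).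
Proof.
move=> pk; elim: n => [|n IH]; first exact: positive_cst.
by under eq_fun do rewrite exprS; exact: positiveM.
Qed.

Lemma positive_sum (I : Type) (s : seq I) (k : I -> T * T -> R) :
  (forall i, positive_kernel (k i)) ->
  positive_kernel (fun x => \sum_(i <- s) k i x).
Proof.
move=> bf; elim: s => [|i s IH].
  by under eq_fun do rewrite big_nil; exact: positive_cst.
by under eq_fun do rewrite big_cons; exact: positiveD.
Qed.

Lemma positive_lim k : bounded_measurable k ->
  (forall e, 0 < e -> exists2 p, positive_kernel p & forall x, `|k x - p x| <= e) ->
  positive_kernel k.
Proof.
move=> bk h; split=> // e e0.
have [p [_ pp] kp] := h _ (divr_gt0 e0 (ltr0n _ 2)).
have [q fq pq] := pp _ (divr_gt0 e0 (ltr0n _ 2)).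
exists q => // x; rewrite -[k x](subrK (p x)) -addrA.
rewrite (le_trans (ler_normD _ _))//.
by rewrite (le_trans (lerD (kp x) (pq x)))// -splitr.
Qed.

Variables al be : probability T R.

Lemma featured_energy_form k (I : finType) (phi : I -> T -> R) :
  (forall i, bounded_measurable (phi i)) ->
  (forall x, k x = \sum_i phi i x.1 * phi i x.2) ->
  energy_form al be k =
    \sum_i (\int[al]_x phi i x - \int[be]_x phi i x) ^+ 2.
Proof.
move=> bphi /funext ->.
rewrite (@energy_form_sum _ _ _ al be _ _ (fun i x => phi i x.1 * phi i x.2)).
  by apply: eq_bigr => i _; exact: energy_form_product.
by move=> i; exact: bounded_measurable_square.
Qed.

Lemma positive_energy_form k : positive_kernel k -> 0 <= energy_form al be k.
Proof.
move=> [bk h]; apply/ler_addgt0Pl => e e0.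
(* The form consists of four integrals, so an error e / 4 in the kernel costs at most e. *)
have [p fp kp] := h _ (divr_gt0 e0 (ltr0n _ 4)).
have bp := featured_bounded_measurable fp.
have D : `|energy_form al be (fun x => k x - p x)| <= 4 * (e / 4).
  by apply: energy_form_bounded => //; apply/bounded_measurableD/bounded_measurableN.
have p0 : 0 <= energy_form al be p.
  have [I [phi [bphi pE]]] := fp.
  by rewrite (featured_energy_form bphi pE) sumr_ge0// => i _; rewrite sqr_ge0.
move: D; rewrite energy_formB// ler_norml => /andP[D _].
by move: D p0; lra.
Qed.

End positive_kernels.

(** * Energy determines moments *)

(** The increment of [ln] lies between e / (a + e) and e / a, and these two differ by e^2 / (a (a +
    e)). *)
Lemma ln_increment_bound (R : realType) (a e : R) : 0 < a -> 0 <= e ->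
  `|ln (a + e) - ln a - e / a| <= (e / a) ^+ 2.
Proof.
move=> a0 e0; have ae0 : 0 < a + e by rewrite ltr_wpDr.
have up : ln (a + e) - ln a <= e / a.
  rewrite -ln_div ?posrE// mulrDl divff ?gt_eqF//.
  by rewrite le_ln1Dx// (lt_le_trans (y := 0))// ?oppr_lt0// divr_ge0// ltW.
have lo : e / (a + e) <= ln (a + e) - ln a.
  have : ln (a / (a + e)) <= - (e / (a + e)).
    have -> : a / (a + e) = 1 + (- (e / (a + e))).
      by field; rewrite gt_eqF.
    by apply: le_ln1Dx; rewrite ltrN2 ltr_pdivrMr// mul1r ltrDr.
  by rewrite ln_div ?posrE//; lra.
rewrite ler0_norm ?subr_le0// opprB lerBlDr.
apply: le_trans (lerD (lexx _) lo).
rewrite -subr_ge0.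
have -> : (e / a) ^+ 2 + e / (a + e) - e / a = e ^+ 3 / (a ^+ 2 * (a + e)).
  by field; rewrite !gt_eqF.
by rewrite divr_ge0 ?mulr_ge0 ?exprn_ge0// ltW.
Qed.

Section log_kernel.
Context d (T : measurableType d) (R : realType).
Variables X Y : T -> R.
Hypotheses (bX : bounded_measurable X) (bY : bounded_measurable Y).

(** [X] and [Y] stand for the coordinates of a point of the plane. Keeping them abstract and bounded
    allows coordinates cut off outside a bounded set to be substituted later. *)
Definition sqnorm z : R := X z ^+ 2 + Y z ^+ 2.

Definition sqdist (x : T * T) : R := (X x.1 - X x.2) ^+ 2 + (Y x.1 - Y x.2) ^+ 2.

Lemma sqnorm_ge0 z : 0 <= sqnorm z.
Proof. by rewrite addr_ge0 ?sqr_ge0. Qed.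

Lemma sqdist_ge0 x : 0 <= sqdist x.
Proof. by rewrite addr_ge0 ?sqr_ge0. Qed.

Lemma bounded_measurable_sqnorm : bounded_measurable sqnorm.
Proof. by apply: bounded_measurableD; exact: bounded_measurableX. Qed.

Lemma bounded_measurable_sqdist : bounded_measurable sqdist.
Proof.
have b1 (f : T -> R) : bounded_measurable f ->
    bounded_measurable (fun x : T * T => f x.1).
  exact: (bounded_measurable_comp (h := fst)).
have b2 (f : T -> R) : bounded_measurable f ->
    bounded_measurable (fun x : T * T => f x.2).
  exact: (bounded_measurable_comp (h := snd)).
by apply: bounded_measurableD; apply: bounded_measurableX;
  apply: bounded_measurableD; [exact: b1|exact/bounded_measurableN/b2
   |exact: b1|exact/bounded_measurableN/b2].
Qed.

Lemma sqnorm_bound : exists2 M, 0 < M & forall z, sqnorm z <= M.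
Proof.
have [_ [M hM]] := bounded_measurable_sqnorm.
exists (`|M| + 1) => [|z]; first by rewrite ltr_wpDl.
rewrite (le_trans (ler_norm _))// (le_trans (hM z))//.
by rewrite (le_trans (ler_norm _))// lerDl.
Qed.

Lemma sqdist_bound : exists2 M, 0 < M & forall x, sqdist x <= M.
Proof.
have [_ [M hM]] := bounded_measurable_sqdist.
exists (`|M| + 1) => [|z]; first by rewrite ltr_wpDl.
rewrite (le_trans (ler_norm _))// (le_trans (hM z))//.
by rewrite (le_trans (ler_norm _))// lerDl.
Qed.

Lemma bounded_measurable_ln d' (T' : measurableType d') (t : R) (f : T' -> R) :
  0 < t -> (forall x, 0 <= f x) -> bounded_measurable f ->
  bounded_measurable (fun x => ln (t + f x)).
Proof.
move=> t0 f0 [mf [M fM]]; split.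
  rewrite -[X in measurable_fun _ X]/(@ln R \o (fun x => t + f x)).
  apply: measurableT_comp; first exact: measurable_ln.
  exact: (measurable_funD (f := fun=> t)).
exists (`|ln t| + `|ln (t + M)|) => x.
have l1 : ln t <= ln (t + f x) by rewrite ler_ln ?posrE ?lerDl// ltr_wpDr.
have l2 : ln (t + f x) <= ln (t + M).
  have fM' : f x <= M by exact: le_trans (ler_norm _) (fM x).
  by rewrite ler_ln ?posrE ?lerD2l// ltr_wpDr// (le_trans (f0 x)).
rewrite ler_norml; apply/andP; split.
  rewrite (le_trans _ l1)// opprD (le_trans (y := - `|ln t|))//.
    by rewrite gerDl oppr_le0.
  by rewrite lerNl -normrN ler_norm.
by rewrite (le_trans l2)// (le_trans (ler_norm _))// lerDr.
Qed.

Lemma bounded_measurable_inv d' (T' : measurableType d') (t : R) (f : T' -> R) :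
  0 < t -> (forall x, 0 <= f x) -> bounded_measurable f ->
  bounded_measurable (fun x => (t + f x)^-1).
Proof.
move=> t0 f0 bf; have tf x : 0 < t + f x by rewrite ltr_wpDr.
split; last first.
  exists t^-1 => x; rewrite gtr0_norm ?invr_gt0// lef_pV2 ?posrE//.
  by rewrite lerDl.
rewrite (_ : (fun _ => _) = fun x => expR (- ln (t + f x))).
  rewrite -[X in measurable_fun _ X]/(@expR R \o (fun x => - ln (t + f x))).
  apply: measurableT_comp; first exact: measurable_expR.
  by apply: measurable_funN; have [] := bounded_measurable_ln t0 f0 bf.
by apply/funext => x; rewrite expRN lnK ?posrE.
Qed.

(** * The kernel 1 / (t + s) as a geometric series *)

Section fixed_t.
Variables (t : R) (t0 : 0 < t).

Definition psi z := (t + sqnorm z)^-1.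

(** These come from (t + |z|^2)(t + |w|^2) - t (t + |z - w|^2) = |z|^2 |w|^2 + 2 t <z, w>. Divided
    by the first product, the right-hand side is the inner product of the feature vectors of z and
    w, whence the weights [Num.sqrt (2 * t)]. *)
Definition feature (i : 'I_3) z := psi z *
  [:: sqnorm z; Num.sqrt (2 * t) * X z; Num.sqrt (2 * t) * Y z]`_i.

Definition qkernel x := \sum_i feature i x.1 * feature i x.2.

Lemma tsq_gt0 z : 0 < t + sqnorm z.
Proof. by rewrite ltr_wpDr// sqnorm_ge0. Qed.

Lemma bounded_measurable_psi : bounded_measurable psi.
Proof.
exact: (bounded_measurable_inv t0 sqnorm_ge0 bounded_measurable_sqnorm).
Qed.

Lemma bounded_measurable_feature i : bounded_measurable (feature i).
Proof.
apply: bounded_measurableM; first exact: bounded_measurable_psi.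
case: i => -[|[|[|//]]] i3 /=.
- exact: bounded_measurable_sqnorm.
- by apply: (bounded_measurableM (f := fun=> _)) => //; exact: bounded_measurable_cst.
- by apply: (bounded_measurableM (f := fun=> _)) => //; exact: bounded_measurable_cst.
Qed.

Lemma qkernelE x : qkernel x = psi x.1 * psi x.2 *
  (sqnorm x.1 * sqnorm x.2 + 2 * t * (X x.1 * X x.2 + Y x.1 * Y x.2)).
Proof.
rewrite /qkernel !big_ord_recl big_ord0 /feature /=.
have s2 : Num.sqrt (2 * t) ^+ 2 = 2 * t by rewrite sqr_sqrtr// mulr_ge0 ?ltW.
by move: s2; set r := Num.sqrt _ => <-; ring.
Qed.

Lemma one_subr_qkernel x :
  1 - qkernel x = t * psi x.1 * psi x.2 * (t + sqdist x).
Proof.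
rewrite qkernelE /psi /sqdist; have := tsq_gt0 x.1; have := tsq_gt0 x.2.
rewrite /sqnorm => h1 h2; field; by rewrite !gt_eqF.
Qed.

(** Both 1 - q and 1 + q equal psi(z) psi(w) times a factor that is at least t^2, while psi is at
    least 1 / (t + M). A bound strictly below 1 makes the geometric series converge uniformly. *)
Lemma qkernel_bound : exists2 c, 0 <= c < 1 & forall x, `|qkernel x| <= c.
Proof.
have [M M0 hM] := sqnorm_bound.
have p0 z : 0 < psi z by rewrite invr_gt0 tsq_gt0.
have pM z : (t + M)^-1 <= psi z.
  by rewrite lef_pV2 ?posrE ?tsq_gt0// ?lerD2l// addr_gt0.
have tM0 : 0 < t + M by rewrite addr_gt0.
pose a := (t / (t + M)) ^+ 2.
have a0 : 0 < a by rewrite exprn_gt0// divr_gt0.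
have a1 : a <= 1.
  by rewrite exprn_ile1 ?divr_ge0 ?(ltW t0) ?(ltW tM0)// ler_pdivrMr// mul1r lerDl ltW.
have key (r : R) x : t ^+ 2 <= r -> a <= psi x.1 * psi x.2 * r.
  move=> tr; rewrite /a expr_div_n mulrC; apply: ler_pM => //.
  - by rewrite invr_ge0 exprn_ge0// ltW.
  - by rewrite exprn_ge0 ?ltW.
  - by rewrite -exprVn expr2 ler_pM// invr_ge0 ltW.
exists (1 - a); first by rewrite subr_ge0 a1 ltrBlDr ltrDl.
move=> x; rewrite ler_norml; apply/andP; split; last first.
  rewrite lerBrDr -lerBrDl one_subr_qkernel.
  have -> : t * psi x.1 * psi x.2 * (t + sqdist x) =
    psi x.1 * psi x.2 * (t * (t + sqdist x)) by ring.
  by apply: key; rewrite expr2 ler_pM2l// lerDl sqdist_ge0.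
rewrite opprB lerBlDr addrC.
have -> : 1 + qkernel x = psi x.1 * psi x.2 *
   (t ^+ 2 + t * ((X x.1 + X x.2) ^+ 2 + (Y x.1 + Y x.2) ^+ 2)
      + 2 * sqnorm x.1 * sqnorm x.2).
  rewrite qkernelE /psi; have := tsq_gt0 x.1; have := tsq_gt0 x.2.
  rewrite /sqnorm => h1 h2; field; by rewrite !gt_eqF.
apply: key; rewrite -addrA lerDl addr_ge0//.
  by rewrite mulr_ge0 ?addr_ge0 ?sqr_ge0// ltW.
by rewrite !mulr_ge0 ?sqnorm_ge0.
Qed.

(** The remainder is kept exactly because it is used in two ways: it is small, which yields
    positivity of the left-hand side, and it is itself a positive kernel, which later lets single
    terms be isolated without passing to a limit. *)
Lemma inv_sqdist_geometric m x : (t + sqdist x)^-1 =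
  \sum_(n < m) t * (psi x.1 * psi x.2) * qkernel x ^+ n
    + qkernel x ^+ m / (t + sqdist x).
Proof.
have n0 : t + sqdist x != 0 by rewrite gt_eqF// ltr_wpDr// sqdist_ge0.
have := one_subr_qkernel x; set q := qkernel x; move=> q1.
rewrite -mulr_sumr; apply: (mulIf n0).
rewrite mulVf// mulrDl mulfVK//.
have -> : t * (psi x.1 * psi x.2) * (\sum_(i < m) q ^+ i) * (t + sqdist x) =
  (1 - q) * (\sum_(i < m) q ^+ i) by rewrite q1; ring.
rewrite -[1 - q]opprB mulNr -subrX1.
by rewrite opprB subrK.
Qed.

Lemma positive_qkernel : positive_kernel qkernel.
Proof.
apply: positive_featured; exists 'I_3, feature.
by split=> // i; exact: bounded_measurable_feature.
Qed.

Lemma bounded_measurable_inv_sqdist :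
  bounded_measurable (fun x => (t + sqdist x)^-1).
Proof. exact: bounded_measurable_inv t0 sqdist_ge0 bounded_measurable_sqdist. Qed.

Lemma positive_psi_qkernel n :
  positive_kernel (fun x => t * (psi x.1 * psi x.2) * qkernel x ^+ n).
Proof.
apply: positiveM; last exact/positiveX/positive_qkernel.
apply: positiveM; first exact/positive_cst/ltW.
exact/positive_square/bounded_measurable_psi.
Qed.

Lemma positive_inv_sqdist : positive_kernel (fun x => (t + sqdist x)^-1).
Proof.
apply: positive_lim; first exact: bounded_measurable_inv_sqdist.
move=> e e0; have [c /andP[c0 c1] qc] := qkernel_bound.
(* The remainder of the series is at most c^m / t. *)
have [m hm] : exists m, c ^+ m <= e * t.
  have et0 : 0 < e * t by rewrite mulr_gt0.
  have := @cvg_expr R c; rewrite ger0_norm// => /(_ c1) /cvgrPdist_le /(_ _ et0).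
  case=> m _ /(_ m (leqnn m)); rewrite /= sub0r normrN ger0_norm ?exprn_ge0//.
  by exists m.
exists (fun x => \sum_(n < m) t * (psi x.1 * psi x.2) * qkernel x ^+ n).
  by apply: positive_sum => i; exact: positive_psi_qkernel.
move=> x; rewrite (inv_sqdist_geometric m x) addrC addKr.
have s0 := sqdist_ge0 x.
have ts0 : 0 < t + sqdist x by rewrite ltr_wpDr.
rewrite normrM normfV normrX (gtr0_norm ts0) ler_pdivrMr//.
apply: (@le_trans _ _ (c ^+ m)).
  by rewrite lerXn2r ?nnegrE.
by rewrite (le_trans hm)// ler_pM2l// lerDl.
Qed.

End fixed_t.

Lemma bounded_measurable_ln_sqdist t : 0 < t ->
  bounded_measurable (fun x => ln (t + sqdist x)).
Proof.
move=> t0.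
exact: bounded_measurable_ln t0 sqdist_ge0 bounded_measurable_sqdist.
Qed.

(* A Riemann sum of [1 / (r + s)] over [t, u]. *)
Lemma positive_ln_ratio t u : 0 < t -> t <= u ->
  positive_kernel (fun x => ln (u + sqdist x) - ln (t + sqdist x)).
Proof.
move=> t0 tu; have u0 : 0 < u by exact: lt_le_trans tu.
apply: positive_lim.
  apply: bounded_measurableD; first exact: bounded_measurable_ln_sqdist.
  exact/bounded_measurableN/bounded_measurable_ln_sqdist.
move=> e e0.
pose C := ((u - t) / t) ^+ 2.
have C0 : 0 <= C by rewrite sqr_ge0.
(* Each of the m steps of the Riemann sum contributes an error of at most (dl / t)^2 = C / m^2, in
   total C / m. *)
pose m := (Num.truncn (C / e)).+1.
have m0 : (0 : R) < m%:R by rewrite ltr0n.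
have mC : C / m%:R <= e.
  rewrite ler_pdivrMr// mulrC -ler_pdivrMr// ltW//.
  exact: truncnS_gt.
pose dl := (u - t) / m%:R.
have dl0 : 0 <= dl by rewrite divr_ge0 ?subr_ge0// ltW.
exists (fun x => \sum_(i < m) dl * (t + i%:R * dl + sqdist x)^-1).
  apply: positive_sum => i; apply: positiveM; first exact: positive_cst.
  by apply: positive_inv_sqdist; rewrite ltr_wpDr// mulr_ge0.
move=> x; have s0 := sqdist_ge0 x.
pose F (i : nat) := ln (t + i%:R * dl + sqdist x).
have -> : ln (u + sqdist x) - ln (t + sqdist x) = \sum_(i < m) (F i.+1 - F i).
  rewrite -(big_mkord xpredT (fun i => F i.+1 - F i)) telescope_sumr// /F mul0r addr0.
  have -> // : t + m%:R * dl = u by rewrite /dl; field; rewrite gt_eqF.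
rewrite -sumrB (le_trans (ler_norm_sum _ _ _))//.
apply: (@le_trans _ _ (\sum_(i < m) (dl / t) ^+ 2)).
  apply: ler_sum => i _.
  have ti : t <= t + i%:R * dl + sqdist x by rewrite -addrA lerDl addr_ge0// mulr_ge0.
  have ti0 := lt_le_trans t0 ti.
  have := ln_increment_bound ti0 dl0.
  have -> : t + i%:R * dl + sqdist x + dl = t + i.+1%:R * dl + sqdist x.
    by rewrite -(addn1 i) natrD; ring.
  move=> /le_trans; apply.
  have q1 : 0 <= dl / (t + i%:R * dl + sqdist x) by rewrite mulr_ge0// invr_ge0 ltW.
  have q2 : 0 <= dl / t by rewrite mulr_ge0// invr_ge0 ltW.
  by rewrite lerXn2r// ler_wpM2l// lef_pV2.
rewrite sumr_const card_ord (le_trans _ mC)//.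
rewrite /C /dl -mulr_natr le_eqVlt; apply/orP; left; apply/eqP.
by field; rewrite !gt_eqF.
Qed.

Variables al be : probability T R.
Local Notation D := (energy_form al be).

(** The form kills the constant ln u, and what remains is ln (1 + s / u), which is at most M / u. So
    the form tends to 0 as u grows. *)
Lemma energy_form_ln_sqdist_infty u M : 0 < u -> (forall x, sqdist x <= M) ->
  `|D (fun x => ln (u + sqdist x))| <= 4 * (M / u).
Proof.
move=> u0 hM; have bl := bounded_measurable_ln_sqdist u0.
rewrite -[D _]subr0 -(energy_form_cst al be (ln u)).
rewrite -energy_formB//; last exact: bounded_measurable_cst.
apply: energy_form_bounded.
  apply: (bounded_measurableD (g := fun=> - ln u)) => //.
  exact: bounded_measurable_cst.
move=> x; have s0 := sqdist_ge0 x.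
have us0 : 0 < u + sqdist x by rewrite ltr_wpDr.
rewrite ger0_norm; last by rewrite subr_ge0 ler_ln ?posrE// lerDl.
rewrite -ln_div ?posrE// mulrDl divff ?gt_eqF//.
have su0 : 0 <= sqdist x / u by rewrite divr_ge0// ltW.
rewrite (le_trans (le_ln1Dx _))//; first by rewrite (lt_le_trans _ su0)// oppr_lt0.
by rewrite ler_pM2r ?invr_gt0.
Qed.

Hypothesis ln_form_ge0 : forall t : R, 0 < t -> 0 <= D (fun x => ln (t + sqdist x)).

(** By [positive_ln_ratio] the form is nondecreasing in t, and it tends to 0 at infinity; hence it
    is at most 0. The hypothesis [ln_form_ge0] supplies the other sign. *)
Lemma energy_form_ln_sqdist_eq0 t : 0 < t -> D (fun x => ln (t + sqdist x)) = 0.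
Proof.
move=> t0; apply/eqP; rewrite eq_le ln_form_ge0// andbT.
have [M M0 hM] := sqdist_bound.
apply/ler_addgt0Pr => e e0; rewrite add0r.
pose u := Num.max t (4 * M / e).
have u0 : 0 < u by rewrite lt_max t0.
have tu : t <= u by rewrite le_max lexx.
have := positive_energy_form al be (positive_ln_ratio t0 tu).
rewrite energy_formB; [|exact: bounded_measurable_ln_sqdist..].
rewrite subr_ge0 => /le_trans; apply.
apply: le_trans (ler_norm _) _.
apply: le_trans (energy_form_ln_sqdist_infty u0 hM) _.
by rewrite mulrA ler_pdivrMr// [e * u]mulrC -ler_pdivrMr// le_max lexx orbT.
Qed.

(** 1 / (t + s) is the derivative in t of ln (t + s), whose form vanishes for every t > 0. The
    difference quotient is controlled by [ln_increment_bound]. *)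
Lemma energy_form_inv_sqdist_eq0 t : 0 < t -> D (fun x => (t + sqdist x)^-1) = 0.
Proof.
move=> t0; have bi := bounded_measurable_inv_sqdist t0.
apply/eqP; rewrite eq_le (positive_energy_form _ _ (positive_inv_sqdist t0)) andbT.
apply/ler_addgt0Pr => e e0; rewrite add0r.
(* Chosen so that the error 4 (dl / t)^2 equals dl e; dividing by dl leaves e. *)
pose dl := e * t ^+ 2 / 4.
have dl0 : 0 < dl by rewrite divr_gt0// mulr_gt0// exprn_gt0.
have bd : bounded_measurable (fun x => dl * (t + sqdist x)^-1).
  apply: (bounded_measurableM (f := fun=> dl)) => //.
  exact: bounded_measurable_cst.
have tdl : 0 < t + dl by rewrite addr_gt0.
have b1 := bounded_measurable_ln_sqdist t0.
have b2 := bounded_measurable_ln_sqdist tdl.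
have b3 : bounded_measurable
    (fun x => ln (t + dl + sqdist x) - ln (t + sqdist x)).
  exact/bounded_measurableD/bounded_measurableN.
have : `|D (fun x => (ln (t + dl + sqdist x) - ln (t + sqdist x))
                     - dl * (t + sqdist x)^-1)| <= 4 * (dl / t) ^+ 2.
  apply: energy_form_bounded; first exact/bounded_measurableD/bounded_measurableN.
  move=> x; have s0 := sqdist_ge0 x.
  have ts0 : t <= t + sqdist x by rewrite lerDl.
  have ts1 := lt_le_trans t0 ts0.
  have := ln_increment_bound ts1 (ltW dl0).
  rewrite [t + sqdist x + dl]addrAC => /le_trans; apply.
  have q1 : 0 <= dl / (t + sqdist x) by rewrite mulr_ge0 ?(ltW dl0)// invr_ge0 ltW.
  have q2 : 0 <= dl / t by rewrite mulr_ge0 ?(ltW dl0)// invr_ge0 ltW.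
  by rewrite lerXn2r// ler_wpM2l ?(ltW dl0)// lef_pV2.
rewrite !energy_formB// energy_formZ// !energy_form_ln_sqdist_eq0//.
rewrite subrr sub0r normrN ger0_norm; last first.
  by rewrite mulr_ge0 ?(ltW dl0)// positive_energy_form//; exact: positive_inv_sqdist.
have -> : 4 * (dl / t) ^+ 2 = dl * e.
  by rewrite /dl; field; rewrite gt_eqF.
by rewrite ler_pM2l.
Qed.

(** The vanishing form of 1 / (t + s) is a sum of nonnegative forms, those of the terms of the
    series and of the remainder, so each of them vanishes. The n-th term expands over all words f of
    length n in the three features into a sum of squares of differences of integrals, and again each
    square vanishes. *)
Lemma Rintegral_feature_eq t n (f : {ffun 'I_n -> 'I_3}) : 0 < t ->
  \int[al]_x (psi t x * \prod_i feature t (f i) x) =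
  \int[be]_x (psi t x * \prod_i feature t (f i) x).
Proof.
move=> t0; have bq := positive_psi_qkernel t0.
have bf i := bounded_measurable_feature t0 i.
have bp := bounded_measurable_psi t0.
have rest : positive_kernel (fun x => qkernel t x ^+ n.+1 / (t + sqdist x)).
  apply: positiveM; last exact: positive_inv_sqdist.
  exact/positiveX/positive_qkernel.
have D0 : D (fun x => t * (psi t x.1 * psi t x.2) * qkernel t x ^+ n) = 0.
  have := energy_form_inv_sqdist_eq0 t0.
  under eq_fun do rewrite (inv_sqdist_geometric t0 n.+1).
  rewrite energy_formD; [|by apply: bounded_measurable_sum => i; case: (bq i)|by case: rest].
  rewrite (@energy_form_sum _ _ _ al be _ _
    (fun (i : 'I_n.+1) x => t * (psi t x.1 * psi t x.2) * qkernel t x ^+ i)); last first.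
    by move=> i; case: (bq i).
  have p i := positive_energy_form al be (bq i).
  have := positive_energy_form al be rest => r0 /eqP.
  rewrite paddr_eq0//; last by rewrite sumr_ge0// => i _; exact: p.
  rewrite psumr_eq0; last by move=> i _; exact: p.
  by move=> /andP[/allP/(_ ord_max (mem_index_enum _))/= /eqP + _].
pose phi (g : {ffun 'I_n -> 'I_3}) x := psi t x * \prod_i feature t (g i) x.
have bphi g : bounded_measurable (phi g).
  by apply: bounded_measurableM => //; apply: bounded_measurable_prod.
have kE x : psi t x.1 * psi t x.2 * qkernel t x ^+ n =
    \sum_g phi g x.1 * phi g x.2.
  rewrite /qkernel -[n in LHS]card_ord -prodr_const bigA_distr_bigA mulr_sumr /=.
  by apply: eq_bigr => g _; rewrite /phi big_split/=; ring.
have bk : bounded_measurable (fun x => psi t x.1 * psi t x.2 * qkernel t x ^+ n).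
  by apply: featured_bounded_measurable; eexists; eexists; split; [exact: bphi|].
move: D0; under eq_fun do rewrite -mulrA.
rewrite energy_formZ// (featured_energy_form al be bphi kE) => /eqP.
rewrite mulf_eq0 gt_eqF//= psumr_eq0; last by move=> g _; exact: sqr_ge0.
move=> /allP/(_ f (mem_index_enum _))/=; rewrite sqrf_eq0 subr_eq0.
by move=> /eqP.
Qed.

Lemma Rintegral_psi_monomial t i j : 0 < t ->
  \int[al]_x (psi t x ^+ (i + j).+1 * (X x ^+ i * Y x ^+ j)) =
  \int[be]_x (psi t x ^+ (i + j).+1 * (X x ^+ i * Y x ^+ j)).
Proof.
move=> t0.
(* The word with i letters [X] followed by j letters [Y]; up to the factor [c] its product of
   features is the wanted monomial. *)
pose g : {ffun 'I_(i + j) -> 'I_3} :=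
  [ffun m : 'I_(i + j) => if (m < i)%N then inord 1 else inord 2].
pose c := Num.sqrt (2 * t) ^+ (i + j).
have c0 : c != 0 by rewrite expf_neq0// gt_eqF// sqrtr_gt0 mulr_gt0.
have bm : bounded_measurable
    (fun x => psi t x ^+ (i + j).+1 * (X x ^+ i * Y x ^+ j)).
  apply: bounded_measurableM.
    exact/bounded_measurableX/bounded_measurable_psi.
  by apply: bounded_measurableM; exact: bounded_measurableX.
have := Rintegral_feature_eq g t0.
have -> : (fun x => psi t x * \prod_m feature t (g m) x) =
    (fun x => c * (psi t x ^+ (i + j).+1 * (X x ^+ i * Y x ^+ j))).
  apply/funext => x; rewrite big_split_ord/=.
  have -> : \prod_(m < i) feature t (g (lshift j m)) x =
      (psi t x * (Num.sqrt (2 * t) * X x)) ^+ i.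
    rewrite -[i in RHS]card_ord -prodr_const; apply: eq_bigr => m _.
    by rewrite ffunE/= ltn_ord /feature inordK.
  have -> : \prod_(m < j) feature t (g (rshift i m)) x =
      (psi t x * (Num.sqrt (2 * t) * Y x)) ^+ j.
    rewrite -[j in RHS]card_ord -prodr_const; apply: eq_bigr => m _.
    by rewrite ffunE/= -ltn_subRL subnn ltn0 /feature inordK.
  by rewrite /c !exprMn !exprD exprS exprD; ring.
rewrite !RintegralZl//; [|exact: bounded_measurable_integrable..].
exact: mulfI.
Qed.

(** After multiplication by t^m the weight becomes (t psi)^m, which tends to 1 uniformly as t grows:
    1 - y^m is at most m (1 - y) for y in [0, 1], and 1 - t psi is at most M / t. *)
Lemma Rintegral_monomial_eq i j :
  \int[al]_x (X x ^+ i * Y x ^+ j) = \int[be]_x (X x ^+ i * Y x ^+ j).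
Proof.
have [M M0 hM] := sqnorm_bound.
pose h x := X x ^+ i * Y x ^+ j.
have bh : bounded_measurable h.
  by apply: bounded_measurableM; exact: bounded_measurableX.
have [_ [B hB]] := bh.
pose m := (i + j).+1.
have est t (P : probability T R) : 0 < t ->
    `|\int[P]_x h x - t ^+ m * \int[P]_x (psi t x ^+ m * h x)| <=
      `|B| * (m%:R * (M / t)).
  move=> t0.
  have bp : bounded_measurable (fun x => psi t x ^+ m * h x).
    apply: bounded_measurableM => //.
    exact/bounded_measurableX/bounded_measurable_psi.
  have bpt : bounded_measurable (fun x => t ^+ m * (psi t x ^+ m * h x)).
    by apply: (bounded_measurableM (f := fun=> _)) => //; exact: bounded_measurable_cst.
  rewrite -RintegralZl//; last exact: bounded_measurable_integrable.
  rewrite -RintegralB//; [|exact: bounded_measurable_integrable..].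
  apply: Rintegral_bounded; first exact/bounded_measurableD/bounded_measurableN.
  move=> x.
  have -> : h x - t ^+ m * (psi t x ^+ m * h x) = h x * (1 - (t * psi t x) ^+ m).
    by rewrite exprMn; ring.
  rewrite normrM.
  have s0 := sqnorm_ge0 x; have ts := tsq_gt0 t0 x.
  have y0 : 0 <= t * psi t x by rewrite mulr_ge0 ?invr_ge0 ?ltW.
  have y1 : t * psi t x <= 1 by rewrite ler_pdivrMr// mul1r lerDl.
  apply: ler_pM => //; first by rewrite (le_trans (hB x))// ler_norm.
  have yM : 1 - t * psi t x <= M / t.
    have -> : 1 - t * psi t x = sqnorm x / (t + sqnorm x).
      by rewrite /psi; field; rewrite gt_eqF.
    apply: ler_pM => //; first by rewrite invr_ge0 ltW.
    by rewrite lef_pV2 ?posrE// lerDl.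
  rewrite ger0_norm ?subr_ge0 ?exprn_ile1//.
  rewrite -[1 - _]opprB subrX1 -mulNr opprB mulrC; apply: ler_pM => //.
  - by rewrite sumr_ge0// => k _; rewrite exprn_ge0.
  - by rewrite subr_ge0.
  - rewrite (le_trans (y := \sum_(k < m) 1))//; last by rewrite sumr_const card_ord.
    by apply: ler_sum => k _; rewrite exprn_ile1.
change (\int[al]_x h x = \int[be]_x h x).
apply/eqP; rewrite -subr_eq0 -normr_le0; apply/ler_addgt0Pr => e e0; rewrite add0r.
pose C := 2 * (`|B| * (m%:R * M)).
have C0 : 0 <= C by rewrite /C !mulr_ge0// ltW.
(* The summand 1 keeps t positive when C = 0. *)
pose t := (C + 1) / e.
have t0 : 0 < t by rewrite divr_gt0// ltr_wpDl.
have := est t al t0; have := est t be t0.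
rewrite -(Rintegral_psi_monomial i j t0) -/m -/h.
set I := \int[al]_x h x; set K := \int[be]_x h x; set J := t ^+ m * _ => hK hI.
have -> : I - K = (I - J) - (K - J) by ring.
rewrite (le_trans (ler_normB _ _))// (le_trans (lerD hI hK))//.
have -> : `|B| * (m%:R * (M / t)) + `|B| * (m%:R * (M / t)) = C / t.
  by rewrite /C; field; rewrite gt_eqF.
by rewrite ler_pdivrMr// mulrC divfK ?gt_eqF// lerDl.
Qed.

End log_kernel.

(** * Logarithmic energy and potentials *)

Section energy.
Context d (T : measurableType d) (R : realType).
Variables X Y : T -> R.
Hypotheses (bX : bounded_measurable X) (bY : bounded_measurable Y).

(* C makes the logarithmic kernel and its truncations (for t <= 1) nonnegative. *)
Variable C : R.
Hypothesis C_ge : forall x, 2^-1 * ln (1 + sqdist X Y x) <= C.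

(** The kernel log (1 / |z - w|) shifted by [C], equal to [+oo] on the diagonal. The bounded kernels
    [logkt t] increase to it as t decreases to 0; the factor 1 / 2 there comes from working with
    squared distances. *)
Definition logk (x : T * T) : \bar R := (C%:E - lne (Num.sqrt (sqdist X Y x))%:E)%E.

Definition logkt t (x : T * T) : R := C - 2^-1 * ln (t + sqdist X Y x).

Lemma logkt_ge0 t x : 0 < t <= 1 -> 0 <= logkt t x.
Proof.
move=> /andP[t0 t1]; have s0 := sqdist_ge0 X Y x.
rewrite subr_ge0 (le_trans _ (C_ge x))// ler_pM2l ?invr_gt0//.
by rewrite ler_ln ?posrE ?lerD2r// ltr_wpDr.
Qed.

Lemma logkt_anti t u x : 0 < t <= u -> logkt u x <= logkt t x.
Proof.
move=> /andP[t0 tu]; have s0 := sqdist_ge0 X Y x.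
rewrite lerD2l lerN2 ler_pM2l ?invr_gt0//.
by rewrite ler_ln ?posrE ?lerD2r// ltr_wpDr// (lt_le_trans t0).
Qed.

Lemma logkE x : sqdist X Y x != 0 -> logk x = (C - 2^-1 * ln (sqdist X Y x))%:E.
Proof.
move=> sx; have s0 : 0 < sqdist X Y x by rewrite lt0r sx sqdist_ge0.
rewrite /logk lne_EFin ?sqrtr_gt0// -EFinB -powR12_sqrt ?ltW//.
by rewrite ln_powR mulrC.
Qed.

Lemma logk_diag x : sqdist X Y x = 0 -> logk x = +oo%E.
Proof. by move=> sx; rewrite /logk sx sqrtr0 le0_lneNy. Qed.

Lemma logkt_le t x : 0 < t -> ((logkt t x)%:E <= logk x)%E.
Proof.
move=> t0; have [s0|s0] := eqVneq (sqdist X Y x) 0.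
  by rewrite logk_diag// leey.
have sp : 0 < sqdist X Y x by rewrite lt0r s0 sqdist_ge0.
rewrite logkE// lee_fin lerD2l lerN2 ler_pM2l ?invr_gt0//.
have ts0 : 0 < t + sqdist X Y x by rewrite ltr_wpDl // ltW.
by rewrite ler_ln ?posrE// lerDr ltW.
Qed.

Lemma logk_ge0 x : (0 <= logk x)%E.
Proof.
by apply: le_trans (logkt_le x ltr01); rewrite lee_fin logkt_ge0// ltr01 lexx.
Qed.

Lemma logkt_cvg x : (fun n => (logkt n.+1%:R^-1 x)%:E) @ \oo --> logk x.
Proof.
have [s0|s0] := eqVneq (sqdist X Y x) 0.
  rewrite logk_diag// /logkt s0; apply/cvgeryP/cvgryPge => A.
  near=> n; rewrite addr0 lnV ?posrE ?ltr0n// mulrN opprK -lerBlDl.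
  rewrite mulrC ler_pdivlMr// -[leLHS]expRK ler_ln ?posrE ?expR_gt0 ?ltr0n//.
  rewrite ltW// (@lt_trans _ _ n%:R)// ?ltr_nat//.
  by near: n; exact: nbhs_infty_gtr.
have sp : 0 < sqdist X Y x by rewrite lt0r s0 sqdist_ge0.
rewrite logkE//; apply/cvg_EFin; first by near=> n.
apply: cvgB; first exact: cvg_cst.
apply: cvgMr; rewrite -[X in _ --> ln X]add0r.
have : (fun n => n.+1%:R^-1 + sqdist X Y x) @ \oo --> 0 + sqdist X Y x.
  by apply: cvgD; [exact: cvg_harmonic|exact: cvg_cst].
by move/(cvg_comp _ _)/(_ (continuous_ln _)); apply; rewrite add0r.
Unshelve. all: by end_near. Qed.

Lemma bounded_measurable_logkt t : 0 < t -> bounded_measurable (logkt t).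
Proof.
move=> t0; apply: (bounded_measurableD (f := fun=> C)).
  exact: bounded_measurable_cst.
apply: bounded_measurableN; apply: (bounded_measurableM (f := fun=> 2^-1)).
  exact: bounded_measurable_cst.
exact: bounded_measurable_ln_sqdist.
Qed.

Lemma measurable_logk : measurable_fun setT logk.
Proof.
apply: emeasurable_fun_cvg => [n|x _]; last exact: logkt_cvg.
by apply/measurable_EFinP; case: (bounded_measurable_logkt (t := n.+1%:R^-1)).
Qed.

(** Monotone convergence along t = 1 / (n + 1). The map [h] lets the same bound serve on a product
    space and on a slice where one point is fixed. *)
Lemma integral_logk_le d' (T' : measurableType d') (P : probability T' R)
    (h : T' -> T * T) (c : \bar R) : measurable_fun setT h ->
  (forall t, 0 < t <= 1 -> (\int[P]_x (logkt t (h x))%:E <= c)%E) ->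
  (\int[P]_x logk (h x) <= c)%E.
Proof.
move=> mh hc.
have ti n : 0 < (n.+1%:R^-1 : R) <= 1.
  by rewrite invr_gt0 ltr0n/= invf_le1 ?ltr0n// ler1n.
have -> : (\int[P]_x logk (h x) =
    \int[P]_x limn (fun n => (logkt n.+1%:R^-1 (h x))%:E))%E.
  by apply: eq_integral => x _; apply/esym/cvg_lim => //; exact: logkt_cvg.
have mk n : measurable_fun setT (fun x => (logkt n.+1%:R^-1 (h x))%:E).
  apply/measurable_EFinP.
  apply: (measurableT_comp (f := logkt n.+1%:R^-1)) => //.
  by case: (bounded_measurable_logkt (t := n.+1%:R^-1)).
have k0 n x : setT x -> (0 <= (logkt n.+1%:R^-1 (h x))%:E)%E.
  by move=> _; rewrite lee_fin logkt_ge0.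
have nd x : setT x -> {homo (fun n => (logkt n.+1%:R^-1 (h x))%:E) : m n /
    (m <= n)%N >-> (m <= n)%E}.
  move=> _ m n mn; rewrite lee_fin logkt_anti// invr_gt0 ltr0n/=.
  by rewrite lef_pV2 ?posrE ?ltr0n// ler_nat.
rewrite monotone_convergence//; apply: lime_le; last by apply: nearW => n; exact: hc.
apply: ereal_nondecreasing_is_cvgn => m n mn.
by apply: ge0_le_integral => //= x _; [exact: k0|exact: nd].
Qed.

(** * Comparison of two measures through their mutual energies *)

Section two_measures.
Variables al be : probability T R.

Definition mutual_energy (P Q : probability T R) : \bar R :=
  (\int[P]_z \int[Q]_w logk (z, w))%E.

Lemma mutual_energyE (P Q : probability T R) : mutual_energy P Q = (\int[(P \x Q)%E]_x logk x)%E.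
Proof.
rewrite /mutual_energy (fubini_tonelli1 logk)//; first exact: measurable_logk.
exact: logk_ge0.
Qed.

Lemma mutual_logkt_le t (P Q : probability T R) : 0 < t <= 1 ->
  ((\int[(P \x Q)%E]_x logkt t x)%:E <= mutual_energy P Q)%E.
Proof.
move=> t01; have /andP[t0 _] := t01; have bk := bounded_measurable_logkt t0.
rewrite /Rintegral fineK; last first.
  exact: (integrable_fin_num measurableT
    (bounded_measurable_integrable (P \x Q)%E bk)).
rewrite mutual_energyE; apply: ge0_le_integral => //.
- by move=> x _; rewrite lee_fin logkt_ge0.
- by apply/measurable_EFinP; case: bk.
- exact: measurable_logk.
- by move=> x _; exact: logkt_le.
Qed.

Lemma Rintegral_logkt_sym t (P Q : probability T R) : 0 < t <= 1 ->
  \int[(P \x Q)%E]_x logkt t x = \int[(Q \x P)%E]_x logkt t x.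
Proof.
move=> t01; have /andP[t0 _] := t01; have [mk _] := bounded_measurable_logkt t0.
have mk' : measurable_fun setT (EFin \o logkt t) by exact/measurable_EFinP.
have k0 x : (0 <= (EFin \o logkt t) x)%E by rewrite lee_fin logkt_ge0.
rewrite /Rintegral; congr fine.
rewrite [LHS](fubini_tonelli1 (EFin \o logkt t) mk' k0).
rewrite [RHS](fubini_tonelli2 (EFin \o logkt t) mk' k0).
apply: eq_integral => z _; apply: eq_integral => w _ /=.
by rewrite /logkt /sqdist/= -[X z - _]opprB sqrrN -[Y z - _]opprB sqrrN.
Qed.

Hypothesis fin : (mutual_energy be al < +oo)%E.
Hypothesis be_be : mutual_energy be be = mutual_energy be al.
Hypothesis al_al : (mutual_energy al al <= mutual_energy be be)%E.

(** Let Du be the form of [logkt u], which is - 1 / 2 times the form in question. It does not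
    decrease when u is replaced by v <= u, so 2 I_v(be, al) <= a + b - Du, where I_v is the
    truncated energy and a, b are the energies of [al] and [be]. Letting v tend to 0 and using I(be,
    al) = b gives Du <= a - b <= 0. *)
Lemma ln_form_ge0_of_energy t : 0 < t ->
  0 <= energy_form al be (fun x => ln (t + sqdist X Y x)).
Proof.
have me0 P Q : (0 <= mutual_energy P Q)%E.
  by do 2 (apply: integral_ge0 => ? _); exact: logk_ge0.
have fP P Q : (mutual_energy P Q < +oo)%E -> mutual_energy P Q \is a fin_num.
  by move=> h; rewrite ge0_fin_numE.
have logE u : 0 < u -> energy_form al be (logkt u) =
    - (2^-1 * energy_form al be (fun x => ln (u + sqdist X Y x))).
  move=> u0; rewrite /logkt.
  have b := bounded_measurable_ln_sqdist bX bY u0.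
  rewrite energy_formB ?energy_form_cst ?energy_formZ ?sub0r//.
    exact: bounded_measurable_cst.
  apply: (bounded_measurableM (f := fun=> 2^-1)) => //.
  exact: bounded_measurable_cst.
have mono u v : 0 < u -> u <= v ->
    energy_form al be (fun x => ln (u + sqdist X Y x)) <=
    energy_form al be (fun x => ln (v + sqdist X Y x)).
  move=> u0 uv; have v0 := lt_le_trans u0 uv.
  have := positive_energy_form al be (positive_ln_ratio bX bY u0 uv).
  rewrite energy_formB; [|exact: bounded_measurable_ln_sqdist..].
  by rewrite subr_ge0.
have [fab fbb faa] : [/\ mutual_energy be al \is a fin_num,
    mutual_energy be be \is a fin_num & mutual_energy al al \is a fin_num].
  by split; apply: fP; rewrite ?be_be// (le_lt_trans al_al)// be_be.
(* The truncated kernels are known to be nonnegative only for t <= 1; larger t follows by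
   monotonicity. *)
suff main u : 0 < u <= 1 -> 0 <= energy_form al be (fun x => ln (u + sqdist X Y x)).
  move=> t0; have [t1|/ltW t1] := leP t 1; first by apply: main; rewrite t0.
  by apply: le_trans (mono _ _ ltr01 t1); apply: main; rewrite ltr01 lexx.
move=> /andP[u0 u1].
pose a := fine (mutual_energy al al); pose b := fine (mutual_energy be be).
pose Du := energy_form al be (logkt u).
suff : Du <= 0 by rewrite /Du logE// oppr_le0 pmulr_rge0// invr_gt0.
have ab : a <= b by rewrite fine_le.
suff : (mutual_energy be al <= ((a + b - Du) / 2)%:E)%E.
  rewrite -be_be -(fineK fbb) -/b lee_fin; lra.
(* All r <= 1 have to be treated; for r > u the kernel at r lies below the one at u. *)
rewrite mutual_energyE; apply: (integral_logk_le (h := id)) => // r /andP[r0 r1].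
have est v : 0 < v -> v <= u ->
    \int[(be \x al)%E]_x logkt v x <= (a + b - Du) / 2.
  move=> v0 vu; have v01 : 0 < v <= 1 by rewrite v0 (le_trans vu).
  have : Du <= energy_form al be (logkt v).
    by rewrite /Du !logE// lerN2 ler_pM2l ?invr_gt0// mono.
  have ha : \int[(al \x al)%E]_x logkt v x <= a.
    by rewrite -lee_fin /a (fineK faa) mutual_logkt_le.
  have hb : \int[(be \x be)%E]_x logkt v x <= b.
    by rewrite -lee_fin /b (fineK fbb) mutual_logkt_le.
  rewrite /energy_form (Rintegral_logkt_sym al be v01); lra.
have bk v : 0 < v -> (be \x al)%E.-integrable setT (EFin \o logkt v).
  by move=> v0; exact/bounded_measurable_integrable/bounded_measurable_logkt.
rewrite -[leLHS](@fineK _); last exact: (integrable_fin_num measurableT (bk _ r0)).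
rewrite lee_fin; have [tu|/ltW ut] := leP r u; first exact: est.
apply: le_trans (est u u0 (lexx _)).
apply: le_Rintegral => //; [exact: bk..|] => x _.
by apply: logkt_anti; rewrite u0.
Qed.

Lemma Rintegral_monomial_of_energy i j :
  \int[al]_x (X x ^+ i * Y x ^+ j) = \int[be]_x (X x ^+ i * Y x ^+ j).
Proof. exact: Rintegral_monomial_eq bX bY _ _ ln_form_ge0_of_energy i j. Qed.

End two_measures.

Definition potential (P : probability T R) z : \bar R := (\int[P]_w logk (z, w))%E.

Lemma measurable_logk2 z : measurable_fun setT (fun w => logk (z, w)).
Proof.
by apply: (measurableT_comp measurable_logk); exact: measurable_pair1.
Qed.

Lemma potential_ge0 P z : (0 <= potential P z)%E.
Proof. by apply: integral_ge0 => w _; exact: logk_ge0. Qed.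

Lemma measurable_potential P : measurable_fun setT (potential P).
Proof.
apply: (measurable_fun_fubini_tonelli_F logk); first exact: measurable_logk.
exact: logk_ge0.
Qed.

(** * Boundedness of the potential of a minimising measure *)

Section bounded_potential.
Variable mu : probability T R.

(* Weak maximum principle: compare the potential at [u] with the potential at
   a nearly closest point [z] of [A]. *)
Lemma potential_le_of_le_on A (n : R) u : measurable A -> mu (~` A) = 0%E ->
  A !=set0 -> (forall z, A z -> (potential mu z <= n%:E)%E) ->
  (potential mu u <= (n + ln 4 / 2)%:E)%E.
Proof.
move=> mA A1 [z0 Az0] An.
apply: (integral_logk_le (h := fun w => (u, w))).
  exact: measurable_pair1.
move=> t t01; have /andP[t0 t1] := t01.
pose I := [set sqdist X Y (u, w) | w in A].
have I0 : has_inf I.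
  split; first by exists (sqdist X Y (u, z0)); exists z0.
  by exists 0 => _ [w _ <-]; exact: sqdist_ge0.
have [_ [z Az <-] zI] := inf_adherent t0 I0.
have key w : A w -> sqdist X Y (u, z) <= sqdist X Y (u, w) + t.
  move=> Aw; rewrite (le_trans (ltW zI))// lerD2r.
  by apply: ge_inf; [case: I0|exists w].
have bk (v : T) : measurable_fun setT (fun w => (logkt t (v, w))%:E).
  apply/measurable_EFinP.
  apply: (measurableT_comp (f := logkt t)); first by case: (bounded_measurable_logkt t0).
  exact: measurable_pair1.
have l4 : 0 <= ln 4 / 2 :> R by rewrite divr_ge0// ln_ge0// ler1n.
apply: (@le_trans _ _ (\int[mu]_w (logk (z, w) + (ln 4 / 2)%:E))%E).
  apply: ae_ge0_le_integral => //.
  - by move=> w _; rewrite lee_fin logkt_ge0.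
  - by move=> w _; rewrite adde_ge0// logk_ge0.
  - by apply: emeasurable_funD => //; exact: measurable_logk2.
  exists (~` A); split => //; first exact: measurableC.
  move=> w /= + Aw; apply => _.
  apply: le_trans (leeD2r _ (logkt_le (z, w) t0)).
  have s1 := sqdist_ge0 X Y (u, w); have s2 := sqdist_ge0 X Y (z, w).
  (* By the parallelogram law |z - w|^2 <= 2 |u - z|^2 + 2 |u - w|^2, and the choice of z bounds
     this by 4 |u - w|^2 + 2 t. This is the origin of the constant ln 4 / 2. *)
  have : ln (t + sqdist X Y (z, w)) <= ln (t + sqdist X Y (u, w)) + ln 4.
    rewrite -lnM ?posrE ?ltr_wpDr// ler_ln ?posrE ?mulr_gt0 ?ltr_wpDr//.
    have := key _ Aw; rewrite /sqdist/= => k1.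
    have := sqr_ge0 (X u - X z + (X u - X w)).
    have := sqr_ge0 (Y u - Y z + (Y u - Y w)).
    by nra.
  by rewrite -EFinD lee_fin /logkt; lra.
rewrite ge0_integralD//; last 2 first.
- by move=> w _; exact: logk_ge0.
- exact: measurable_logk2.
rewrite integral_cst// [X in (_ * X)%E](@probability_setT _ _ _ mu) mule1.
by rewrite EFinD leeD2r// An.
Qed.

Hypothesis fin : (mutual_energy mu mu < +oo)%E.
Hypothesis minimal : forall A, measurable A -> (0 < mu A)%E ->
  (mutual_energy mu mu * (mu A * mu A) <=
   \int[mu]_(z in A) \int[mu]_(w in A) logk (z, w))%E.

(* If the potential exceeded [n] on a set of measure [dl], then removing this
   set would lower the energy by at least [n * dl], hence also lower the
   energy of the normalised restriction. *)
Lemma potential_bounded : exists M : R, forall u, (potential mu u <= M%:E)%E.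
Proof.
have G0 : (0 <= mutual_energy mu mu)%E.
  by apply: integral_ge0 => z _; exact: potential_ge0.
have Gfin : mutual_energy mu mu \is a fin_num by rewrite ge0_fin_numE.
pose g := fine (mutual_energy mu mu).
have g0 : 0 <= g by exact: fine_ge0.
have Gg : mutual_energy mu mu = g%:E by rewrite fineK.
(* With this level, the final inequality g (1 - dl)^2 + n dl <= g reads g dl^2 + dl <= 0, which
   forces dl = 0. *)
pose n := 2 * g + 1.
pose A := [set z | (potential mu z <= n%:E)%E].
have mp := measurable_potential mu.
have mA : measurable A.
  by rewrite -[A]setTI; exact: emeasurable_fun_infty_c.
have mAC : measurable (~` A) by exact: measurableC.
pose dl := fine (mu (~` A)).
have dlE : mu (~` A) = dl%:E by rewrite fineK// fin_num_measure.
have dl0 : 0 <= dl by rewrite fine_ge0// measure_ge0.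
have muA : mu A = (1 - dl)%:E.
  have := probability_setC mu mAC; rewrite setCK dlE => ->.
  by rewrite EFinB.
have split_G : (mutual_energy mu mu = \int[mu]_(z in A) potential mu z +
    \int[mu]_(z in ~` A) potential mu z)%E.
  rewrite -ge0_integral_setU//.
  - by rewrite setUv.
  - exact: measurable_funS mp.
  - by move=> z _; exact: potential_ge0.
  - by apply/disj_setPS; rewrite setICr.
have lowC : (n%:E * dl%:E <= \int[mu]_(z in ~` A) potential mu z)%E.
  rewrite -dlE -integral_cst//; apply: ge0_le_integral => //.
  - by move=> z _; rewrite lee_fin addr_ge0// mulr_ge0.
  - by apply: measurable_funS mp.
  - by move=> z /negP; rewrite -ltNge => /ltW.
have iA0 : (0 <= \int[mu]_(z in A) potential mu z)%E.
  by apply: integral_ge0 => z _; exact: potential_ge0.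
(* So that [A] has positive measure, as [minimal] requires. *)
have dl1 : dl < 1.
  have : (n%:E * dl%:E <= g%:E)%E.
    by rewrite -Gg split_G (le_trans lowC)// leeDr.
  rewrite -EFinM lee_fin /n => h.
  by rewrite ltNge; apply/negP => h1; move: h; nra.
have lowA : (g%:E * ((1 - dl)%:E * (1 - dl)%:E) <=
    \int[mu]_(z in A) potential mu z)%E.
  rewrite -Gg -muA; apply: le_trans (minimal mA _) _.
    by rewrite muA lte_fin subr_gt0.
  apply: ge0_le_integral => //.
  - by move=> z _; apply: integral_ge0 => w _; exact: logk_ge0.
  - apply: (measurable_funS measurableT) => //.
    have mr : measurable_fun setT (fun x : T * T => logk x * (\1_A x.2)%:E)%E.
      apply: emeasurable_funM; first exact: measurable_logk.
      apply/measurable_EFinP.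
      rewrite -[X in measurable_fun _ X]/((\1_A : T -> R) \o snd).
      apply: measurableT_comp; first exact: measurable_indic.
      exact: measurable_snd.
    have -> : (fun z => \int[mu]_(w in A) logk (z, w))%E =
        (fun z => \int[mu]_w (logk (z, w) * (\1_A w)%:E))%E.
      apply/funext => z; rewrite integral_mkcond epatch_indic.
      by apply: eq_integral.
    apply: (measurable_fun_fubini_tonelli_F (fun x => logk x * (\1_A x.2)%:E)%E) => // x.
    by rewrite mule_ge0 ?logk_ge0// lee_fin.
  - exact: measurable_funS mp.
  - move=> z _; apply: ge0_subset_integral => //; first exact: measurable_logk2.
    by move=> w _; exact: logk_ge0.
have dl00 : dl = 0.
  have : (g%:E * ((1 - dl)%:E * (1 - dl)%:E) + n%:E * dl%:E <= g%:E)%E.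
    by rewrite -[leRHS]Gg split_G leeD.
  rewrite -!EFinM -EFinD lee_fin /n => h.
  by apply/eqP; rewrite eq_le dl0 andbT; nra.
have AC0 : mu (~` A) = 0%E by rewrite dlE dl00.
exists (n + ln 4 / 2) => u; apply: (@potential_le_of_le_on A n u) => //.
apply/set0P/negP => /eqP A0; move: muA; rewrite A0 measure0 dl00 subr0.
by move/eqP; rewrite eqe eq_sym oner_eq0.
Qed.

End bounded_potential.

Lemma mutual_energy_atom (mu : probability T R) a : measurable [set a] ->
  (0 < mu [set a])%E -> mutual_energy mu mu = +oo%E.
Proof.
move=> ma a0.
have pa : potential mu a = +oo%E.
  apply/eqP; rewrite -leye_eq.
  apply: (@le_trans _ _ (\int[mu]_(w in [set a]) logk (a, w))%E); last first.
    apply: ge0_subset_integral => //; first exact: measurable_logk2.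
    by move=> w _; exact: logk_ge0.
  rewrite (eq_integral (cst +oo%E)); last first.
    move=> w; rewrite inE => /= ->; apply: logk_diag.
    by rewrite /sqdist/= !subrr expr0n addr0.
  by rewrite integral_cst// gt0_mulye.
apply/eqP; rewrite -leye_eq.
apply: (@le_trans _ _ (\int[mu]_(w in [set a]) potential mu w)%E); last first.
  apply: ge0_subset_integral => //; first exact: measurable_potential.
  by move=> w _; exact: potential_ge0.
rewrite (eq_integral (cst +oo%E)); last by move=> w; rewrite inE => /= ->.
by rewrite integral_cst// gt0_mulye.
Qed.

End energy.

(** * Complex modulus and measurability *)

Section complex_modulus.
Context (R : realType).
Implicit Types (z w : R[i]) (p q : {poly R[i]}).

Lemma cabs_ge0 z : 0 <= cabs z.
Proof. by case: z => a b; exact: sqrtr_ge0. Qed.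

Lemma cabs0 : cabs (0 : R[i]) = 0.
Proof. exact: Normc.normc0. Qed.

Lemma cabs_eq0 z : (cabs z == 0) = (z == 0).
Proof.
apply/eqP/eqP => [|->]; last exact: cabs0.
exact: Normc.eq0_normc.
Qed.

Lemma cabs_gt0 z : (0 < cabs z) = (z != 0).
Proof. by rewrite lt0r cabs_eq0 cabs_ge0 andbT. Qed.

Lemma cabs1 : cabs (1 : R[i]) = 1.
Proof. exact: Normc.normc1. Qed.

Lemma cabsM z w : cabs (z * w) = cabs z * cabs w.
Proof. exact: Normc.normcM. Qed.

Lemma cabsV z : cabs z^-1 = (cabs z)^-1.
Proof. exact: Normc.normcV. Qed.

Lemma cabsN z : cabs (- z) = cabs z.
Proof. exact: normcN. Qed.

Lemma cabsD z w : cabs (z + w) <= cabs z + cabs w.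
Proof. exact: le_normcD. Qed.

Lemma cabsB z w : cabs (z - w) = cabs (w - z).
Proof. by rewrite -opprB cabsN. Qed.

Lemma cabsB_triangle u z w : cabs (z - w) <= cabs (z - u) + cabs (u - w).
Proof. by rewrite -(subrKA u) cabsD. Qed.

Lemma cabsX z n : cabs (z ^+ n) = cabs z ^+ n.
Proof. by elim: n => [|n IH]; rewrite ?expr0 ?cabs1// !exprS cabsM IH. Qed.

Lemma cabs_prod (I : Type) (s : seq I) (F : I -> R[i]) :
  cabs (\prod_(i <- s) F i) = \prod_(i <- s) cabs (F i).
Proof. by elim: s => [|i s IH]; rewrite ?big_nil ?cabs1// !big_cons cabsM IH. Qed.

Lemma cabs_sum (I : Type) (s : seq I) (F : I -> R[i]) :
  cabs (\sum_(i <- s) F i) <= \sum_(i <- s) cabs (F i).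
Proof.
elim: s => [|i s IH]; rewrite ?big_nil ?cabs0// !big_cons.
by rewrite (le_trans (cabsD _ _))// lerD2l.
Qed.

Lemma cabsE z : cabs z = Num.sqrt (complex.Re z ^+ 2 + complex.Im z ^+ 2).
Proof. by case: z. Qed.

Lemma cabs_sqr z : cabs z ^+ 2 = complex.Re z ^+ 2 + complex.Im z ^+ 2.
Proof. by rewrite cabsE sqr_sqrtr// addr_ge0// sqr_ge0. Qed.

Lemma Re_le_cabs z : `|complex.Re z| <= cabs z.
Proof.
by rewrite -sqrtr_sqr cabsE ler_wsqrtr// lerDl sqr_ge0.
Qed.

Lemma Im_le_cabs z : `|complex.Im z| <= cabs z.
Proof.
by rewrite -sqrtr_sqr cabsE ler_wsqrtr// lerDr sqr_ge0.
Qed.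

Lemma cabs_le_ReIm z : cabs z <= `|complex.Re z| + `|complex.Im z|.
Proof.
rewrite -(@ler_pXn2r _ 2)// ?nnegrE ?cabs_ge0 ?addr_ge0//.
rewrite cabs_sqr -(real_normK (num_real (complex.Re z))).
rewrite -(real_normK (num_real (complex.Im z))).
have := normr_ge0 (complex.Re z); have := normr_ge0 (complex.Im z); nra.
Qed.

Lemma cabs_horner_le p z : cabs p.[z] <= \sum_(i < size p) cabs p`_i * cabs z ^+ i.
Proof.
rewrite horner_coef (le_trans (cabs_sum _ _))//.
by apply: ler_sum => i _; rewrite cabsM cabsX.
Qed.

(** Write p - p(z) = q (X - z) and bound q on the unit disc around z by its coefficients. *)
Lemma poly_local_lipschitz p z : exists2 M, 0 < M &
  forall w, cabs (w - z) <= 1 -> cabs (p.[w] - p.[z]) <= M * cabs (w - z).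
Proof.
have /factor_theorem [q pq] : root (p - p.[z]%:P) z.
  by rewrite /root hornerD hornerN hornerC subrr.
pose M := \sum_(i < size q) cabs q`_i * (cabs z + 1) ^+ i.
have M0 : 0 <= M.
  by rewrite sumr_ge0// => i _; rewrite mulr_ge0 ?exprn_ge0 ?addr_ge0 ?cabs_ge0.
exists (M + 1) => [|w wz]; first by rewrite ltr_wpDl.
have -> : p.[w] - p.[z] = q.[w] * (w - z).
  by have := congr1 (horner^~ w) pq; rewrite !hornerE.
rewrite cabsM ler_wpM2r ?cabs_ge0// (le_trans (cabs_horner_le _ _))//.
rewrite (@le_trans _ _ M) ?lerDl//; apply: ler_sum => i _.
rewrite ler_wpM2l ?cabs_ge0// lerXn2r ?nnegrE ?addr_ge0 ?cabs_ge0//.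
by rewrite -[w](subrK z) addrC (le_trans (cabsD _ _))// lerD2l.
Qed.

Lemma monic_split p : p \is monic ->
  exists s : seq R[i], p = \prod_(z <- s) ('X - z%:P).
Proof.
move=> pm; have [s ps] := closed_field_poly_normal p.
by exists s; rewrite ps (monicP pm) scale1r.
Qed.

Lemma horner_prod_XsubC_cabs (s : seq R[i]) u :
  cabs (\prod_(z <- s) ('X - z%:P)).[u] = \prod_(z <- s) cabs (u - z).
Proof. by rewrite horner_prod cabs_prod; under eq_bigr do rewrite hornerXsubC. Qed.

(** If all n roots were at distance at least e from u, the product of these distances, which is
    |p(u)|, would be at least e^n. This is the quantitative continuity of roots behind both the
    measurable selection and the openness of polynomial maps. *)
Lemma exists_close_root p n u e : p \is monic -> size p = n.+1 -> 0 < e ->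
  cabs p.[u] < e ^+ n -> exists2 z, root p z & cabs (u - z) < e.
Proof.
move=> pm + e0; have [s ->] := monic_split pm.
rewrite size_prod_XsubC => -[<-]; rewrite horner_prod_XsubC_cabs => h.
apply: contrapT => nex; move: h; apply/negP; rewrite -leNgt.
have : {in s, forall z, e <= cabs (u - z)}.
  move=> z zs; rewrite leNgt; apply/negP => uz; apply: nex.
  by exists z => //; rewrite root_prod_XsubC.
elim: s {pm nex} => [|z s IH] h; first by rewrite big_nil.
rewrite big_cons /= exprS ler_pM ?exprn_ge0 ?(ltW e0)//.
  by apply: h; rewrite inE eqxx.
by apply: IH => w ws; apply: h; rewrite inE ws orbT.
Qed.

(** An enumeration of the Gaussian rationals, so that a selection can take the least admissible
    index; codes of no pair give 0. *)
Definition rat_complex (k : nat) : R[i] :=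
  if unpickle k is Some (a, b) then Complex (ratr a) (ratr b) else 0.

Lemma rat_complex_dense z e : 0 < e -> exists k, cabs (rat_complex k - z) < e.
Proof.
move=> e0; have e2 : 0 < e / 2 by rewrite divr_gt0.
have near (x : R) : exists a : rat, `|ratr a - x| < e / 2.
  have [a] := @rat_in_itvoo _ (x - e / 2) (x + e / 2) ltac:(lra).
  by rewrite in_itv/= => /andP[? ?]; exists a; rewrite ltr_norml; lra.
have [a ha] := near (complex.Re z); have [b hb] := near (complex.Im z).
exists (pickle (a, b)); rewrite /rat_complex pickleK.
apply: le_lt_trans (cabs_le_ReIm _) _.
rewrite [e]splitr; case: z ha hb => x y /= ha hb; exact: ltrD.
Qed.

End complex_modulus.

Section complex_measurable.
Context d (T : measurableType d) (R : realType).
Implicit Types f g : T -> R[i].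

(** Stated by components so that real measurability applies; [complex_measurable_borel] below
    recovers measurability into [borelC R]. *)
Definition complex_measurable f :=
  measurable_fun setT (fun t => complex.Re (f t)) /\
  measurable_fun setT (fun t => complex.Im (f t)).

Lemma complex_measurable_cst c : complex_measurable (fun=> c).
Proof. by []. Qed.

Lemma complex_measurableD f g : complex_measurable f -> complex_measurable g ->
  complex_measurable (fun t => f t + g t).
Proof.
move=> [f1 f2] [g1 g2]; split.
  rewrite (_ : (fun _ => _) = (fun t => complex.Re (f t) + complex.Re (g t))).
    exact: measurable_funD.
  by apply/funext => t; case: (f t) => ? ?; case: (g t).
rewrite (_ : (fun _ => _) = (fun t => complex.Im (f t) + complex.Im (g t))).
  exact: measurable_funD.
by apply/funext => t; case: (f t) => ? ?; case: (g t).
Qed.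

Lemma complex_measurableM f g : complex_measurable f -> complex_measurable g ->
  complex_measurable (fun t => f t * g t).
Proof.
move=> [f1 f2] [g1 g2]; split.
  rewrite (_ : (fun _ => _) = (fun t => complex.Re (f t) * complex.Re (g t) -
      complex.Im (f t) * complex.Im (g t))).
    by apply: measurable_funB; exact: measurable_funM.
  by apply/funext => t; case: (f t) => ? ?; case: (g t).
rewrite (_ : (fun _ => _) = (fun t => complex.Re (f t) * complex.Im (g t) +
      complex.Im (f t) * complex.Re (g t))).
  by apply: measurable_funD; exact: measurable_funM.
by apply/funext => t; case: (f t) => ? ?; case: (g t).
Qed.

Lemma complex_measurableN f : complex_measurable f ->
  complex_measurable (fun t => - f t).
Proof.
move=> /(complex_measurableM (complex_measurable_cst (-1))).
by under eq_fun do rewrite mulN1r.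
Qed.

Lemma complex_measurableX f n : complex_measurable f ->
  complex_measurable (fun t => f t ^+ n).
Proof.
move=> mf; elim: n => [|n IH]; first exact: complex_measurable_cst.
by under eq_fun do rewrite exprS; exact: complex_measurableM.
Qed.

Lemma complex_measurable_sum (I : Type) (s : seq I) (f : I -> T -> R[i]) :
  (forall i, complex_measurable (f i)) ->
  complex_measurable (fun t => \sum_(i <- s) f i t).
Proof.
move=> mf; elim: s => [|i s IH].
  by under eq_fun do rewrite big_nil; exact: complex_measurable_cst.
by under eq_fun do rewrite big_cons; exact: complex_measurableD.
Qed.

Lemma measurable_cabs f : complex_measurable f ->
  measurable_fun setT (fun t => cabs (f t)).
Proof.
move=> [f1 f2].
rewrite (_ : (fun _ => _) =
    (fun t => (complex.Re (f t) ^+ 2 + complex.Im (f t) ^+ 2) `^ 2^-1)).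
  apply: (@measurableT_comp _ _ _ _ _ _ (fun x : R => x `^ 2^-1)).
    exact: measurable_powR.
  by apply: measurable_funD; exact: measurable_funX.
by apply/funext => t; rewrite powR12_sqrt ?addr_ge0 ?sqr_ge0// cabsE.
Qed.

Lemma complex_measurable_horner (q : T -> {poly R[i]}) n f :
  (forall t, (size (q t) <= n)%N) ->
  (forall i, complex_measurable (fun t => (q t)`_i)) ->
  complex_measurable f -> complex_measurable (fun t => (q t).[f t]).
Proof.
move=> qn mq mf.
rewrite (_ : (fun _ => _) = (fun t => \sum_(i < n) (q t)`_i * f t ^+ i)).
  apply: complex_measurable_sum => i; apply: complex_measurableM => //.
  exact: complex_measurableX.
by apply/funext => t; rewrite (horner_coef_wide _ (qn t)).
Qed.

(** The least index equals k exactly on the set of [P k] with the sets of all earlier [P j]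
    removed. *)
Lemma measurable_ex_minn (P : nat -> T -> bool)
    (exP : forall t, exists k, P k t) (e : nat -> R) :
  (forall k, measurable [set t | P k t]) ->
  measurable_fun setT (fun t => e (ex_minn (exP t))).
Proof.
move=> mP _ Y mY; rewrite setTI.
rewrite (_ : _ @^-1` _ = \bigcup_(k in [set k | Y (e k)])
    ([set t | P k t] `&` \bigcap_(j in `I_k) ~` [set t | P j t])).
  apply: bigcup_measurable => k _; apply: measurableI => //.
  by apply: bigcap_measurableType => j _; exact: measurableC.
apply/seteqP; split=> t /=.
  case: ex_minnP => k Pk kmin Yk; exists k => //; split=> // j /= jk Pj.
  by have := kmin _ Pj; rewrite leqNgt jk.
move=> [k Yk [Pk jP]]; case: ex_minnP => m Pm mmin.
have [mk|km|->//] := ltngtP m k; first by have /= := jP m mk; rewrite Pm.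
by have := mmin _ Pk; rewrite leqNgt km.
Qed.

End complex_measurable.

(** * Measurable choice of the roots *)

(** Synthetic division: q_i = p_(i+1) + r q_(i+1), unrolled from the top coefficient. It serves both
    for the measurability of quotients and for Newton's identities. *)
Lemma quotient_XsubC_coef (R : comNzRingType) (p q : {poly R}) r j m :
  p = ('X - r%:P) * q -> (size q <= m + j)%N ->
  q`_j = \sum_(k < m) p`_(j.+1 + k) * r ^+ k.
Proof.
move=> pq; have step i : q`_i = p`_i.+1 + r * q`_i.+1.
  by rewrite pq mulrBl coefB coefXM coefCM /= subrK.
elim: m j => [|m IH] j; first by rewrite big_ord0; exact: nth_default.
move=> qm; rewrite step (IH j.+1) ?addnS// big_ord_recl expr0 mulr1 addn0.
rewrite mulr_sumr; congr (_ + _); apply: eq_bigr => k _.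
by rewrite /= /bump /= add1n addnS exprS; ring.
Qed.

Section measurable_roots.
Context d (T : measurableType d) (R : realType).

Lemma measurable_lt_cst (f : T -> R) a : measurable_fun setT f ->
  measurable [set t | f t < a].
Proof.
move=> mf; rewrite -[X in measurable X]setTI.
have := mf measurableT `]-oo, a[%classic (measurable_itv _).
by rewrite preimage_itvNyo.
Qed.

Lemma measurable_selection (Q : R[i] -> T -> bool) :
  (forall c, measurable [set t | Q c t]) ->
  (forall t, exists k, Q (rat_complex R k) t) ->
  exists2 u : T -> R[i], complex_measurable u & forall t, Q (u t) t.
Proof.
move=> mQ exQ; exists (fun t => rat_complex R (ex_minn (exQ t))).
  split.
    apply: (measurable_ex_minn (P := fun k => Q (rat_complex R k)) exQ
      (fun k => complex.Re (rat_complex R k))) => k; exact: mQ.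
  apply: (measurable_ex_minn (P := fun k => Q (rat_complex R k)) exQ
    (fun k => complex.Im (rat_complex R k))) => k; exact: mQ.
by move=> t; case: ex_minnP.
Qed.

Section one_root.
Variables (n : nat) (q : T -> {poly R[i]}).
Hypothesis q_monic : forall t, q t \is monic.
Hypothesis size_q : forall t, size (q t) = n.+2.
Hypothesis mq : forall i, complex_measurable (fun t => (q t)`_i).

Let mq_horner f : complex_measurable f ->
  complex_measurable (fun t => (q t).[f t]).
Proof. by apply: (@complex_measurable_horner _ _ _ _ n.+2) => // t; rewrite size_q. Qed.

Let root_approx t z a e : root (q t) z -> 0 < a -> 0 < e ->
  exists k, cabs (q t).[rat_complex R k] < a /\ cabs (rat_complex R k - z) < e.
Proof.
move=> /rootP qz a0 e0; have [M M0 hM] := poly_local_lipschitz (q t) z.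
have m0 : 0 < Num.min 1 (Num.min e (a / M)) by rewrite !lt_min ltr01 e0 divr_gt0.
have [k hk] := rat_complex_dense z m0; exists k.
move: hk; rewrite !lt_min => /and3P[h1 h2 h3]; split=> //.
have := hM _ (ltW h1); rewrite qz subr0 => /le_lt_trans; apply.
by rewrite mulrC -ltr_pdivlMr.
Qed.

Let dl (m : nat) : R := 2^-1 ^+ m.

Let dl0 m : 0 < dl m. Proof. by rewrite exprn_gt0// invr_gt0. Qed.

(** The exponent is the degree n + 1 of [q t]: by [exists_close_root], a value below dl^(n+1)
    guarantees a true root within [dl m], near which the next approximant can be taken. *)
Let approx m := [set u : T -> R[i] | complex_measurable u /\
  forall t, cabs (q t).[u t] < dl m ^+ n.+1].

Let approx0 : exists u, approx 0 u.
Proof.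
have [c|t|u mu hu] := @measurable_selection (fun c t => cabs (q t).[c] < dl 0 ^+ n.+1).
- by apply: measurable_lt_cst; apply: measurable_cabs; exact: mq_horner.
- have [s qs] := monic_split (q_monic t).
  have : size (q t) = n.+2 by []; case: s qs => [|z s] qs.
    by rewrite qs big_nil size_poly1.
  have qz : root (q t) z by rewrite qs root_prod_XsubC inE eqxx.
  have [k [hk _]] := root_approx qz (exprn_gt0 n.+1 (dl0 0)) ltr01.
  by exists k.
- by exists u.
Qed.

Let approxS m u : approx m u ->
  exists2 v, approx m.+1 v & forall t, cabs (v t - u t) < dl m.
Proof.
move=> [mu hu].
have [c|t|v mv hv] := @measurable_selection
    (fun c t => (cabs (q t).[c] < dl m.+1 ^+ n.+1) && (cabs (c - u t) < dl m)).
- rewrite (_ : [set _ | _] = [set t | cabs (q t).[c] < dl m.+1 ^+ n.+1] `&`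
      [set t | cabs (c - u t) < dl m]).
    apply: measurableI; apply: measurable_lt_cst; apply: measurable_cabs.
      exact: mq_horner.
    exact/complex_measurableD/complex_measurableN.
  by apply/seteqP; split=> t /= /andP.
- have [z qz uz] := exists_close_root (q_monic t) (size_q t) (dl0 m) (hu t).
  have e0 : 0 < dl m - cabs (u t - z) by rewrite subr_gt0.
  have [k [hk1 hk2]] := root_approx qz (exprn_gt0 n.+1 (dl0 m.+1)) e0.
  exists k; rewrite hk1/= (le_lt_trans (cabsB_triangle z _ _))//.
  by rewrite [X in _ + X]cabsB -ltrBrDr.
- by exists v => [|t]; [split=> // t|]; have /andP[] := hv t.
Qed.

(** The root is a pointwise limit of measurable approximate roots. Consecutive ones differ by less
    than 2^-m, so the sequence converges, and continuity of [q t] makes the limit a root. *)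
Lemma measurable_root :
  exists2 r : T -> R[i], complex_measurable r & forall t, root (q t) (r t).
Proof.
have [u0 hu0] := approx0.
(* The index m is carried along with the approximant because the tolerance of the next choice
   depends on it. *)
pose X := {mu : nat * (T -> R[i]) | approx mu.1 mu.2}.
pose rel (x y : X) := (sval y).1 = (sval x).1.+1 /\
  forall t, cabs ((sval y).2 t - (sval x).2 t) < dl (sval x).1.
have [x|g [g0 gS]] := @dependent_choice X rel _
    (exist (fun mu : nat * (T -> R[i]) => approx mu.1 mu.2) (0%N, u0) hu0).
  case: x => -[m u] hu; apply: cid; have [v hv uv] := approxS hu.
  by exists (exist (fun mu : nat * (T -> R[i]) => approx mu.1 mu.2) (m.+1, v) hv).
pose u m := (sval (g m)).2.
have g1 m : (sval (g m)).1 = m.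
  by elim: m => [|m IH]; [rewrite g0|have [-> _] := gS m; rewrite IH].
have hu m : approx m (u m) by have := svalP (g m); rewrite g1.
have uS m t : cabs (u m.+1 t - u m t) < dl m.
  by have [_ /(_ t)] := gS m; rewrite g1.
have dlcvg : cvgn (series dl).
  have -> : series dl = series (geometric 1 2^-1).
    by apply/funext => m; apply: eq_bigr => i _; rewrite /= mul1r.
  by apply: is_cvg_geometric_series; rewrite gtr0_norm ?invr_gt0 ?invf_lt1 ?ltr1n.
(* To be applied to Re and Im: each component is a telescoping series dominated by the geometric
   series of [dl]. *)
have cvgu (h : R[i] -> R) : (forall z w, h (z - w) = h z - h w) ->
    (forall z, `|h z| <= cabs z) -> forall t, cvgn (fun m => h (u m t)).
  move=> hB hle t.
  have : cvgn (series (telescope (fun m => h (u m t)))).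
    apply: normed_cvg; apply: series_le_cvg dlcvg => m /=; [by []|exact/ltW/dl0|].
    by rewrite /telescope/= -hB (le_trans (hle _))// ltW.
  rewrite telescopeK => H; have := is_cvgD (is_cvg_cst (h (u 0%N t))) H.
  have -> // : cst (h (u 0%N t)) + [sequence h (u k t) - h (u 0%N t)]_k =
    (fun m => h (u m t)).
    by apply/funext => m; rewrite /= fctE/= addrC subrK.
  exact.
have ReB (z w : R[i]) : complex.Re (z - w) = complex.Re z - complex.Re w.
  by case: z => ? ?; case: w.
have ImB (z w : R[i]) : complex.Im (z - w) = complex.Im z - complex.Im w.
  by case: z => ? ?; case: w.
have cRe := cvgu _ ReB (@Re_le_cabs R).
have cIm := cvgu _ ImB (@Im_le_cabs R).
pose r t := Complex (limn (fun m => complex.Re (u m t)))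
                    (limn (fun m => complex.Im (u m t))).
exists r.
  split.
    apply: (measurable_fun_cvg (h := fun m t => complex.Re (u m t))) => [m|t _].
      by have [[]] := hu m.
    exact: cRe.
  apply: (measurable_fun_cvg (h := fun m t => complex.Im (u m t))) => [m|t _].
    by have [[]] := hu m.
  exact: cIm.
move=> t; apply/rootP/eqP; rewrite -cabs_eq0 eq_le cabs_ge0 andbT.
apply/ler_addgt0Pr => e e0; rewrite add0r.
have [M M0 hM] := poly_local_lipschitz (q t) (r t).
pose e' := Num.min 1 (e / 2 / M).
have e'0 : 0 < e' by rewrite lt_min ltr01 !divr_gt0.
have e'2 : 0 < e' / 2 by rewrite divr_gt0.
have /cvgrPdist_lt /(_ _ e'2) [m1 _ h1] := cRe t.
have /cvgrPdist_lt /(_ _ e'2) [m2 _ h2] := cIm t.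
have [m3 _ h3] : \forall m \near \oo, dl m <= e / 2.
  have : (2^-1 : R) ^+ m @[m --> \oo] --> (0 : R).
    by apply: cvg_expr; rewrite gtr0_norm ?invr_gt0 ?invf_lt1 ?ltr1n.
  move=> /cvgrPdist_le /(_ _ (divr_gt0 e0 (ltr0n _ 2))).
  by apply: filterS => m; rewrite sub0r normrN (ger0_norm (ltW (dl0 m))).
pose m := maxn m1 (maxn m2 m3).
have um : cabs (u m t - r t) <= e'.
  rewrite cabsB (le_trans (cabs_le_ReIm _))// [e']splitr ltW// ReB ImB ltrD//.
    by apply: h1; rewrite /= leq_maxl.
  by apply: h2; rewrite /= /m maxnCA leq_maxl.
have um1 : cabs (u m t - r t) <= 1 by rewrite (le_trans um)// ge_min lexx.
have qu : cabs (q t).[u m t] <= e / 2.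
  have [_ /(_ t) /ltW] := hu m => /le_trans; apply.
  apply: le_trans (h3 m _); last by rewrite /= /m !leq_max leqnn !orbT.
  rewrite exprS ger_pMr//; apply: exprn_ile1; first exact/ltW.
  by rewrite exprn_ile1 ?invr_ge0// invf_le1// ler1n.
have := hM _ um1; rewrite [cabs (_.[_] - _)]cabsB => h.
rewrite -[(q t).[r t]](subrK (q t).[u m t]) (le_trans (cabsD _ _))//.
rewrite [e]splitr lerD// (le_trans h)// mulrC -ler_pdivlMr//.
by rewrite (le_trans um)// ge_min lexx orbT.
Qed.

End one_root.

(** Deflation: divide by X - r and recurse. The coefficients of the quotient are polynomial in r and
    in the coefficients of [q t], hence measurable. *)
Lemma measurable_roots n (q : T -> {poly R[i]}) :
  (forall t, q t \is monic) -> (forall t, size (q t) = n.+1) ->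
  (forall i, complex_measurable (fun t => (q t)`_i)) ->
  exists2 zeta : nat -> T -> R[i], forall i, complex_measurable (zeta i) &
    forall t, q t = \prod_(i < n) ('X - (zeta i t)%:P).
Proof.
elim: n q => [|n IH] q qm sq mq.
  exists (fun _ _ => 0) => [i|t]; first exact: complex_measurable_cst.
  rewrite big_ord0; have /size_poly1P[c _ qc] : size (q t) == 1 by rewrite sq.
  by have := monicP (qm t); rewrite qc lead_coefC => ->.
have [r mr rr] := measurable_root qm sq mq.
pose q' t := q t %/ ('X - (r t)%:P).
have qE t : q t = ('X - (r t)%:P) * q' t.
  by rewrite mulrC divpK// dvdp_XsubCl.
have sq' t : size (q' t) = n.+1.
  by rewrite size_divp ?polyXsubC_eq0// size_XsubC sq subSS subn0.
have qm' t : q' t \is monic by have := qm t; rewrite qE monicMl ?monicXsubC.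
have [|zeta mz zE] := IH q' qm' sq'.
  move=> j; rewrite (_ : (fun _ => _) =
      (fun t => \sum_(k < n.+1) (q t)`_(j.+1 + k) * r t ^+ k)).
    apply: complex_measurable_sum => k; apply: complex_measurableM => //.
    exact: complex_measurableX.
  apply/funext => t; apply: quotient_XsubC_coef (qE t) _.
  by rewrite sq' leq_addr.
exists (fun i => if i is j.+1 then zeta j else r) => [[|i]|t];
  [exact: mr|exact: mz|].
by rewrite big_ord_recl /= qE zE.
Qed.

End measurable_roots.

(** * The chordal metric *)

Lemma increasing_choice (Q : nat -> nat -> Prop) :
  (forall n N, exists2 k, (N <= k)%N & Q n k) ->
  exists2 s : nat -> nat, {homo s : m n / (m < n)%N} & forall n, Q n (s n).
Proof.
move=> hQ.
have [x|g hg] := @boolp.choice _ _ (fun x k => (x.2 <= k)%N /\ Q x.1 k).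
  by have [k] := hQ x.1 x.2; exists k.
pose s := fix s n := if n is m.+1 then g (n, (s m).+1) else g (0%N, 0%N).
exists s; first by apply: homo_ltn => [y x z|n]; [exact: ltn_trans|exact: (hg (n.+1, (s n).+1)).1].
by case=> [|n]; [exact: (hg (0%N, 0%N)).2|exact: (hg (n.+1, (s n).+1)).2].
Qed.

(** Normality quantifies over arbitrary sequences from the family, whose indices may repeat or come
    in any order. Either one index recurs infinitely often or the indices tend to infinity; the
    normality proofs below split accordingly. *)
Lemma constant_or_unbounded_subsequence (m : nat -> nat) :
  (exists c, exists2 s : nat -> nat, {homo s : i j / (i < j)%N} &
     forall n, m (s n) = c) \/
  (exists2 s : nat -> nat, {homo s : i j / (i < j)%N} & forall n, (n <= m (s n))%N).
Proof.
have [[c hc]|h] := pselect (exists c, forall N, exists2 k, (N <= k)%N & m k = c).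
  left; exists c; apply: (@increasing_choice (fun _ k => m k = c)) => _.
  exact: hc.
right; apply: (@increasing_choice (fun n k => (n <= m k)%N)).
have fin c : exists N, forall k, (N <= k)%N -> m k <> c.
  apply: contrapT => hN; apply: h; exists c => N; apply: contrapT => hk.
  by apply: hN; exists N => k Nk mk; apply: hk; exists k.
have big n : exists N, forall k, (N <= k)%N -> (n <= m k)%N.
  elim: n => [|n [N1 h1]]; first by exists 0%N.
  have [N2 h2] := fin n; exists (maxn N1 N2) => k.
  rewrite geq_max => /andP[k1 k2]; rewrite ltn_neqAle h1// andbT.
  by apply/eqP => e; exact: (h2 k k2).
move=> n N; have [N' h'] := big n.
by exists (maxn N N'); [exact: leq_maxl|apply: h'; exact: leq_maxr].
Qed.

Lemma leq_increasing (s : nat -> nat) n :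
  {homo s : m n / (m < n)%N} -> (n <= s n)%N.
Proof.
move=> hs; elim: n => // n IH; exact: leq_ltn_trans IH (hs _ _ (ltnSn n)).
Qed.

Section sphere_topology.
Context (R : realType).
Implicit Types (z w : R[i]) (V : set (sphere R)).

Lemma chordalxx (a : sphere R) : chordal a a = 0.
Proof. exact: (@mdistxx R (sphere R)). Qed.

Lemma chordal_eq0 (a b : sphere R) : chordal a b = 0 -> a = b.
Proof. exact: (@mdist_positivity R (sphere R)). Qed.

Lemma chordal_ge0 (a b : sphere R) : 0 <= chordal a b.
Proof. exact: (@mdist_ge0 R (sphere R)). Qed.

Lemma chordal_sym (a b : sphere R) : chordal a b = chordal b a.
Proof. exact: (@metric_sym R (sphere R)). Qed.

Lemma chordal_triangle (b a c : sphere R) :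
  chordal a c <= chordal a b + chordal b c.
Proof. exact: (@metric_triangle R (sphere R)). Qed.

Lemma nbhs_sphereP (a : sphere R) V :
  nbhs a V <-> exists2 e : R, 0 < e & forall b, chordal a b < e -> V b.
Proof.
split=> [/nbhs_ballP[e /= e0 h]|[e e0 h]].
  by exists e => // b ab; apply: h; rewrite ballEmdist.
by apply/nbhs_ballP; exists e => // b; rewrite ballEmdist; exact: h.
Qed.

Lemma uniform_sphereP V (h : nat -> sphere R -> sphere R) g :
  {uniform V, h @ \oo --> g} <->
  forall e : R, 0 < e -> exists N, forall n, (N <= n)%N -> forall y, V y ->
    chordal (g y) (h n y) < e.
Proof.
split=> [hg e e0|hg P].
  have : nbhs (g : {uniform` V -> sphere R})
      [set k : {uniform` V -> sphere R} | forall y, V y -> chordal (g y) (k y) < e].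
    apply/uniform_nbhs; exists [set xy | ball xy.1 e xy.2].
    by split; [exact: (entourage_ball (sphere R) (PosNum e0))|move=> k /= hk y Vy; have := hk y Vy; rewrite ballEmdist].
  by move=> /hg[N _ hN]; exists N => n Nn; exact: (hN n Nn).
move=> /uniform_nbhs[E [entE EP]].
have [e /= e0 eE] : exists2 e : R, 0 < e & [set xy | ball xy.1 e xy.2] `<=` E.
  by move: entE; rewrite -entourage_ballE => -[e /= e0 eE]; exists e.
have [N hN] := hg e e0; exists N => // n Nn; apply: EP => y Vy; apply: eE => /=.
by rewrite ballEmdist; exact: hN.
Qed.

Let h z : R := Num.sqrt (1 + cabs z ^+ 2).

Let h_ge1 z : 1 <= h z.
Proof. by rewrite -[leLHS]sqrtr1 ler_wsqrtr// lerDl sqr_ge0. Qed.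

Let h_gt0 z : 0 < h z.
Proof. exact: lt_le_trans (h_ge1 z). Qed.

Lemma chordal_le z w : chordal (Some z) (Some w) <= 2 * cabs (z - w).
Proof.
rewrite /= ler_pdivrMr ?mulr_gt0 ?h_gt0// ler_peMr//.
  by rewrite mulr_ge0// cabs_ge0.
by rewrite -[leLHS]mulr1 ler_pM// h_ge1.
Qed.

Lemma chordal_infty z : 0 < cabs z -> chordal None (Some z) <= 2 / cabs z.
Proof.
move=> z0; rewrite /= ler_pM2l// lef_pV2 ?posrE ?h_gt0//.
by rewrite -[leLHS]ger0_norm ?cabs_ge0// -sqrtr_sqr ler_wsqrtr// lerDr.
Qed.

Lemma chordal_infty_lt (r : R) z : 0 <= r ->
  (chordal None (Some z) < 2 / Num.sqrt (1 + r ^+ 2)) = (r < cabs z).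
Proof.
move=> r0; have r1 : 0 < 1 + r ^+ 2 by rewrite ltr_pwDl// sqr_ge0.
have z1 : 0 < 1 + cabs z ^+ 2 by rewrite ltr_pwDl// sqr_ge0.
rewrite /= ltr_pM2l// ltf_pV2 ?posrE ?sqrtr_gt0// ltr_sqrt// ltrD2l.
by rewrite ltr_pXn2r// nnegrE cabs_ge0.
Qed.

Lemma chordal_lt_finite z (e : R) : 0 < e -> exists2 r : R, 0 < r &
  forall b, chordal (Some z) b < r -> exists2 w, b = Some w & cabs (w - z) < e.
Proof.
move=> e0; have hz := h_gt0 z.
have k0 : 0 < h z * (e + h z) by rewrite mulr_gt0// addr_gt0.
(* The first radius is the distance from z to infinity and so excludes infinity. The second is the
   lower bound of 2 |w - z| / (h z h w) for |w - z| >= e that results from h w <= |w - z| + h z. *)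
exists (Num.min (2 / h z) (2 * e / (h z * (e + h z)))) => [|b].
  by rewrite lt_min !divr_gt0// mulr_gt0.
rewrite lt_min => /andP[]; case: b => [w|/=]; last by rewrite -/(h z) ltxx.
move=> _ hw; exists w => //; rewrite ltNge; apply/negP => we.
move: hw; apply/negP; rewrite -leNgt /= -/(h z) -/(h w) [cabs (z - w)]cabsB.
have hw : h w <= cabs (w - z) + h z.
  have := sqr_sqrtr (ler_wpDr (sqr_ge0 (cabs w)) (@ler01 R)); rewrite -/(h w) => e1.
  have := sqr_sqrtr (ler_wpDr (sqr_ge0 (cabs z)) (@ler01 R)); rewrite -/(h z) => e2.
  have zh : cabs z <= h z.
    by rewrite -[leLHS]ger0_norm ?cabs_ge0// -sqrtr_sqr ler_wsqrtr// lerDr.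
  have wz : cabs w <= cabs (w - z) + cabs z by rewrite -{1}(subrK z w) cabsD.
  have c1 := cabs_ge0 w; have c2 := cabs_ge0 z; have c3 := cabs_ge0 (w - z).
  have w0 := h_gt0 w.
  rewrite -(@ler_pXn2r _ 2)// ?nnegrE ?addr_ge0 ?(ltW hz) ?(ltW w0)//.
  have : cabs w ^+ 2 <= (cabs (w - z) + cabs z) ^+ 2.
    by rewrite lerXn2r// nnegrE ?addr_ge0.
  have : cabs (w - z) * cabs z <= cabs (w - z) * h z by rewrite ler_wpM2l.
  nra.
rewrite ler_pdivlMr ?mulr_gt0 ?h_gt0// mulrAC ler_pdivrMr//.
have c3 := cabs_ge0 (w - z); have w0 := h_gt0 w.
have : e * h w <= cabs (w - z) * (e + h z) by nra.
nra.
Qed.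

Lemma nbhs_Some z V : nbhs (Some z : sphere R) V <->
  exists2 e : R, 0 < e & forall w, cabs (w - z) < e -> V (Some w).
Proof.
split=> [/nbhs_sphereP[e e0 hV]|[e e0 hV]].
  exists (e / 2) => [|w wz]; first by rewrite divr_gt0.
  apply: hV; apply: le_lt_trans (chordal_le _ _) _.
  by rewrite cabsB mulrC -ltr_pdivlMr.
have [r r0 hr] := chordal_lt_finite z e0.
by apply/nbhs_sphereP; exists r => // b /hr[w -> /hV].
Qed.

End sphere_topology.

(** * The Julia set *)

Section composition.
Context (R : realType).
Variable f : nat -> {poly R[i]}.

Lemma comp_seq_horner_eq l m (z w : R[i]) : (l <= m)%N ->
  (comp_seq f l).[z] = (comp_seq f l).[w] ->
  (comp_seq f m).[z] = (comp_seq f m).[w].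
Proof.
move=> lm zw; rewrite -(subnKC lm); elim: (m - l)%N => [|k IH]; first by rewrite addn0.
by rewrite addnS /= !horner_comp IH.
Qed.

Hypothesis hf : regular f.

Lemma regular_deg n : (0 < n)%N -> (2 <= deg (f n))%N.
Proof. by have [A1 [A2 [A3 [_ _ _ h]]]] := hf; move=> /h[]. Qed.

Lemma deg_comp_seq n : deg (comp_seq f n) = (\prod_(1 <= i < n.+1) deg (f i))%N.
Proof.
rewrite /deg; elim: n => [|n IH]; first by rewrite size_polyX big_geq.
by rewrite /= size_comp_poly IH mulnC -big_nat_recr.
Qed.

Lemma deg_comp_seq_gt0 n : (0 < deg (comp_seq f n))%N.
Proof.
rewrite deg_comp_seq big_nat_cond prodn_cond_gt0// => i /andP[/andP[i0 _] _].
exact: ltnW (regular_deg i0).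
Qed.

Lemma size_comp_seq n : size (comp_seq f n) = (deg (comp_seq f n)).+1.
Proof. by have := deg_comp_seq_gt0 n; rewrite /deg; case: (size _). Qed.

Lemma lead_coef_comp_seq n : lead_coef (comp_seq f n) =
  \prod_(1 <= i < n.+1) lead_coef (f i) ^+ (\prod_(i.+1 <= j < n.+1) deg (f j))%N.
Proof.
elim: n => [|n IH]; first by rewrite /= lead_coefX big_geq.
rewrite /= lead_coef_comp ?size_comp_seq ?ltnS ?deg_comp_seq_gt0// IH.
rewrite [RHS]big_nat_recr//= [(\prod_(n.+2 <= j < n.+2) _)%N]big_geq// expr1 mulrC.
congr (_ * _); rewrite -/(deg _) -prodrXl; apply: eq_big_nat => i /andP[_ ilen].
by rewrite -exprM [in RHS]big_nat_recr//.
Qed.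

Lemma comp_seq_growth : exists2 r : R, 1 <= r &
  forall z, r <= cabs z -> forall n, 2 ^+ n <= cabs (comp_seq f n).[z].
Proof.
have [A1 [A2 [A3 [a1 a2 _ hA]]]] := hf.
(* An escape radius common to all [f n]. The term 2 A2 makes the lower-order terms at most half of
   the leading one; as the degree is at least 2, the term 4 / A1 then makes |f_n(w)| at least 2
   |w|. *)
pose r := 1 + 2 * A2 + 4 / A1.
have A10 : 0 < 4 / A1 by rewrite divr_gt0.
have r1 : 1 <= r by rewrite /r; lra.
exists r => // z rz n.
suff : 2 ^+ n * r <= cabs (comp_seq f n).[z].
  by apply: le_trans; rewrite ler_peMr// exprn_ge0.
elim: n => [|n]; first by rewrite expr0 mul1r /= hornerX.
rewrite exprS -mulrA /= horner_comp; set w := (comp_seq f n).[z] => IH.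
have wr : r <= cabs w by rewrite (le_trans _ IH)// ler_peMl ?exprn_ege1 ?ler1n// (le_trans _ r1).
apply: (@le_trans _ _ (2 * cabs w)); first by rewrite ler_pM2l.
have [d2 lA ajA _] := hA n.+1 isT; set p := f n.+1 in d2 lA ajA *.
set d := deg p in d2 ajA; set x := cabs w in wr *; set L := cabs (lead_coef p) in lA ajA.
have x1 : 1 <= x by exact: le_trans wr.
have x0 : 0 < x by exact: lt_le_trans x1.
have L0 : 0 < L by exact: lt_le_trans lA.
have sp : size p = d.+1 by move: d2; rewrite /d /deg; case: (size p).
have geo : (\sum_(i < d) x ^+ i) * (2 * A2) <= x ^+ d.
  have S0 : 0 <= \sum_(i < d) x ^+ i by rewrite sumr_ge0// => i _; rewrite exprn_ge0// ltW.
  have := subrX1 x d => e.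
  apply: (@le_trans _ _ (x ^+ d - 1)); last by lra.
  rewrite e mulrC ler_wpM2r//; move: wr; rewrite /r; lra.
have lower : L * x ^+ d - A2 * L * (\sum_(i < d) x ^+ i) <= cabs p.[w].
  rewrite horner_coef sp big_ord_recr/= -[p`_d]/(lead_coef p).
  have : cabs (\sum_(i < d) p`_i * w ^+ i) <= A2 * L * (\sum_(i < d) x ^+ i).
    rewrite (le_trans (cabs_sum _ _))// mulr_sumr; apply: ler_sum => i _.
    rewrite cabsM cabsX ler_wpM2r ?exprn_ge0 ?(ltW x0)//; exact: ajA.
  set s := \sum_(i < d) _ => hs.
  have := cabsD (s + lead_coef p * w ^+ d) (- s).
  rewrite addrAC subrr add0r cabsN cabsM cabsX -/x -/L; lra.
apply: le_trans lower.
have xd : x * r <= x ^+ d.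
  rewrite -(subnKC d2) exprD expr2 -mulrA ler_pM2l//.
  by rewrite -[leLHS]mulr1 ler_pM ?exprn_ege1// (le_trans _ r1).
have Lr : 4 <= L * r.
  apply: (@le_trans _ _ (A1 * (4 / A1))); first by rewrite mulrC divfK ?gt_eqF.
  by rewrite ler_pM ?(ltW a1) ?(ltW A10)// /r; lra.
have : L * (\sum_(i < d) x ^+ i * (2 * A2)) <= L * x ^+ d by rewrite -mulr_suml ler_pM2l.
have : L * (x * r) <= L * x ^+ d by rewrite ler_pM2l.
rewrite -mulr_suml.
have : x * 4 <= x * (L * r) by rewrite ler_pM2l.
set S := \sum_(i < d) _; set Y := x ^+ d; nra.
Qed.

(** Beyond the escape radius the iterates tend to infinity at a rate independent of the point. So a
    sequence from the family has a subsequence that repeats a single map or converges uniformly to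
    the constant infinity. *)
Lemma julia_bounded : exists2 r : R, 0 < r &
  forall z, julia f (Some z) -> cabs z <= r.
Proof.
have [r r1 hr] := comp_seq_growth.
have r0 : 0 <= r by exact: le_trans r1.
exists r => [|z]; first exact: lt_le_trans r1.
move=> Jz; rewrite leNgt; apply/negP => rz; apply: Jz.
(* The chordal distance from infinity to the circle |z| = r, so that [U] is the exterior of the
   circle together with infinity. *)
pose dl : R := 2 / Num.sqrt (1 + r ^+ 2).
have dl0 : 0 < dl by rewrite divr_gt0// sqrtr_gt0 ltr_pwDl// sqr_ge0.
pose U := [set b : sphere R | chordal None b < dl].
have oU : open U.
  rewrite openE => a Ua; apply/nbhs_sphereP.
  exists (dl - chordal None a) => [|b ab]; first by rewrite subr_gt0.
  by apply: (le_lt_trans (chordal_triangle a None b)); rewrite -ltrBrDl.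
exists U; first by split=> //; rewrite /U /= chordal_infty_lt.
move=> u hu.
have [n|m hm] := @boolp.choice _ _ (fun n m => (0 < m)%N /\ sphere_map (comp_seq f m) = u n).
  by have [m m0 <-] := hu n; exists m.
have [[c [s hs sc]]|[s hs sn]] := constant_or_unbounded_subsequence m.
  exists s; split=> //; exists (sphere_map (comp_seq f c)) => b _.
  exists setT; first exact: filterT.
  apply/uniform_sphereP => e e0; exists 0%N => n _ y _.
  have [_ us] := hm (s n); rewrite -[(u \o s) n]/(u (s n)) -us sc.
  by rewrite chordalxx.
exists s; split=> //; exists (fun=> None) => b Ub; exists U.
  by apply: open_nbhs_nbhs.
apply/uniform_sphereP => e e0.
have [N _ hN] : \forall n \near \oo, 2 * (2^-1 : R) ^+ n < e.
  have : (2^-1 : R) ^+ n @[n --> \oo] --> (0 : R).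
    by apply: cvg_expr; rewrite gtr0_norm ?invr_gt0 ?invf_lt1 ?ltr1n.
  move=> /cvgrPdist_lt /(_ _ (divr_gt0 e0 (ltr0n _ 2))).
  apply: filterS => n; rewrite sub0r normrN ger0_norm ?exprn_ge0 ?invr_ge0//.
  by rewrite ltr_pdivlMr// mulrC.
exists N => n Nn y Uy; have [_ us] := hm (s n).
rewrite -[(u \o s) n]/(u (s n)) -us.
case: y Uy => [y|_]; last by rewrite /= e0.
rewrite /U /= chordal_infty_lt// => ry.
have := hr y (ltW ry) (m (s n)); set w := _.[y] => hw.
have w0 : 0 < cabs w by rewrite (lt_le_trans _ hw)// exprn_gt0.
apply: le_lt_trans (chordal_infty w0) _.
apply: le_lt_trans (hN n Nn).
rewrite ler_pM2l// exprVn lef_pV2 ?posrE ?exprn_gt0//.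
by rewrite (le_trans _ hw)// ler_weXn2l// ler1n.
Qed.

(* Polynomials are open maps, by continuity of the roots. *)
Lemma nbhs_fibre (p : {poly R[i]}) (x y : R[i]) (V : set (sphere R)) :
  (1 < size p)%N -> p.[x] = p.[y] -> nbhs (Some x : sphere R) V ->
  nbhs (Some y : sphere R)
    [set b | exists y' x', [/\ b = Some y', V (Some x') & p.[x'] = p.[y']]].
Proof.
move=> p1 pxy /nbhs_Some[e e0 hV].
have [n sp] : exists n, size p = n.+2 by case: (size p) p1 => [|[|n]]//; exists n.
have a0 : lead_coef p != 0 by rewrite lead_coef_eq0 -size_poly_gt0 sp.
have [M M0 hM] := poly_local_lipschitz p y.
have ca : 0 < cabs (lead_coef p) by rewrite cabs_gt0.
have e1 : 0 < e ^+ n.+1 by rewrite exprn_gt0.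
pose dl := Num.min 1 (e ^+ n.+1 * cabs (lead_coef p) / M).
apply/nbhs_Some; exists dl.
  by rewrite lt_min ltr01 divr_gt0// mulr_gt0.
move=> y'; rewrite lt_min => /andP[y1 y2].
(* At x this polynomial takes the value (p(y) - p(y')) / a, where a is the leading coefficient. The
   choice of [dl] puts it below e^(n+1) in modulus, so a root x' of [q], a point of the fibre of y',
   lies within e of x. *)
pose q := (lead_coef p)^-1 *: (p - p.[y']%:P).
have sq : size (p - p.[y']%:P) = n.+2.
  by rewrite size_polyDl ?sp// size_polyN (leq_ltn_trans (size_polyC_leq1 _)).
have qm : q \is monic.
  rewrite monicE lead_coefZ lead_coefDl ?mulVf//.
  by rewrite size_polyN sp (leq_ltn_trans (size_polyC_leq1 _)).
have sq' : size q = n.+2 by rewrite size_scale ?invr_eq0.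
have qx : cabs q.[x] < e ^+ n.+1.
  rewrite hornerZ hornerD hornerN hornerC cabsM cabsV mulrC ltr_pdivrMr//.
  rewrite pxy cabsB; apply: le_lt_trans (hM _ (ltW y1)) _.
  by rewrite mulrC -ltr_pdivlMr.
have [x' /rootP qx' xx'] := exists_close_root qm sq' e0 qx.
exists y', x'; split=> //; first by apply: hV; rewrite cabsB.
move/eqP: qx'; rewrite hornerZ mulf_eq0 invr_eq0 (negPf a0)/=.
by rewrite hornerD hornerN hornerC subr_eq0 => /eqP.
Qed.

(** The saturation of a neighbourhood of x under F_l is an open set containing y. For m >= l the map
    F_m factors through F_l, so its values on the saturation are already taken on the original
    neighbourhood, and locally uniform convergence is carried over. *)
Lemma fatou_fibre l (x y : R[i]) : (comp_seq f l).[x] = (comp_seq f l).[y] ->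
  Defs.fatou f (Some x) -> Defs.fatou f (Some y).
Proof.
move=> xy [U [oU Ux] nU]; set p := comp_seq f l in xy.
have p1 : (1 < size p)%N by rewrite size_comp_seq ltnS deg_comp_seq_gt0.
pose sat V := [set b : sphere R | exists y' x',
  [/\ b = Some y', V (Some x') & p.[x'] = p.[y']]].
exists (sat U).
  split; last by exists y, x.
  rewrite openE => _ [y' [x' [-> Ux' xy']]].
  by apply: (nbhs_fibre p1 xy'); apply: open_nbhs_nbhs.
move=> u hu.
have [s [hs [g hg]]] := nU u hu.
have [n|m hm] := @boolp.choice _ _ (fun n m => (0 < m)%N /\ sphere_map (comp_seq f m) = u (s n)).
  by have [m m0 <-] := hu (s n); exists m.
have [[c [t ht tc]]|[t ht tn]] := constant_or_unbounded_subsequence m.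
  exists (s \o t); split; first by move=> i j ij; apply/hs/ht.
  exists (sphere_map (comp_seq f c)) => b _.
  exists setT; first exact: filterT.
  apply/uniform_sphereP => e e0; exists 0%N => n _ y' _.
  have [_ us] := hm (t n); rewrite -[(u \o _) n]/(u (s (t n))) -us tc.
  by rewrite chordalxx.
exists (s \o t); split; first by move=> i j ij; apply/hs/ht.
have eq_fibre n (a b : R[i]) : (l <= n)%N -> p.[a] = p.[b] ->
    u (s (t n)) (Some a) = u (s (t n)) (Some b).
  move=> ln ab; have [_ <-] := hm (t n); congr Some.
  exact: (comp_seq_horner_eq (leq_trans ln (tn n)) ab).
have limU a e : U (Some a) -> 0 < e -> exists N, forall n, (N <= n)%N ->
    chordal (g (Some a)) (u (s (t n)) (Some a)) < e.
  move=> Ua e0; have [V Va /uniform_sphereP/(_ e e0)[N hN]] := hg _ Ua.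
  exists N => n Nn; apply: hN; last exact: (nbhs_singleton Va).
  by rewrite (leq_trans Nn)// leq_increasing.
(* The approximating maps agree at a and b from the index l on, so their limits agree; the choice of
   representative in [g'] is therefore harmless. *)
have g_fibre a b : U (Some a) -> U (Some b) -> p.[a] = p.[b] ->
    g (Some a) = g (Some b).
  move=> Ua Ub ab; apply: chordal_eq0; apply/eqP; rewrite eq_le chordal_ge0 andbT.
  apply/ler_addgt0Pr => e e0; rewrite add0r.
  have e2 : 0 < e / 2 by rewrite divr_gt0.
  have [N1 h1] := limU a _ Ua e2; have [N2 h2] := limU b _ Ub e2.
  pose n := maxn l (maxn N1 N2).
  have := h1 n; have := h2 n.
  rewrite /n !leq_max !leqnn !orbT -/n => /(_ isT) k2 /(_ isT) k1.
  apply: le_trans (chordal_triangle (u (s (t n)) (Some a)) _ _) _.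
  rewrite [e]splitr ltW// ltrD// (@eq_fibre n a b) ?leq_maxl//.
  by rewrite chordal_sym.
pose g' b := if b is Some y' then
  g (Some (xget 0 [set x' : R[i] | U (Some x') /\ p.[x'] = p.[y']])) else None.
exists g' => _ [y' [x' [-> Ux' xy']]].
have [V Vx' hV] := hg _ Ux'.
exists (sat (V `&` U)).
  apply: (nbhs_fibre p1 xy'); apply: filterI => //.
  by apply: open_nbhs_nbhs.
apply/uniform_sphereP => e e0; have /uniform_sphereP/(_ e e0)[N hN] := hV.
exists (maxn N l) => n; rewrite geq_max => /andP[Nn ln] _ [z [w [-> [Vw Uw] wz]]].
rewrite -[(u \o _) n]/(u (s (t n))) -(eq_fibre n _ _ ln wz).
have -> : g' (Some z) = g (Some w).
  have [Ux0 x0z] : [set x' : R[i] | U (Some x') /\ p.[x'] = p.[z]]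
      (xget 0 [set x' : R[i] | U (Some x') /\ p.[x'] = p.[z]]).
    by apply: xgetPex; exists w.
  by apply: g_fibre => //; rewrite x0z.
by apply: hN => //; rewrite (leq_trans Nn)// leq_increasing.
Qed.

Lemma julia_fibre l (x y : R[i]) : (comp_seq f l).[x] = (comp_seq f l).[y] ->
  julia f (Some x) -> julia f (Some y).
Proof. by move=> xy Jx /(fatou_fibre (esym xy)). Qed.

Lemma julia_measurable :
  @measurable _ (borelC R) [set z : R[i] | julia f (Some z)].
Proof.
rewrite -[X in measurable X]setCK; apply: measurableC; apply: sub_gen_smallest.
rewrite openE => z /contrapT[U [oU Uz] nU].
have /nbhs_Some[e e0 hU] : nbhs (Some z : sphere R) U by exact: open_nbhs_nbhs.
(* The norm of [R[i]^o] takes its values in [R[i]], hence a complex radius. *)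
apply/(nbhs_ballP (z : R[i]^o)); exists (Complex e 0).
  by rewrite /= ltcE /= eqxx.
move=> w; rewrite -ball_normE /= => zw; apply; exists U => //; split=> //.
apply: hU; rewrite cabsB.
by move: zw; rewrite normc_def ltcE /= cabsE => /andP[].
Qed.

End composition.

(** * Probability measures on the plane *)

Section probability_constructions.
Context d (T : measurableType d) (R : realType).
Local Open Scope ereal_scope.

(** Normalising a measure of mass 1 leaves it unchanged; [P0] is the fallback that [mnormalize]
    takes for measures that cannot be normalised. *)
Lemma probability_of_measure (P0 : probability T R)
    (m : {measure set T -> \bar R}) : m setT = 1 ->
  exists P : probability T R, forall A, P A = m A.
Proof.
move=> m1; exists (mnormalize m P0) => A.
by rewrite /= /mnormalize /= m1 onee_eq0 /= invr1 mule1.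
Qed.

Lemma ge0_integral_mrestr (m : {measure set T -> \bar R}) (A : set T)
    (mA : measurable A) (f : T -> \bar R) :
  (forall x, 0 <= f x) -> measurable_fun setT f ->
  \int[mrestr m mA]_x f x = \int[m]_(x in A) f x.
Proof.
move=> f0 mf; have mAC := measurableC mA.
have fA0 x : setT x -> 0 <= (f \_ A) x by move=> _; rewrite erestrict_ge0.
have mfA : measurable_fun setT (f \_ A).
  by apply/(measurable_restrictT f mA); exact: measurable_funS mf.
rewrite [RHS]integral_mkcond.
rewrite [RHS](_ : _ = \int[measure_add (mrestr m mA) (mrestr m mAC)]_x (f \_ A) x); last first.
  apply: eq_measure_integral => B mB _.
  transitivity (m (B `&` A) + m (B `&` ~` A)); last exact/esym/measure_addE.
  rewrite -measureU//; [|exact: measurableI..|].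
    by rewrite -setIUr setUv setIT.
  by rewrite setIACA setICr setI0.
rewrite ge0_integral_measure_add//.
rewrite [X in _ + X](ge0_negligible_integral (N := A))//; last first.
  exact: etrans (congr1 m (setICr A)) (measure0 m).
rewrite [X in _ + X]integral0_eq ?adde0; last first.
  by move=> x [_ nA]; rewrite patchE memNset.
apply: ge0_ae_eq_integral => //.
exists (~` A); split=> //; first exact: etrans (congr1 m (setICl A)) (measure0 m).
by move=> x /= + Ax; apply => _; rewrite patchE mem_set.
Qed.

Lemma restricted_probability (P : probability T R) (A : set T) :
  measurable A -> 0 < P A -> exists Q : probability T R,
  (forall B, Q B = ((fine (P A))^-1)%:E * P (B `&` A)) /\
  forall f, (forall x, 0 <= f x) -> measurable_fun setT f ->
    \int[Q]_x f x = ((fine (P A))^-1)%:E * \int[P]_(x in A) f x.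
Proof.
move=> mA PA.
have fA : P A \is a fin_num by rewrite fin_num_measure.
have r0 : (0 < fine (P A))%R by rewrite fine_gt0// PA -ge0_fin_numE// fA.
have ri0 : (0 <= (fine (P A))^-1)%R by rewrite invr_ge0 ltW.
have [|Q QE] := @probability_of_measure P (mscale (NngNum ri0) (mrestr P mA)).
  transitivity (((fine (P A))^-1)%:E * P A).
    exact: (congr1 (fun B => _ * P B) (setTI A)).
  by rewrite -[X in _ * X](fineK fA) -EFinM mulVf// gt_eqF.
exists Q; split=> [B|f f0 mf]; first by rewrite QE.
rewrite (eq_measure_integral (mscale (NngNum ri0) (mrestr P mA))); last first.
  by move=> B _ _; rewrite -QE.
by rewrite ge0_integral_mscale// ge0_integral_mrestr.
Qed.

Lemma averaged_probability (P : probability T R) (N : nat) (zeta : nat -> T -> T) :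
  (0 < N)%N -> (forall i, measurable_fun setT (zeta i)) ->
  exists Q : probability T R, [/\
  forall B, Q B = (N%:R^-1)%:E * \sum_(i < N) P (zeta i @^-1` B),
  forall f, (forall x, 0 <= f x) -> measurable_fun setT f ->
    \int[Q]_x f x = (N%:R^-1)%:E * \sum_(i < N) \int[P]_x f (zeta i x) &
  forall g, bounded_measurable g -> (\int[Q]_x g x =
    N%:R^-1 * \sum_(i < N) \int[P]_x g (zeta i x))%R].
Proof.
move=> N0 mz; have ri0 : (0 <= N%:R^-1 :> R)%R by [].
have N1 : (N%:R^-1 * N%:R = 1 :> R)%R by rewrite mulVf// pnatr_eq0 -lt0n.
pose zm i : {mfun T >-> T} := HB.pack (zeta i)
  (isMeasurableFun.Build _ _ _ _ _ (mz i)).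
pose m := mscale (NngNum ri0) (msum (fun i => distribution P (zm i)) N).
have [|Q QE] := @probability_of_measure P m.
  transitivity ((N%:R^-1)%:E * \sum_(i < N) 1 : \bar R).
    congr (_ * _); apply: eq_bigr => i _; exact: (@probability_setT _ _ _ P).
  by rewrite sumEFin -EFinM sumr_const card_ord N1.
have Qint f : (forall x, 0 <= f x) -> measurable_fun setT f ->
    \int[Q]_x f x = (N%:R^-1)%:E * \sum_(i < N) \int[P]_x f (zeta i x).
  move=> f0 mf; rewrite (eq_measure_integral m); last by move=> B _ _; rewrite -QE.
  rewrite ge0_integral_mscale// ge0_integral_measure_sum//; congr (_ * _).
  by apply: eq_bigr => i _; rewrite ge0_integral_distribution.
exists Q; split=> // g bg.
have bgz i : bounded_measurable (fun x => g (zeta i x)).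
  exact: (bounded_measurable_comp (h := zeta i)).
have [mg [M gM]] := bg.
have bM := bounded_measurable_cst T M.
have h0 x : 0 <= (g x + M)%:E.
  by rewrite lee_fin -lerBlDr sub0r; have := gM x; rewrite ler_norml => /andP[].
(* [g + M] is nonnegative, so the formula just proved applies to it; the constant then cancels
   because all the measures have mass 1. *)
have mh : measurable_fun setT (fun x => (g x + M)%:E).
  by apply/measurable_EFinP; apply: measurable_funD => //; exact: measurable_cst.
have := Qint _ h0 mh.
have fineE (P' : probability T R) (k : T -> R) : bounded_measurable k ->
    \int[P']_x (k x + M)%:E = (\int[P']_x k x + M)%:E.
  move=> bk; have bkM := bounded_measurableD bk bM.
  transitivity (\int[P']_x (k x + M))%R%:E.
    rewrite /Rintegral fineK//.
    exact: (integrable_fin_num measurableT (bounded_measurable_integrable P' bkM)).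
  rewrite RintegralD//; [|exact: bounded_measurable_integrable..].
  by rewrite Rintegral_cstT.
rewrite fineE// (eq_bigr (fun i : 'I_N => (\int[P]_x g (zeta i x) + M)%:E)); last first.
  by move=> i _; rewrite -fineE.
rewrite sumEFin -EFinM => -[]; rewrite big_split/= sumr_const card_ord mulrDr.
rewrite -[(M *+ N)%R]mulr_natl mulrA N1 mul1r; exact: addIr.
Qed.

Lemma measurable_partial_integral (P : probability T R) (f : T * T -> \bar R) :
  measurable_fun setT f -> measurable_fun setT (fun z => \int[P]_w f (z, w)).
Proof.
move=> mf; rewrite (_ : (fun _ => _) = (fun z => \int[P]_w (f^\+ (z, w)) -
    \int[P]_w (f^\- (z, w)))); last first.
  apply/funext => z; rewrite [LHS]integralE; congr (_ - _).
    by apply: eq_integral => w _; rewrite !funeposE.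
  by apply: eq_integral => w _; rewrite !funenegE.
apply: emeasurable_funB.
  apply: (measurable_fun_fubini_tonelli_F f^\+) => //; exact: measurable_funepos.
apply: (measurable_fun_fubini_tonelli_F f^\-) => //; exact: measurable_funeneg.
Qed.

(** Energies of competing measures may be infinite, so the constant has to be split off without
    integrability. If the integral of f is infinite, so is that of the positive part of f - c, while
    the negative part is at most |c|. *)
Lemma ge0_integral_subcst (P : probability T R) (f : T -> \bar R) (c : R) :
  (forall x, 0 <= f x) -> measurable_fun setT f ->
  \int[P]_x (f x - c%:E) = \int[P]_x f x - c%:E.
Proof.
move=> f0 mf.
have ic : P.-integrable setT (cst c%:E).
  exact: (bounded_measurable_integrable P (bounded_measurable_cst T c)).
have Ic (a : R) : \int[P]_x (cst a%:E) x = a%:E.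
  by rewrite integral_cst// [X in _ * X](@probability_setT _ _ _ P) mule1.
have [flt|] := ltP (\int[P]_x f x) +oo.
  rewrite integralB//; first by rewrite Ic.
  apply/integrableP; split=> //.
  by under eq_integral do rewrite gee0_abs//.
rewrite leye_eq => /eqP foo; rewrite foo addye//.
have mfc : measurable_fun setT (fun x => f x - c%:E).
  by apply: emeasurable_funB => //; exact: measurable_cst.
rewrite integralE.
have -> : \int[P]_x ((fun x => f x - c%:E)^\+) x = +oo.
  apply/eqP; rewrite -leye_eq.
  have : +oo <= \int[P]_x (((fun x => f x - c%:E)^\+) x + `|c|%:E).
    rewrite -foo; apply: ge0_le_integral => //.
    - by apply: emeasurable_funD => //; exact: measurable_funepos.
    move=> x _; rewrite -[leLHS](@subeK _ (f x) c%:E)//.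
    by rewrite leeD// ?lee_fin ?ler_norm// funeposE le_max lexx.
  rewrite ge0_integralD//; last exact: measurable_funepos.
  rewrite [X in _ + X](Ic `|c|%R).
  have key (I : \bar R) : +oo <= I + `|c|%:E -> +oo <= I by case: I => [r| |].
  exact: key.
rewrite addye// gt_eqF// (lt_le_trans (ltNyr (- `|c|)%R))// EFinN leeN2.
rewrite -(Ic `|c|%R); apply: ge0_le_integral => //.
- exact: measurable_funeneg.
- move=> x _; rewrite funenegE ge_max lee_fin normr_ge0 andbT.
  move: (f0 x); case: (f x) => [r| |]//=; rewrite ?leNye ?lee_fin//.
  by have := ler_norm c; lra.
Qed.

End probability_constructions.

(** * The Borel sigma-algebra of the plane *)

Section borel_complex.
Context (R : realType).

Lemma measurable_Re : measurable_fun setT (fun z : borelC R => complex.Re (z : R[i])).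
Proof.
apply: (measurability _ (RGenOInfty.measurableE R)) => _ [_ [a ->] <-].
rewrite setTI; apply: sub_gen_smallest; rewrite openE => z /= za.
apply/(nbhs_ballP (z : R[i]^o)).
have e0 : 0 < complex.Re z - a by move: za; rewrite in_itv/= andbT subr_gt0.
exists (Complex (complex.Re z - a) 0); first by rewrite /= ltcE /= eqxx.
move=> w; rewrite -ball_normE /= normc_def ltcE /= -cabsE => /andP[_ zw].
rewrite in_itv/= andbT.
have := le_lt_trans (Re_le_cabs (z - w)) zw.
case: z w {za zw e0} => x y [u v] /=; rewrite ltr_norml => /andP[_]; lra.
Qed.

Lemma measurable_Im : measurable_fun setT (fun z : borelC R => complex.Im (z : R[i])).
Proof.
apply: (measurability _ (RGenOInfty.measurableE R)) => _ [_ [a ->] <-].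
rewrite setTI; apply: sub_gen_smallest; rewrite openE => z /= za.
apply/(nbhs_ballP (z : R[i]^o)).
have e0 : 0 < complex.Im z - a by move: za; rewrite in_itv/= andbT subr_gt0.
exists (Complex (complex.Im z - a) 0); first by rewrite /= ltcE /= eqxx.
move=> w; rewrite -ball_normE /= normc_def ltcE /= -cabsE => /andP[_ zw].
rewrite in_itv/= andbT.
have := le_lt_trans (Im_le_cabs (z - w)) zw.
case: z w {za zw e0} => x y [u v] /=; rewrite ltr_norml => /andP[_]; lra.
Qed.

Lemma borel_set1 (a : R[i]) : @measurable _ (borelC R) [set a].
Proof.
rewrite (_ : [set a] = [set z : borelC R | complex.Re (z : R[i]) = complex.Re a] `&`
    [set z : borelC R | complex.Im (z : R[i]) = complex.Im a]).
  apply: measurableI; rewrite -[X in measurable X]setTI.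
    exact: (measurable_Re measurableT (measurable_set1 (complex.Re a))).
  exact: (measurable_Im measurableT (measurable_set1 (complex.Im a))).
by apply/seteqP; split=> [z ->//|[x y] /= [e1 e2]]; case: a e1 e2 => ? ? /= -> ->.
Qed.

Lemma complex_measurable_id : complex_measurable (id : borelC R -> R[i]).
Proof. by split; [exact: measurable_Re|exact: measurable_Im]. Qed.

(** An open set is a countable union of discs with Gaussian rational centres and radii 1 / (m + 1),
    and the preimage of a disc is given by a measurable real inequality. *)
Lemma complex_measurable_borel d (T : measurableType d) (g : T -> R[i]) :
  complex_measurable g -> measurable_fun setT (g : T -> borelC R).
Proof.
move=> mg; apply: (@measurability _ _ T (borelC R) setT g (@open R[i]^o)) => // _ [U oU <-].
rewrite setTI.
pose e (k : nat) : R := k.+1%:R^-1.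
pose good (km : nat * nat) := forall w, cabs (w - rat_complex R km.1) < e km.2 -> U w.
have -> : g @^-1` U = \bigcup_(k : nat) \bigcup_(m in [set m | good (k, m)])
    [set t | cabs (g t - rat_complex R k) < e m].
  apply/seteqP; split=> [t /= Ut|t [k _ [m gkm /= h]]]; last exact: (gkm (g t) h).
  have := oU; rewrite openE => /(_ _ Ut) /(nbhs_ballP (g t : R[i]^o))[[r ri] /=].
  rewrite ltcE /= => /andP[/eqP ri0 r0] hr; subst ri.
  have [m hm] : exists m, e m < r / 2.
    exists (Num.truncn (r / 2)^-1).
    rewrite /e -[ltRHS]invrK ltf_pV2 ?posrE ?invr_gt0 ?divr_gt0 ?ltr0n//.
    exact: truncnS_gt.
  have em0 : 0 < e m by rewrite invr_gt0 ltr0n.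
  have [k hk] := rat_complex_dense (g t) em0.
  exists k => //; exists m; last by rewrite /= cabsB.
  move=> w wk; apply: hr; rewrite -ball_normE /= normc_def ltcE /= eqxx -cabsE.
  rewrite (le_lt_trans (cabsB_triangle (rat_complex R k) _ _))//.
  rewrite cabsB [cabs (_ - w)]cabsB [r]splitr ltrD//; first exact: lt_trans hk hm.
  exact: lt_trans wk hm.
apply: bigcup_measurable => k _; apply: bigcup_measurable => m _.
apply: measurable_lt_cst; apply: measurable_cabs.
exact: complex_measurableD (complex_measurable_cst _ _).
Qed.

End borel_complex.

(** * Equilibrium measure and fibres *)

Section equilibrium_measure.
Context (R : realType).
Variables (K : set R[i]) (rho : R).
Hypothesis mK : @measurable _ (borelC R) K.
Hypothesis rho0 : 0 < rho.
Hypothesis K_bounded : forall z, K z -> cabs z <= rho.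
Local Notation T := (borelC R).

(* Real and imaginary parts, cut off outside K so as to be bounded. *)
Definition ReK (z : T) : R := \1_K z * complex.Re (z : R[i]).
Definition ImK (z : T) : R := \1_K z * complex.Im (z : R[i]).

Lemma ReKE z : K z -> ReK z = complex.Re z.
Proof. by move=> Kz; rewrite /ReK indicE mem_set// mul1r. Qed.

Lemma ImKE z : K z -> ImK z = complex.Im z.
Proof. by move=> Kz; rewrite /ImK indicE mem_set// mul1r. Qed.

Lemma bounded_measurable_ReK : bounded_measurable ReK.
Proof.
split.
  by apply: measurable_funM; [exact: measurable_indic|exact: measurable_Re].
exists rho => z; rewrite /ReK indicE; have [zK|zK] := boolP (z \in K).
  by rewrite mul1r (le_trans (Re_le_cabs _))// K_bounded//; exact: set_mem.
by rewrite mul0r normr0 ltW.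
Qed.

Lemma bounded_measurable_ImK : bounded_measurable ImK.
Proof.
split.
  by apply: measurable_funM; [exact: measurable_indic|exact: measurable_Im].
exists rho => z; rewrite /ImK indicE; have [zK|zK] := boolP (z \in K).
  by rewrite mul1r (le_trans (Im_le_cabs _))// K_bounded//; exact: set_mem.
by rewrite mul0r normr0 ltW.
Qed.

Local Notation bX := bounded_measurable_ReK.
Local Notation bY := bounded_measurable_ImK.

Lemma sqrt_sqdistK z w : K z -> K w ->
  Num.sqrt (sqdist ReK ImK (z, w)) = cabs (z - w).
Proof.
move=> Kz Kw; rewrite cabsE /sqdist/= !ReKE ?ImKE//.
by case: z {Kz} => a b; case: w {Kw}.
Qed.

Variable C : R.
Hypothesis C_ge : forall x, 2^-1 * ln (1 + sqdist ReK ImK x) <= C.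

Local Notation logk := (logk ReK ImK C).
Local Notation mutual_energy := (mutual_energy ReK ImK C).
Local Notation potential := (potential ReK ImK C).

Lemma measurable_logkernel :
  measurable_fun setT (fun x : T * T => - lne (cabs ((x.1 : R[i]) - (x.2 : R[i])))%:E)%E.
Proof.
have m1 : complex_measurable (fun x : T * T => (x.1 : R[i])).
  split; first exact: measurableT_comp (@measurable_Re R) measurable_fst.
  exact: measurableT_comp (@measurable_Im R) measurable_fst.
have m2 : complex_measurable (fun x : T * T => (x.2 : R[i])).
  split; first exact: measurableT_comp (@measurable_Re R) measurable_snd.
  exact: measurableT_comp (@measurable_Im R) measurable_snd.
have mc := measurable_cabs (complex_measurableD m1 (complex_measurableN m2)).
pose g n (x : T * T) := (- ln (n.+1%:R^-1 + cabs (x.1 - x.2 : R[i])))%:E.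
apply: (emeasurable_fun_cvg g) => [n|x _].
  apply/measurable_EFinP/measurable_funN.
  rewrite -[X in measurable_fun _ X]/(@ln R \o
     (fun x : T * T => n.+1%:R^-1 + cabs ((x.1 : R[i]) - (x.2 : R[i])))).
  apply: measurableT_comp; first exact: measurable_ln.
  exact: (measurable_funD (f := fun=> n.+1%:R^-1)).
rewrite /g; set c := cabs _; have [c0|c0] := eqVneq c 0.
  rewrite c0 le0_lneNy//=; apply/cvgeryP/cvgryPge => A.
  near=> n; rewrite addr0 lnV ?posrE ?ltr0n// opprK.
  rewrite -[leLHS]expRK ler_ln ?posrE ?expR_gt0 ?ltr0n//.
  rewrite ltW// (@lt_trans _ _ n%:R)// ?ltr_nat//.
  by near: n; exact: nbhs_infty_gtr.
have cp : 0 < c by rewrite lt0r c0 cabs_ge0.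
rewrite lne_EFin// -EFinN; apply/cvg_EFin; first by near=> n.
apply: cvgN; rewrite -[X in _ --> ln X]add0r.
have : (fun n => n.+1%:R^-1 + c) @ \oo --> 0 + c.
  by apply: cvgD; [exact: cvg_harmonic|exact: cvg_cst].
by move/(cvg_comp _ _)/(_ (continuous_ln _)); apply; rewrite add0r.
Unshelve. all: by end_near. Qed.

(** On K x K the cut-off kernel is the true one shifted by [C], and P does not charge the complement
    of K. *)
Lemma energyE (P : probability T R) : P K = 1%E ->
  (energy P = mutual_energy P P - C%:E)%E.
Proof.
move=> PK.
have PKC : P (~` K) = 0%E by rewrite probability_setC// PK subee.
pose L (x : T * T) := (- lne (cabs ((x.1 : R[i]) - (x.2 : R[i])))%:E)%E.
have mL : measurable_fun setT L by exact: measurable_logkernel.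
have mLz z : measurable_fun setT (fun w => L (z, w)).
  by apply: (measurableT_comp mL); exact: measurable_pair1.
have LE z w : K z -> K w -> (L (z, w) = logk (z, w) - C%:E)%E.
  move=> Kz Kw; rewrite /logk sqrt_sqdistK//.
  rewrite -[L _]/(- lne (cabs (z - w))%:E)%E.
  by case: (lne _)%E => [r| |] //; rewrite -!EFinB; congr EFin; ring.
have mpot := measurable_potential bX bY C_ge P.
have mlk z := measurable_logk2 bX bY C z.
have lk0 := logk_ge0 C_ge.
rewrite /energy /mutual_energy.
rewrite -(ge0_integral_subcst P C (potential_ge0 C_ge P) mpot).
apply: ae_eq_integral => //.
- exact: measurable_partial_integral mL.
- by apply: emeasurable_funB => //; exact: measurable_cst.
exists (~` K); split=> //; first exact: measurableC.
move=> z /= nz Kz; apply: nz => _.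
rewrite -(ge0_integral_subcst P C (fun w => lk0 (z, w)) (mlk z)).
apply: ae_eq_integral => //; first exact: mLz.
- by apply: emeasurable_funB => //; exact: measurable_cst.
exists (~` K); split=> //; first exact: measurableC.
by move=> w /= nw Kw; apply: nw => _; exact: LE.
Qed.

Variable mu : probability T R.
Hypothesis hmu : is_equilibrium_measure K mu.

Let muK : mu K = 1%E. Proof. by case: hmu. Qed.

Lemma mutual_energy_fin : (mutual_energy mu mu < +oo)%E.
Proof.
have [_ + _] := hmu; rewrite energyE//.
by case: (mutual_energy mu mu) => [r _| |_]; rewrite ?ltry ?ltNyy.
Qed.

Lemma mutual_energy_min (P : probability T R) : P K = 1%E ->
  (mutual_energy mu mu <= mutual_energy P P)%E.
Proof.
move=> PK; have [_ _ /(_ P PK)] := hmu; rewrite !energyE//.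
by rewrite leeD2rE.
Qed.

(** Minimality is tested on the normalised restriction of mu to A. It still gives K mass 1, and its
    energy is the double integral over A divided by the square of mu(A). *)
Lemma equilibrium_potential_bounded :
  exists M : R, forall u, (potential mu u <= M%:E)%E.
Proof.
apply: (potential_bounded bX bY C_ge mutual_energy_fin) => A mA muA.
have lk0 := logk_ge0 C_ge.
have mlk z := measurable_logk2 bX bY C z.
have [Q [QE Qint]] := restricted_probability mA muA.
have fA : mu A \is a fin_num by rewrite fin_num_measure.
have r0 : (0 < fine (mu A)) by rewrite fine_gt0// muA -ge0_fin_numE// fA.
have QK : Q K = 1%E.
  rewrite QE; have -> : mu (K `&` A) = mu A.
    rewrite -[in RHS](setIT A) -(setUv K) setIUr.
    have mAK : measurable (A `&` ~` K) by apply: measurableI => //; exact: measurableC.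
    rewrite measureU//; [|exact: measurableI|by rewrite setIACA setICr setI0].
    rewrite [X in (_ + X)%E](_ : _ = 0%E) ?adde0; first by rewrite setIC.
    apply/eqP; rewrite eq_le measure_ge0 andbT.
    have <- : mu (~` K) = 0%E by rewrite probability_setC// muK subee.
    by apply: le_measure; rewrite ?inE//; exact: measurableC.
  by rewrite -[X in (_ * X)%E](fineK fA) -EFinM mulVf// gt_eqF.
set m := fine (mu A) in r0 *.
have Em : mu A = m%:E by rewrite fineK.
have mpot := measurable_potential bX bY C_ge Q.
have pot0 := potential_ge0 C_ge Q.
pose S := (\int[mu]_(z in A) potential Q z)%E.
have GS : (mutual_energy mu mu <= m^-1%:E * S)%E.
  apply: le_trans (mutual_energy_min QK) _.
  by rewrite /mutual_energy (Qint (potential Q)).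
have -> : (\int[mu]_(z in A) \int[mu]_(w in A) logk (z, w) = m%:E * S)%E.
  rewrite /S -ge0_integralZl//; last 2 first.
  - exact: measurable_funS mpot.
  - by rewrite lee_fin ltW.
  apply: eq_integral => z _; rewrite /potential Qint//.
  by rewrite muleA -EFinM mulfV ?mul1e// gt_eqF.
rewrite Em; apply: (@le_trans _ _ (m^-1%:E * S * (m%:E * m%:E))%E).
  by apply: lee_wpmul2r => //; rewrite mule_ge0// lee_fin ltW.
rewrite muleC [(_^-1%:E * S)%E]muleC !muleA -EFinM [X in (X <= _)%E]muleC.
by rewrite !muleA -!EFinM mulrA mulVf ?mul1r// gt_eqF.
Qed.

Lemma equilibrium_no_atom a : mu [set a] = 0%E.
Proof.
apply/eqP; rewrite eq_le measure_ge0 andbT leNgt; apply/negP => a0.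
have := mutual_energy_fin.
by rewrite (mutual_energy_atom bX bY C_ge (borel_set1 a) a0).
Qed.

(** * Invariance of the moments under averaging over fibres *)

Section fibres.
Variables (p : {poly R[i]}) (N : nat) (zeta : nat -> T -> R[i]).
Hypothesis N0 : (0 < N)%N.
Hypothesis a0 : lead_coef p != 0.
Hypothesis mzeta : forall i, complex_measurable (zeta i).
Hypothesis zetaE : forall z : T, p - p.[z]%:P =
  lead_coef p *: \prod_(i < N) ('X - (zeta i z)%:P).
Hypothesis K_fibre : forall z w, p.[z] = p.[w] -> K z -> K w.

Lemma horner_zeta (i : 'I_N) (z : T) : p.[zeta i z] = p.[z].
Proof.
have := congr1 (horner^~ (zeta i z)) (zetaE z).
rewrite hornerD hornerN hornerC hornerZ horner_prod (bigD1 i)//= hornerXsubC.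
by rewrite subrr mul0r mulr0 => /eqP; rewrite subr_eq0 => /eqP.
Qed.

Lemma K_zeta (i : 'I_N) (z : T) : K z -> K (zeta i z).
Proof. by apply: K_fibre; rewrite horner_zeta. Qed.

Lemma prod_cabs_zeta (z : T) (u : R[i]) :
  \prod_(j < N) cabs (zeta j z - u) = cabs (p.[u] - p.[z]) / cabs (lead_coef p).
Proof.
have := congr1 (fun q => cabs q.[u]) (zetaE z) => /=.
rewrite hornerD hornerN hornerC hornerZ horner_prod cabsM cabs_prod => ->.
rewrite mulrAC divff ?cabs_eq0// mul1r; apply: eq_bigr => j _.
by rewrite hornerXsubC cabsB.
Qed.

Lemma lne_mul (x y : R) : 0 <= x -> 0 <= y ->
  lne (x * y)%:E = (lne x%:E + lne y%:E)%E.
Proof.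
rewrite le_eqVlt => /predU1P[<- _|x0]; first by rewrite mul0r le0_lneNy.
rewrite le_eqVlt => /predU1P[<-|y0].
  by rewrite mulr0 [lne 0%:E]le0_lneNy// lne_EFin.
by rewrite !lne_EFin ?mulr_gt0// lnM.
Qed.

Lemma sum_sub_lne n (c : R) (r : 'I_n -> R) : (forall i, 0 <= r i) ->
  (\sum_(i < n) (c%:E - lne (r i)%:E) =
   (c *+ n)%:E - lne (\prod_(i < n) r i)%:E)%E.
Proof.
elim: n r => [|n IH] r r0; first by rewrite !big_ord0 mulr0n lne1 sube0.
rewrite !big_ord_recl (IH (fun i => r (lift ord0 i)))// lne_mul//; last by rewrite prodr_ge0.
rewrite mulrS EFinD.
(* The value may be [-oo], when a point meets the fibre, but never [+oo]; so no indeterminate sum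
   arises. *)
have nny (x : R) : lne x%:E != +oo%E.
  have [x0|x0] := leP x 0; first by rewrite le0_lneNy.
  by rewrite lne_EFin.
have key (x y : R) (A B : \bar R) : A != +oo%E -> B != +oo%E ->
    (x%:E - A + (y%:E - B) = x%:E + y%:E - (A + B))%E.
  case: A B => [A| |] [B| |]// _ _.
  by rewrite -!EFinN -!EFinD; congr EFin; ring.
exact: key.
Qed.

Lemma sum_logk_zeta (i : 'I_N) (z w : T) : K z -> K w ->
  (\sum_(j < N) logk (zeta j z, zeta i w) = \sum_(j < N) logk (zeta j z, w))%E.
Proof.
move=> Kz Kw.
have S u : K u -> (\sum_(j < N) logk (zeta j z, u) =
    (C *+ N)%:E - lne (cabs (p.[u] - p.[z]) / cabs (lead_coef p))%:E)%E.
  move=> Ku; rewrite -prod_cabs_zeta -sum_sub_lne; last by move=> j; exact: cabs_ge0.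
  apply: eq_bigr => j _; rewrite /logk sqrt_sqdistK//; exact: K_zeta.
by rewrite !S ?horner_zeta//; exact: K_zeta.
Qed.

Lemma Rintegral_monomial_zeta a b :
  \int[mu]_z (ReK z ^+ a * ImK z ^+ b) =
  N%:R^-1 * \sum_(i < N) \int[mu]_z (ReK (zeta i z) ^+ a * ImK (zeta i z) ^+ b).
Proof.
have mz i : measurable_fun setT (zeta i : T -> T).
  exact: complex_measurable_borel.
have [nu [nuE nuint nuRint]] := averaged_probability mu N0 mz.
have lk0 := logk_ge0 C_ge.
have mlk z := measurable_logk2 bX bY C z.
have mlkz i z : measurable_fun setT (fun w : T => logk (z, zeta i w)).
  by apply: (measurableT_comp (mlk z)); exact: mz.
have Ninv (x : \bar R) : (0 <= x)%E -> ((N%:R^-1)%:E * (\sum_(i < N) x) = x)%E.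
  move=> x0; have -> : (\sum_(i < N) x = N%:R%:E * x)%E.
    elim: (N) => [|n IH]; first by rewrite big_ord0 mul0e.
    by rewrite big_ord_recr/= IH -natr1 EFinD ge0_muleDl// mul1e.
  by rewrite muleA -EFinM mulVf ?mul1e// pnatr_eq0 -lt0n.
have nuK : nu K = 1%E.
  rewrite nuE -[RHS](Ninv 1%E)//; congr (_ * _)%E; apply: eq_bigr => i _.
  apply/eqP; rewrite eq_le probability_le1 /=.
    rewrite -[leLHS]muK; apply: le_measure; rewrite ?inE//.
      by rewrite -[X in measurable X]setTI; exact: mz.
    by move=> z; exact: (K_zeta i).
  by rewrite -[X in measurable X]setTI; exact: mz.
have muKC : mu (~` K) = 0%E by rewrite probability_setC// muK subee.
have pot0 P z := potential_ge0 C_ge P z.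
have mpot P := measurable_potential bX bY C_ge P.
(* Both I(nu, mu) and I(nu, nu) reduce to 1 / N times the integral of [F]. For the second, moving w
   along its fibre leaves the sum over j unchanged for z and w in K, hence almost everywhere. *)
pose F (z : T) : \bar R := (\int[mu]_w \sum_(j < N) logk (zeta j z, w))%E.
have FE z : F z = (\sum_(j < N) potential mu (zeta j z))%E.
  by rewrite /F ge0_integral_sum.
have mF : measurable_fun setT F.
  rewrite (_ : F = fun z => (\sum_(j < N) potential mu (zeta j z))%E); last first.
    exact/funext.
  by apply: emeasurable_sum => j; exact: (measurableT_comp (mpot mu) (mz j)).
have nu_mu : mutual_energy nu mu = ((N%:R^-1)%:E * \int[mu]_z F z)%E.
  transitivity ((N%:R^-1)%:E * \sum_(i < N) \int[mu]_z potential mu (zeta i z))%E.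
    exact: (nuint _ (pot0 mu) (mpot mu)).
  congr (_ * _)%E.
  rewrite -ge0_integral_sum//; first by apply: eq_integral => z _; rewrite FE.
  by move=> j; exact: (measurableT_comp (mpot mu) (mz j)).
have nu_nu : mutual_energy nu nu = ((N%:R^-1)%:E * \int[mu]_z F z)%E.
  transitivity ((N%:R^-1)%:E * \sum_(i < N) \int[mu]_z potential nu (zeta i z))%E.
    exact: (nuint _ (pot0 nu) (mpot nu)).
  congr (_ * _)%E.
  have mpz j : measurable_fun setT (fun z : T => potential nu (zeta j z)).
    exact: (measurableT_comp (mpot nu) (mz j)).
  rewrite -ge0_integral_sum//.
  apply: ae_eq_integral => //; first exact: emeasurable_sum.
  exists (~` K); split; [exact: measurableC|exact: muKC|].
  move=> z /= nz Kz; apply: nz => _.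
  have F0 : (0 <= F z)%E by rewrite FE sume_ge0.
  rewrite -[RHS](Ninv _ F0).
  under eq_bigr do rewrite /potential nuint//.
  rewrite -ge0_sume_distrr; last first.
    by move=> j _; apply: sume_ge0 => i _; apply: integral_ge0.
  congr (_ * _)%E; rewrite exchange_big/=; apply: eq_bigr => i _.
  rewrite -ge0_integral_sum//.
  apply: ae_eq_integral => //; [exact: emeasurable_sum|exact: emeasurable_sum|].
  exists (~` K); split; [exact: measurableC|exact: muKC|].
  by move=> w /= nw Kw; apply: nw => _; exact: sum_logk_zeta.
have nu_fin : (mutual_energy nu mu < +oo)%E.
  have [M hM] := equilibrium_potential_bounded.
  apply: (@le_lt_trans _ _ (\int[nu]_z (cst M%:E) z)%E).
    apply: ge0_le_integral => //; first by move=> z _; exact: pot0.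
      exact: mpot.
    by move=> z _; exact: hM.
  by rewrite integral_cst// [X in (_ * X)%E](@probability_setT _ _ _ nu) mule1 ltry.
rewrite (Rintegral_monomial_of_energy bX bY C_ge nu_fin).
- apply: nuRint; apply: bounded_measurableM; apply: bounded_measurableX.
    exact: bX.
  exact: bY.
- by rewrite nu_nu nu_mu.
- exact: mutual_energy_min.
Qed.

End fibres.

End equilibrium_measure.

(** * Sums over the roots of a polynomial *)

Section roots.
Context (F : fieldType).
Implicit Types (p q : {poly F}) (s t : seq F).

Lemma deriv_prod_XsubC s : (\prod_(x <- s) ('X - x%:P))^`() =
  \sum_(x <- s) (\prod_(y <- s) ('X - y%:P)) %/ ('X - x%:P).
Proof.
elim: s => [|y s IH]; first by rewrite !big_nil derivC.
rewrite !big_cons derivM derivXsubC mul1r IH mulKp ?polyXsubC_eq0//.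
congr (_ + _); rewrite mulr_sumr; apply: eq_big_seq => x xs.
by rewrite divp_mulA// dvdp_XsubCl root_prod_XsubC.
Qed.

(** Newton's identities, read off from p' = sum_x p / (X - x): the coefficients of each quotient are
    given by synthetic division. *)
Lemma newton_sums s j : let p := \prod_(x <- s) ('X - x%:P) in
  (j < size s)%N ->
  p`_j.+1 *+ j.+1 = \sum_(m < size s - j) p`_(j.+1 + m) * \sum_(x <- s) x ^+ m.
Proof.
move=> p js; rewrite -coef_deriv deriv_prod_XsubC coef_sum.
under [RHS]eq_bigr do rewrite mulr_sumr.
rewrite exchange_big/=; apply: eq_big_seq => x xs.
apply: quotient_XsubC_coef.
  by rewrite mulrC divpK// dvdp_XsubCl root_prod_XsubC.
by rewrite size_divp ?polyXsubC_eq0// size_XsubC size_prod_XsubC subSS subn0 subnK// ltnW.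
Qed.

(* By Newton's identities the first power sums do not involve the constant
   coefficient. *)
Lemma power_sums_eq s t : size s = size t ->
  (forall j, (0 < j)%N -> (\prod_(x <- s) ('X - x%:P))`_j =
                          (\prod_(x <- t) ('X - x%:P))`_j) ->
  forall k, (k < size s)%N -> \sum_(x <- s) x ^+ k = \sum_(x <- t) x ^+ k.
Proof.
move=> st pq k; elim/ltn_ind: k => k IH ks.
(* In the identity of this index the k-th power sum is the last term and has the leading coefficient
   1. Only coefficients of index at least j + 1 > 0 occur, so the constant one is avoided. *)
pose j := (size s - k.+1)%N.
have js : (j < size s)%N by rewrite /j ltn_subrL (leq_ltn_trans _ ks).
have sj : (size s - j = k.+1)%N by rewrite /j subKn.
have := newton_sums js; have := newton_sums (s := t) (j := j).
rewrite -st js sj !big_ord_recr/= => /(_ isT) Et Es.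
have jk : (j.+1 + k = size s)%N by rewrite /j -subSn// subSS subnK// ltnW.
have one u : size u = size s -> (\prod_(x <- u) ('X - x%:P))`_(j.+1 + k) = 1.
  move=> us; have /monicP := monic_prod_XsubC u xpredT id.
  by rewrite lead_coefE size_prod_XsubC jk us.
have E : \sum_(m < k) (\prod_(x <- s) ('X - x%:P))`_(j.+1 + m) * \sum_(x <- s) x ^+ m =
    \sum_(m < k) (\prod_(x <- t) ('X - x%:P))`_(j.+1 + m) * \sum_(x <- t) x ^+ m.
  apply: eq_bigr => m _; rewrite pq ?addSn// IH//; exact: ltn_trans (ltn_ord m) ks.
move: Es; rewrite pq// Et E !one// !mul1r => H.
by rewrite big_ord_recr/= one -?st// mul1r in H; exact: (esym (addrI _ H)).
Qed.

Lemma sum_roots p s : size p = (size s).+1 -> (0 < size s)%N ->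
  p = lead_coef p *: \prod_(x <- s) ('X - x%:P) ->
  \sum_(x <- s) x = - (p`_(size s).-1 / lead_coef p).
Proof.
move=> sp s0 pE; have a0 : lead_coef p != 0 by rewrite lead_coef_eq0 -size_poly_gt0 sp.
rewrite {1}pE coefZ coefPn_prod_XsubC -?lt0n//.
by rewrite mulrAC divff// mul1r opprK.
Qed.

End roots.

(** The fibre of f o g over v is the union of the fibres of g over the roots w of f - v, and g
    equals w on each of these deg g points. The sum of the w is given by Vieta's formula; as deg f
    >= 2, subtracting v leaves the relevant coefficient unchanged. *)
Lemma fibre_sum_comp (F : closedFieldType) (f g : {poly F}) (v : F) (s : seq F) :
  (2 < size f)%N -> (1 < size g)%N ->
  f \Po g - v%:P = lead_coef (f \Po g) *: \prod_(x <- s) ('X - x%:P) ->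
  \sum_(x <- s) g.[x] = - ((size g).-1%:R * (f`_(size f).-2 / lead_coef f)).
Proof.
move=> f2 g1 sE.
have lf : lead_coef f != 0 by rewrite lead_coef_eq0 -size_poly_gt0 (ltn_trans _ f2).
have lg : lead_coef g != 0 by rewrite lead_coef_eq0 -size_poly_gt0 (ltn_trans _ g1).
have sub (h : {poly F}) w : (1 < size h)%N ->
    size (h - w%:P) = size h /\ lead_coef (h - w%:P) = lead_coef h.
  move=> h1; have lt : (size (- w%:P) < size h)%N.
    by rewrite size_polyN (leq_ltn_trans (size_polyC_leq1 _)).
  by rewrite size_polyDl// lead_coefDl.
have [t tE] := closed_field_poly_normal (f - v%:P).
have [sfv lfv] := sub f v (ltnW f2).
have [w|r rE] := @boolp.choice _ _ (fun w r => g - w%:P =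
    lead_coef g *: \prod_(z <- r) ('X - z%:P)).
  have [r rE] := closed_field_poly_normal (g - w%:P).
  by exists r; rewrite -(sub g w g1).2.
have sr w : size (r w) = (size g).-1.
  rewrite -(sub g w g1).1 rE size_scale// size_prod_XsubC//.
have st : size t = (size f).-1.
  by rewrite -sfv tE size_scale ?lfv// size_prod_XsubC.
have := congr1 (fun q => q \Po g) tE.
rewrite lfv comp_polyB comp_polyC comp_polyZ sE.
have -> : (\prod_(w <- t) ('X - w%:P)) \Po g =
    lead_coef g ^+ size t *: \prod_(z <- flatten (map r t)) ('X - z%:P).
  rewrite big_flatten big_map/=.
  elim: (t) => [|w u IH]; first by rewrite !big_nil expr0 scale1r comp_polyC.
  rewrite !big_cons comp_polyM IH comp_polyB comp_polyX comp_polyC rE exprS.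
  by rewrite -scalerAl -scalerAr scalerA.
rewrite lead_coef_comp// -st scalerA => H.
(* Unique factorisation: s is a permutation of the concatenated fibres, multiplicities included. *)
have /prod_XsubC_eq perm := scalerI (mulf_neq0 lf (expf_neq0 _ lg)) H.
rewrite (perm_big _ perm)/= big_flatten big_map/=.
have -> : \sum_(w <- t) \sum_(z <- r w) g.[z] = \sum_(w <- t) (size g).-1%:R * w.
  apply: eq_bigr => w _; rewrite (eq_big_seq (fun=> w)).
    by rewrite big_const_seq count_predT iter_addr addr0 sr mulr_natl.
  move=> z zr; have : root (g - w%:P) z by rewrite rE rootZ// root_prod_XsubC.
  by rewrite /root hornerD hornerN hornerC subr_eq0 => /eqP.
rewrite -mulr_sumr (@sum_roots _ (f - v%:P)).
- rewrite lfv st coefB coefC; case: (size f) f2 => [|[|[|n]]]//= _.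
  by rewrite subr0 mulrN.
- by rewrite sfv st; case: (size f) f2.
- by rewrite st; case: (size f) f2 => [|[|]].
- by [].
Qed.

(** * Integration of complex functions *)

Section complex_integral.
Context (R : realType) (K : set R[i]) (P : probability (borelC R) R).
Hypothesis mK : @measurable _ (borelC R) K.
Hypothesis PK : P K = 1%E.
Local Notation T := (borelC R).
Implicit Types (f : T -> R) (g h : T -> R[i]).

(** Polynomials are unbounded on the plane, but P is carried by K; a bound on K is all that
    integrability needs. *)
Definition bounded_on g :=
  complex_measurable g /\ exists M : R, forall z, K z -> cabs (g z) <= M.

Let PKC : P (~` K) = 0%E.
Proof. by rewrite probability_setC// PK subee. Qed.

Lemma Rintegral_eq_on f1 f2 : measurable_fun setT f1 -> measurable_fun setT f2 ->
  (forall z, K z -> f1 z = f2 z) -> \int[P]_z f1 z = \int[P]_z f2 z.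
Proof.
move=> m1 m2 f12; congr fine; apply: ae_eq_integral => //.
- exact/measurable_EFinP.
- exact/measurable_EFinP.
exists (~` K); split; [exact: measurableC|exact: PKC|].
by move=> z /= nz Kz; apply: nz => _; rewrite f12.
Qed.

Lemma integrable_on f M : measurable_fun setT f ->
  (forall z, K z -> `|f z| <= M) -> P.-integrable setT (EFin \o f).
Proof.
move=> mf fM.
have m1 : measurable_fun setT (\1_K : T -> R) by exact: measurable_indic.
have b : bounded_measurable (fun z : T => \1_K z * f z).
  split; first exact: measurable_funM.
  exists `|M| => z; rewrite indicE; have [zK|_] := boolP (z \in K).
    by rewrite mul1r (le_trans (fM _ (set_mem zK)))// ler_norm.
  by rewrite mul0r normr0.
apply/integrableP; split; first exact/measurable_EFinP.
have /integrableP[_] := bounded_measurable_integrable P b.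
congr (_ < _)%E; apply: ge0_ae_eq_integral => //.
- by apply/measurableT_comp => //; apply/measurable_EFinP; case: b.
- by apply/measurableT_comp => //; exact/measurable_EFinP.
exists (~` K); split; [exact: measurableC|exact: PKC|].
by move=> z /= nz Kz; apply: nz => _; rewrite indicE mem_set// mul1r.
Qed.

Lemma integrable_Re g : bounded_on g ->
  P.-integrable setT (EFin \o (fun z => complex.Re (g z))).
Proof.
move=> [[mg _] [M gM]]; apply: (integrable_on (M := M)) => // z Kz.
exact: le_trans (Re_le_cabs _) (gM z Kz).
Qed.

Lemma integrable_Im g : bounded_on g ->
  P.-integrable setT (EFin \o (fun z => complex.Im (g z))).
Proof.
move=> [[_ mg] [M gM]]; apply: (integrable_on (M := M)) => // z Kz.
exact: le_trans (Im_le_cabs _) (gM z Kz).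
Qed.

Lemma bounded_on_cst c : bounded_on (fun=> c).
Proof. by split; [exact: complex_measurable_cst|exists (cabs c)]. Qed.

Lemma bounded_onD g h : bounded_on g -> bounded_on h ->
  bounded_on (fun z => g z + h z).
Proof.
move=> [mg [M gM]] [mh [N hN]]; split; first exact: complex_measurableD.
by exists (M + N) => z Kz; rewrite (le_trans (cabsD _ _))// lerD ?gM ?hN.
Qed.

Lemma bounded_onM g h : bounded_on g -> bounded_on h ->
  bounded_on (fun z => g z * h z).
Proof.
move=> [mg [M gM]] [mh [N hN]]; split; first exact: complex_measurableM.
by exists (M * N) => z Kz; rewrite cabsM ler_pM ?cabs_ge0 ?gM ?hN.
Qed.

Lemma bounded_on_sum (I : Type) (s : seq I) (g : I -> T -> R[i]) :
  (forall i, bounded_on (g i)) -> bounded_on (fun z => \sum_(i <- s) g i z).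
Proof.
move=> bg; elim: s => [|i s IH].
  by under eq_fun do rewrite big_nil; exact: bounded_on_cst.
by under eq_fun do rewrite big_cons; exact: bounded_onD.
Qed.

Lemma bounded_onX g n : bounded_on g -> bounded_on (fun z => g z ^+ n).
Proof.
move=> bg; elim: n => [|n IH]; first exact: bounded_on_cst.
by under eq_fun do rewrite exprS; exact: bounded_onM.
Qed.

Lemma bounded_on_conj g : bounded_on g -> bounded_on (fun z => conjc (g z)).
Proof.
move=> [[m1 m2] [M gM]]; split.
  split.
    rewrite (_ : (fun z => _) = fun z => complex.Re (g z))//.
    by apply/funext => z; case: (g z).
  rewrite (_ : (fun z => _) = fun z => - complex.Im (g z)).
    exact: measurable_funN.
  by apply/funext => z; case: (g z).
exists M => z Kz; have := gM z Kz; rewrite !cabsE.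
by case: (g z) => a b /=; rewrite sqrrN.
Qed.

Lemma bounded_on_horner g (p : {poly R[i]}) : bounded_on g ->
  bounded_on (fun z => p.[g z]).
Proof.
move=> bg; under eq_fun do rewrite horner_coef.
by apply: bounded_on_sum => i; apply: bounded_onM; [exact: bounded_on_cst|exact: bounded_onX].
Qed.

Lemma cintegralD g h : bounded_on g -> bounded_on h ->
  cintegral P (fun z => g z + h z) = cintegral P g + cintegral P h.
Proof.
move=> bg bh; rewrite /cintegral.
have -> : (fun z => complex.Re (g z + h z)) =
    (fun z => complex.Re (g z) + complex.Re (h z)).
  by apply/funext => z; case: (g z) => ? ?; case: (h z).
have -> : (fun z => complex.Im (g z + h z)) =
    (fun z => complex.Im (g z) + complex.Im (h z)).
  by apply/funext => z; case: (g z) => ? ?; case: (h z).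
by rewrite !RintegralD//; do ?[exact: integrable_Re|exact: integrable_Im].
Qed.

Lemma cintegralZ c g : bounded_on g ->
  cintegral P (fun z => c * g z) = c * cintegral P g.
Proof.
move=> bg; rewrite /cintegral; case: c => a b.
have i1 := integrable_Re bg; have i2 := integrable_Im bg.
have s (r : R) f : P.-integrable setT (EFin \o f) ->
    P.-integrable setT (EFin \o (fun z => r * f z)).
  move=> fi; have := integrableZl measurableT r fi.
  by apply: eq_integrable => // z _; rewrite /= EFinM.
have -> : (fun z => complex.Re (Complex a b * g z)) =
    (fun z => a * complex.Re (g z) - b * complex.Im (g z)).
  by apply/funext => z; case: (g z).
have -> : (fun z => complex.Im (Complex a b * g z)) =
    (fun z => a * complex.Im (g z) + b * complex.Re (g z)).
  by apply/funext => z; case: (g z).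
rewrite RintegralB ?RintegralD ?RintegralZl//; do ?exact: s.
Qed.

Lemma cintegral_cst c : cintegral P (fun=> c) = c.
Proof. by rewrite /cintegral !Rintegral_cstT; case: c. Qed.

Lemma cintegral_sum (I : Type) (s : seq I) (g : I -> T -> R[i]) :
  (forall i, bounded_on (g i)) ->
  cintegral P (fun z => \sum_(i <- s) g i z) = \sum_(i <- s) cintegral P (g i).
Proof.
move=> bg; elim: s => [|i s IH].
  by rewrite big_nil; under eq_fun do rewrite big_nil; exact: cintegral_cst.
rewrite big_cons -IH -cintegralD//; last exact: bounded_on_sum.
by under eq_fun do rewrite big_cons.
Qed.

Hypothesis K_bounded : exists rho : R, forall z, K z -> cabs z <= rho.

Lemma bounded_on_id : bounded_on (fun z => z).
Proof. by split=> //; exact: complex_measurable_id. Qed.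

Lemma bounded_on_poly (p : {poly R[i]}) : bounded_on (fun z => p.[z]).
Proof. exact: (bounded_on_horner _ bounded_on_id). Qed.

Hypothesis no_atom : forall a, P [set a] = 0%E.

(* P has no atoms, so it does not charge the finitely many zeros of p. *)
Lemma cintegral_sqr_eq0 (p : {poly R[i]}) :
  cintegral P (fun z => p.[z] * conjc p.[z]) = 0 -> p = 0.
Proof.
move=> /(congr1 (@complex.Re R)) /=.
have sqrE z : complex.Re (p.[z] * conjc p.[z]) = cabs p.[z] ^+ 2.
  by rewrite cabs_sqr; case: (p.[z]) => a b /=; ring.
under eq_fun do rewrite sqrE.
have bp := bounded_on_poly p.
have mp : measurable_fun setT (fun z : T => cabs p.[z] ^+ 2).
  by apply: measurable_funX; apply: measurable_cabs; case: bp.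
have ip : P.-integrable setT (EFin \o (fun z : T => cabs p.[z] ^+ 2)).
  have := integrable_Re (bounded_onM bp (bounded_on_conj bp)).
  by apply: eq_integrable => // z _; rewrite /= sqrE.
move=> i0; apply: contrapT => /eqP p0.
have [s pE] := closed_field_poly_normal p.
have roots z : p.[z] = 0 -> z \in s.
  move=> pz; have : root p z by apply/rootP.
  by rewrite pE rootZ ?lead_coef_eq0// root_prod_XsubC.
have finite0 (t : seq R[i]) : @measurable _ T [set z | z \in t] /\
    P [set z | z \in t] = 0%E.
  elim: t => [|x t [mt Pt]].
    by rewrite (_ : [set _ | _] = set0) ?measure0//; apply/seteqP; split.
  have -> : [set z | z \in x :: t] = [set x] `|` [set z | z \in t].
    apply/seteqP; split=> z /=; rewrite inE; first by case/orP => [/eqP|]; [left|right].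
    by case=> [->|->]; rewrite ?eqxx ?orbT.
  split; first by apply: measurableU => //; exact: borel_set1.
  by rewrite measureU0 //; do ?[exact: no_atom|exact: borel_set1].
have [ms Ps] := finite0 s.
have : (\int[P]_z `|(cabs p.[z] ^+ 2)%:E| = 0)%E.
  under eq_integral do rewrite gee0_abs ?lee_fin ?sqr_ge0//.
  by rewrite -[LHS]fineK ?(integrable_fin_num measurableT ip)//; congr EFin.
move=> /(ae_eq_integral_abs P measurableT (f := fun z => (cabs p.[z] ^+ 2)%:E)).
move=> [|N [mN PN NE]]; first exact/measurable_EFinP.
have : P setT = 0%E.
  have -> : [set: T] = [set z | z \in s] `|` N.
    apply/seteqP; split=> z // _; have [pz|pz] := eqVneq p.[z] 0.
      by left; exact: roots.
    right; apply: NE => /= /(_ Logic.I) [] /eqP.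
    by rewrite sqrf_eq0 cabs_eq0 (negPf pz).
  by rewrite measureU0.
by rewrite [LHS](@probability_setT _ _ _ P) => /eqP; rewrite onee_eq0.
Qed.

(** The difference r has degree less than j, so it is a combination of the powers of z to which it
    is orthogonal; hence the integral of |r|^2 vanishes. *)
Lemma monic_orthopoly_unique j (p q : {poly R[i]}) :
  is_monic_orthopoly P j p -> is_monic_orthopoly P j q -> p = q.
Proof.
move=> [pm sp po] [qm sq qo]; apply/eqP; rewrite -subr_eq0; apply/eqP.
have bzk k : bounded_on (fun z => conjc (z ^+ k)).
  exact/bounded_on_conj/bounded_onX/bounded_on_id.
set r := p - q.
have sr : (size r <= j)%N.
  rewrite -ltnS -sp; have : (size r <= size p)%N.
    by rewrite (leq_trans (size_polyD _ _))// size_polyN sp sq maxnn.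
  rewrite leq_eqVlt => /orP[/eqP srp|//].
  have r0 : lead_coef r = 0.
    rewrite lead_coefE srp sp /= coefB.
    by move: (monicP pm) (monicP qm); rewrite !lead_coefE sp sq/= => -> ->; rewrite subrr.
  by move/eqP: r0; rewrite lead_coef_eq0 -size_poly_eq0 srp sp.
apply: cintegral_sqr_eq0.
have rE z : r.[z] * conjc r.[z] =
    \sum_(k < j) conjc r`_k * (r.[z] * conjc (z ^+ k)).
  rewrite (horner_coef_wide z sr) rmorph_sum mulr_sumr; apply: eq_bigr => k _.
  by rewrite -(horner_coef_wide z sr) rmorphM mulrCA.
under eq_fun do rewrite rE.
have b1 k : bounded_on (fun z => r.[z] * conjc (z ^+ k)).
  by apply: bounded_onM => //; exact: bounded_on_poly.
rewrite (@cintegral_sum _ _ (fun (k : 'I_j) z => conjc r`_k * (r.[z] * conjc (z ^+ k)))).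
  apply: big1 => k _; rewrite cintegralZ//.
  rewrite (_ : (fun z => _) = fun z => p.[z] * conjc (z ^+ k)
      + -1 * (q.[z] * conjc (z ^+ k))); last first.
    by apply/funext => z; rewrite /r hornerD hornerN mulN1r mulrDl mulNr.
  have bp : bounded_on (fun z => p.[z] * conjc (z ^+ k)).
    by apply: bounded_onM => //; exact: bounded_on_poly.
  have bq : bounded_on (fun z => q.[z] * conjc (z ^+ k)).
    by apply: bounded_onM => //; exact: bounded_on_poly.
  rewrite cintegralD// ?cintegralZ//; last by apply: bounded_onM => //; exact: bounded_on_cst.
  by rewrite po// qo// mulr0 addr0 mulr0.
by move=> k; apply: bounded_onM => //; exact: bounded_on_cst.
Qed.

Lemma monic_orthopolyE j p : is_monic_orthopoly P j p -> monic_orthopoly P j = p.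
Proof.
move=> jp; apply: xget_subset1 => // q r; exact: monic_orthopoly_unique.
Qed.

End complex_integral.

(** * Averages of polynomials over fibres *)

Section real_polynomials.
Context (R : realType).
Implicit Types (h k : R -> R -> R) (g : R[i] -> R[i]).

(** An explicit list of coefficients and exponents, because the invariance is known for monomials in
    the two coordinates. *)
Definition bipoly h := exists s : seq (R * (nat * nat)),
  forall x y, h x y = \sum_(m <- s) m.1 * (x ^+ m.2.1 * y ^+ m.2.2).

Lemma bipoly_cst c : bipoly (fun _ _ => c).
Proof. by exists [:: (c, (0, 0)%N)] => x y; rewrite big_seq1 !expr0 !mulr1. Qed.

Lemma bipoly_fst : bipoly (fun x _ => x).
Proof. by exists [:: (1, (1, 0)%N)] => x y; rewrite big_seq1 expr0 expr1 mul1r mulr1. Qed.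

Lemma bipoly_snd : bipoly (fun _ y => y).
Proof. by exists [:: (1, (0, 1)%N)] => x y; rewrite big_seq1 expr0 expr1 !mul1r. Qed.

Lemma bipolyD h k : bipoly h -> bipoly k -> bipoly (fun x y => h x y + k x y).
Proof. by move=> [s sE] [t tE]; exists (s ++ t) => x y; rewrite big_cat/= sE tE. Qed.

Lemma bipolyM h k : bipoly h -> bipoly k -> bipoly (fun x y => h x y * k x y).
Proof.
move=> [s sE] [t tE].
exists [seq (m.1 * n.1, ((m.2.1 + n.2.1)%N, (m.2.2 + n.2.2)%N)) | m <- s, n <- t] => x y.
rewrite big_allpairs_dep/= sE tE mulr_suml; apply: eq_bigr => m _.
by rewrite mulr_sumr; apply: eq_bigr => n _; rewrite !exprD; ring.
Qed.

Lemma bipolyN h : bipoly h -> bipoly (fun x y => - h x y).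
Proof.
move=> /(bipolyM (bipoly_cst (-1))) [s sE].
by exists s => x y; rewrite -sE mulN1r.
Qed.

(** These are the polynomials in z and its conjugate. *)
Definition starpoly g := bipoly (fun x y => complex.Re (g (Complex x y))) /\
  bipoly (fun x y => complex.Im (g (Complex x y))).

Lemma bipoly_ext h k : (forall x y, h x y = k x y) -> bipoly h -> bipoly k.
Proof. by move=> hk [s sE]; exists s => x y; rewrite -hk sE. Qed.

Lemma starpoly_id : starpoly id.
Proof. by split; [exact: bipoly_fst|exact: bipoly_snd]. Qed.

Lemma starpoly_cst c : starpoly (fun=> c).
Proof. by split; exact: bipoly_cst. Qed.

Lemma starpolyD g1 g2 : starpoly g1 -> starpoly g2 ->
  starpoly (fun z => g1 z + g2 z).
Proof.
move=> [r1 i1] [r2 i2]; split.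
  apply: bipoly_ext (bipolyD r1 r2) => x y.
  by case: (g1 _) => ? ?; case: (g2 _).
apply: bipoly_ext (bipolyD i1 i2) => x y.
by case: (g1 _) => ? ?; case: (g2 _).
Qed.

Lemma starpolyM g1 g2 : starpoly g1 -> starpoly g2 ->
  starpoly (fun z => g1 z * g2 z).
Proof.
move=> [r1 i1] [r2 i2]; split.
  apply: bipoly_ext (bipolyD (bipolyM r1 r2) (bipolyN (bipolyM i1 i2))) => x y.
  by case: (g1 _) => ? ?; case: (g2 _).
apply: bipoly_ext (bipolyD (bipolyM r1 i2) (bipolyM i1 r2)) => x y.
by case: (g1 _) => ? ?; case: (g2 _).
Qed.

Lemma starpoly_conj g : starpoly g -> starpoly (fun z => conjc (g z)).
Proof.
move=> [r1 i1]; split; first by apply: bipoly_ext r1 => x y; case: (g _).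
by apply: bipoly_ext (bipolyN i1) => x y; case: (g _).
Qed.

Lemma starpolyX g n : starpoly g -> starpoly (fun z => g z ^+ n).
Proof.
move=> sg; elim: n => [|n IH]; first exact: starpoly_cst.
by under eq_fun do rewrite exprS; exact: starpolyM.
Qed.

Lemma starpoly_horner (p : {poly R[i]}) : starpoly (fun z => p.[z]).
Proof.
elim/poly_ind: p => [|p c IH].
  by under eq_fun do rewrite horner0; exact: starpoly_cst.
under eq_fun do rewrite hornerMXaddC.
apply: starpolyD; last exact: starpoly_cst.
by apply: starpolyM => //; exact: starpoly_id.
Qed.

Lemma measurable_bipoly h d (T : measurableType d) (u v : T -> R) : bipoly h ->
  measurable_fun setT u -> measurable_fun setT v ->
  measurable_fun setT (fun t => h (u t) (v t)).
Proof.
move=> [s sE] mu mv; under eq_fun do rewrite sE.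
elim: s {sE} => [|m s IH]; first by under eq_fun do rewrite big_nil; exact: measurable_cst.
under eq_fun do rewrite big_cons; apply: measurable_funD => //.
apply: measurable_funM => //.
by apply: measurable_funM; exact: measurable_funX.
Qed.

Lemma Rintegral_bipoly (s : seq (R * (nat * nat))) d (T : measurableType d)
    (P : probability T R) (u v : T -> R) :
  bounded_measurable u -> bounded_measurable v ->
  \int[P]_t (\sum_(m <- s) m.1 * (u t ^+ m.2.1 * v t ^+ m.2.2)) =
  \sum_(m <- s) m.1 * \int[P]_t (u t ^+ m.2.1 * v t ^+ m.2.2).
Proof.
move=> bu bv.
have b m : bounded_measurable (fun t => u t ^+ m.2.1 * v t ^+ m.2.2).
  by apply: bounded_measurableM; exact: bounded_measurableX.
have bc (m : R * (nat * nat)) :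
    bounded_measurable (fun t => m.1 * (u t ^+ m.2.1 * v t ^+ m.2.2)).
  by apply: (bounded_measurableM (f := fun=> m.1)) => //; exact: bounded_measurable_cst.
elim: s => [|m s IH].
  by rewrite big_nil; under eq_Rintegral do rewrite big_nil; rewrite Rintegral_cstT.
rewrite big_cons -IH -RintegralZl//; last exact: bounded_measurable_integrable.
rewrite -RintegralD//; [|exact: bounded_measurable_integrable|].
  by under eq_Rintegral do rewrite big_cons.
by apply: bounded_measurable_integrable; exact: bounded_measurable_sum.
Qed.

End real_polynomials.

(** * Integrals of polynomials in z and its conjugate over fibres *)

Section fibre_average.
Context (R : realType) (K : set R[i]) (rho : R) (mu : probability (borelC R) R).
Hypothesis mK : @measurable _ (borelC R) K.
Hypothesis rho0 : 0 < rho.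
Hypothesis K_bounded : forall z, K z -> cabs z <= rho.
Hypothesis hmu : is_equilibrium_measure K mu.
Local Notation T := (borelC R).

Let muK : mu K = 1%E. Proof. by case: hmu. Qed.

Lemma exists_kernel_constant : exists C : R,
  forall x, 2^-1 * ln (1 + sqdist (ReK K) (ImK K) x) <= C.
Proof.
have [M M0 hM] := sqdist_bound (bounded_measurable_ReK mK rho0 K_bounded)
  (bounded_measurable_ImK mK rho0 K_bounded).
exists (2^-1 * ln (1 + M)) => x; rewrite ler_pM2l ?invr_gt0// ler_ln ?posrE.
- by rewrite lerD2l.
- by rewrite ltr_pwDl// sqdist_ge0.
- by rewrite addr_gt0.
Qed.

Lemma equilibrium_measure_atomless a : mu [set a] = 0%E.
Proof.
have [C hC] := exists_kernel_constant.
exact: (equilibrium_no_atom mK rho0 K_bounded hC hmu).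
Qed.

Variables (p : {poly R[i]}) (N : nat).
Hypothesis N0 : (0 < N)%N.
Hypothesis size_p : size p = N.+1.
Hypothesis K_fibre : forall z w, p.[z] = p.[w] -> K z -> K w.

Lemma exists_fibre_roots : exists2 zeta : nat -> T -> R[i],
  forall i, complex_measurable (zeta i) &
  forall z : T, p - p.[z]%:P = lead_coef p *: \prod_(i < N) ('X - (zeta i z)%:P).
Proof.
have a0 : lead_coef p != 0 by rewrite lead_coef_eq0 -size_poly_gt0 size_p.
pose q (z : T) := (lead_coef p)^-1 *: (p - p.[z]%:P).
have lt (z : T) : (size (- p.[z]%:P) < size p)%N.
  by rewrite size_polyN size_p (leq_ltn_trans (size_polyC_leq1 _)).
have qm z : q z \is monic.
  by rewrite monicE lead_coefZ lead_coefDl// mulVf.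
have sq z : size (q z) = N.+1.
  by rewrite size_scale ?invr_eq0// size_polyDl.
have [i|zeta mz zE] := measurable_roots qm sq _.
  under eq_fun do rewrite /q coefZ coefB coefC.
  apply: complex_measurableM; first exact: complex_measurable_cst.
  apply: complex_measurableD; first exact: complex_measurable_cst.
  apply: complex_measurableN; case: eqP => _; last exact: complex_measurable_cst.
  apply: (@complex_measurable_horner _ _ _ (fun=> p) (size p)) => //.
  exact: complex_measurable_id.
by exists zeta => // z; rewrite -zE scalerA divff// scale1r.
Qed.

Variable zeta : nat -> T -> R[i].
Hypothesis mzeta : forall i, complex_measurable (zeta i).
Hypothesis zetaE : forall z : T, p - p.[z]%:P =
  lead_coef p *: \prod_(i < N) ('X - (zeta i z)%:P).

Lemma bounded_on_zeta (i : 'I_N) : bounded_on K (zeta i).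
Proof.
by split=> //; exists rho => z Kz; apply: K_bounded; exact: (K_zeta zetaE).
Qed.

(** The moments are known for the cut-off coordinates. These agree with the true ones on K, and also
    along the roots, because each [zeta i] maps K into K. *)
Lemma Rintegral_bipoly_zeta h : bipoly h ->
  \int[mu]_z h (complex.Re (z : R[i])) (complex.Im (z : R[i])) =
  N%:R^-1 * \sum_(i < N)
    \int[mu]_z h (complex.Re (zeta i z)) (complex.Im (zeta i z)).
Proof.
move=> bh; have [s sE] := bh.
have a0 : lead_coef p != 0 by rewrite lead_coef_eq0 -size_poly_gt0 size_p.
have [C hC] := exists_kernel_constant.
have bX := bounded_measurable_ReK mK rho0 K_bounded.
have bY := bounded_measurable_ImK mK rho0 K_bounded.
have moment := Rintegral_monomial_zeta mK rho0 K_bounded hC hmu N0 a0 mzeta zetaE K_fibre.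
have mz i : measurable_fun setT (zeta i : T -> T) by exact: complex_measurable_borel.
have bXz i : bounded_measurable (fun z : T => ReK K (zeta i z)).
  exact: bounded_measurable_comp (mz i) bX.
have bYz i : bounded_measurable (fun z : T => ImK K (zeta i z)).
  exact: bounded_measurable_comp (mz i) bY.
transitivity (\int[mu]_z h (ReK K z) (ImK K z)).
  apply: (Rintegral_eq_on mK muK).
  - by apply: measurable_bipoly => //; [exact: measurable_Re|exact: measurable_Im].
  - by apply: measurable_bipoly => //; [case: bX|case: bY].
  - by move=> z Kz; rewrite ReKE// ImKE.
under eq_Rintegral do rewrite sE.
rewrite Rintegral_bipoly//; under eq_bigr do rewrite moment mulrCA mulr_sumr.
rewrite -mulr_sumr exchange_big/=; congr (_ * _); apply: eq_bigr => i _.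
rewrite -Rintegral_bipoly//; under eq_Rintegral do rewrite -sE.
have [m1 m2] := mzeta i.
apply: (Rintegral_eq_on mK muK).
- by apply: measurable_bipoly => //; [case: (bXz i)|case: (bYz i)].
- exact: measurable_bipoly.
- move=> z Kz; have Kzi := K_zeta zetaE K_fibre i Kz.
  by rewrite ReKE// ImKE.
Qed.

Lemma cintegral_zeta g : starpoly g ->
  cintegral mu g = N%:R^-1 * \sum_(i < N) cintegral mu (fun z => g (zeta i z)).
Proof.
move=> [gr gi].
have e (x : R[i]) : Complex (complex.Re x) (complex.Im x) = x by case: x.
have -> : cintegral mu g = Complex
    (\int[mu]_z complex.Re (g (Complex (complex.Re (z : R[i])) (complex.Im (z : R[i])))))
    (\int[mu]_z complex.Im (g (Complex (complex.Re (z : R[i])) (complex.Im (z : R[i]))))).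
  by congr Complex; apply: eq_Rintegral => z _; rewrite e.
rewrite (Rintegral_bipoly_zeta gr) (Rintegral_bipoly_zeta gi).
have sumC (a b : 'I_N -> R) :
    \sum_i Complex (a i) (b i) = Complex (\sum_i a i) (\sum_i b i) :> R[i].
  by elim/big_rec3: _ => // i u v _ _ ->.
have -> : (N%:R^-1 : R[i]) = Complex N%:R^-1 0.
  by rewrite -[Complex _ _]/(N%:R^-1)%:C%C fmorphV rmorph_nat.
rewrite /cintegral sumC -[LHS]/(Complex _ _).
congr Complex; rewrite mul0r ?subr0 ?addr0; congr (_ * _); apply: eq_bigr => i _;
  by apply: eq_Rintegral => z _; rewrite e.
Qed.

Lemma cintegral_zeta_const g h c : starpoly g -> bounded_on K g -> bounded_on K h ->
  (forall i : 'I_N, bounded_on K (fun z => g (zeta i z))) ->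
  (forall z, \sum_(i < N) g (zeta i z) = c * h z) ->
  cintegral mu g = c / N%:R * cintegral mu h.
Proof.
move=> sg bg bh bgz gc; rewrite cintegral_zeta//.
rewrite -(@cintegral_sum _ _ _ mK muK _ _ (fun (i : 'I_N) z => g (zeta i z)))//.
rewrite (_ : (fun z => _) = (fun z => c * h z)); last exact/funext.
by rewrite (cintegralZ mK muK)// mulrCA mulrA.
Qed.

(** The polynomials p - p(z) and p - p(w) differ only in the constant coefficient, which
    [power_sums_eq] does not see. *)
Lemma power_sum_zeta k z w : (k < N)%N ->
  \sum_(i < N) zeta i z ^+ k = \sum_(i < N) zeta i w ^+ k.
Proof.
move=> kN; have a0 : lead_coef p != 0 by rewrite lead_coef_eq0 -size_poly_gt0 size_p.
pose s (z : T) := [seq zeta i z | i : 'I_N].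
have ss z' : size (s z') = N by rewrite size_map size_enum_ord.
have ps z' : \prod_(x <- s z') ('X - x%:P) = (lead_coef p)^-1 *: (p - p.[z']%:P).
  by rewrite big_image/= zetaE scalerA mulVf// scale1r; apply: eq_bigl.
have E z' : \sum_(i < N) zeta i z' ^+ k = \sum_(x <- s z') x ^+ k.
  by rewrite big_image/=; apply: eq_bigl.
rewrite !E; apply: power_sums_eq; rewrite ?ss// => j j0.
by rewrite !ps !coefZ !coefB !coefC gtn_eqF.
Qed.

End fibre_average.

(** * Orthogonality *)

Section orthogonality.
Context (R : realType) (f : nat -> {poly R[i]}) (mu : probability (borelC R) R).
Hypothesis hf : regular f.
Local Notation K := [set z : R[i] | julia f (Some z)].
Hypothesis hmu : is_equilibrium_measure K mu.
Local Notation T := (borelC R).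

Let mK : @measurable _ T K := julia_measurable f.
Let muK : mu K = 1%E. Proof. by case: hmu. Qed.
Let K_bounded : exists rho : R, forall z, K z -> cabs z <= rho.
Proof. by have [rho _ h] := julia_bounded hf; exists rho. Qed.

Let cst l := (deg (f l.+1))%:R^-1 * ((f l.+1)`_(deg (f l.+1)).-1 / lead_coef (f l.+1)).

(** On a fibre of F_l the function F_l is constant, and averaging over it yields nothing; hence the
    passage to the larger fibres of F_(l+1). *)
Lemma cintegral_comp_seq l : cintegral mu (fun z => (comp_seq f l).[z]) = - cst l.
Proof.
have [rho rho0 hrho] := julia_bounded hf.
have N0 := deg_comp_seq_gt0 hf l.+1; have sp := size_comp_seq hf l.+1.
have fib z w : (comp_seq f l.+1).[z] = (comp_seq f l.+1).[w] -> K z -> K w.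
  exact: julia_fibre.
have [zeta mz zE] := exists_fibre_roots N0 sp.
have d2 := regular_deg hf (ltn0Sn l).
have df : (2 < size (f l.+1))%N by move: d2; rewrite /deg; case: (size _).
have dF : (1 < size (comp_seq f l))%N by rewrite size_comp_seq// ltnS deg_comp_seq_gt0.
have bz i := bounded_on_zeta hrho fib mz zE i.
rewrite (@cintegral_zeta_const _ _ _ _ mK rho0 hrho hmu _ _ N0 sp fib _ mz zE
  (fun z => (comp_seq f l).[z]) (fun=> 1)
  (- ((deg (comp_seq f l))%:R * ((f l.+1)`_(size (f l.+1)).-2 / lead_coef (f l.+1))))).
- rewrite (cintegral_cst mu) mulr1 [deg (comp_seq f l.+1)]/deg /= size_comp_poly.
  have n0 : (deg (comp_seq f l))%:R != 0 :> R[i] by rewrite pnatr_eq0 -lt0n deg_comp_seq_gt0.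
  have d0 : (deg (f l.+1))%:R != 0 :> R[i] by rewrite pnatr_eq0 -lt0n ltnW.
  rewrite -/(deg _) -/(deg (comp_seq f l)) natrM /cst.
  by set a := (f l.+1)`_ _ / _; field; rewrite n0 d0.
- exact: starpoly_horner.
- exact: bounded_on_poly.
- exact: bounded_on_cst.
- by move=> i; exact: bounded_on_horner.
- move=> z; rewrite mulr1.
  pose s := [seq zeta i z | i : 'I_(deg (comp_seq f l.+1))].
  have := @fibre_sum_comp _ (f l.+1) (comp_seq f l) (comp_seq f l.+1).[z] s df dF.
  by rewrite !big_image/= => -> //; rewrite -zE.
Qed.

Lemma orthogonal_comp_seq l k : (k < deg (comp_seq f l))%N ->
  cintegral mu (fun z => ((comp_seq f l).[z] + cst l) * conjc (z ^+ k)) = 0.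
Proof.
move=> kN; have [rho rho0 hrho] := julia_bounded hf.
have N0 := deg_comp_seq_gt0 hf l; have sp := size_comp_seq hf l.
have fib z w : (comp_seq f l).[z] = (comp_seq f l).[w] -> K z -> K w.
  exact: julia_fibre.
have [zeta mz zE] := exists_fibre_roots N0 sp.
have bz i := bounded_on_zeta hrho fib mz zE i.
have bF := bounded_on_poly K_bounded (comp_seq f l).
have bc := bounded_on_cst K (cst l).
have bid := bounded_on_id K_bounded.
rewrite (@cintegral_zeta_const _ _ _ _ mK rho0 hrho hmu _ _ N0 sp fib _ mz zE
  (fun z => ((comp_seq f l).[z] + cst l) * conjc (z ^+ k))
  (fun z => (comp_seq f l).[z] + cst l)
  (* The power sum is the same over every fibre; the fibre through 0 serves as a reference. *)
  (conjc (\sum_(i < deg (comp_seq f l)) zeta i 0 ^+ k))).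
- rewrite (cintegralD mK muK)// cintegral_comp_seq (cintegral_cst mu).
  by rewrite addNr mulr0.
- apply: starpolyM; first by apply: starpolyD; [exact: starpoly_horner|exact: starpoly_cst].
  exact/starpoly_conj/starpolyX/starpoly_id.
- apply: bounded_onM; first exact: bounded_onD.
  exact/bounded_on_conj/bounded_onX.
- exact: bounded_onD.
- move=> i; apply: bounded_onM.
    by apply: bounded_onD => //; exact: bounded_on_horner.
  exact/bounded_on_conj/bounded_onX.
- move=> z; rewrite (power_sum_zeta sp zE 0 z kN) rmorph_sum mulr_suml.
  apply: eq_bigr => i _; rewrite (horner_zeta zE) mulrC//.
Qed.

Lemma monic_orthopoly_comp_seq l :
  monic_orthopoly mu (deg (comp_seq f l)) =
  (lead_coef (comp_seq f l))^-1 *: (comp_seq f l + (cst l)%:P).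
Proof.
have sF := size_comp_seq hf l; have N0 := deg_comp_seq_gt0 hf l.
have a0 : lead_coef (comp_seq f l) != 0.
  by rewrite lead_coef_eq0 -size_poly_gt0 sF.
have lt : (size (cst l)%:P < size (comp_seq f l))%N.
  by rewrite sF (leq_ltn_trans (size_polyC_leq1 _)).
have [rho rho0 hrho] := julia_bounded hf.
apply: (monic_orthopolyE mK muK K_bounded).
  by move=> a; exact: (equilibrium_measure_atomless mK rho0 hrho hmu).
split.
- by rewrite monicE lead_coefZ lead_coefDl// mulVf.
- by rewrite size_scale ?invr_eq0// size_polyDl.
move=> k kN.
rewrite (_ : (fun z => _) = (fun z => (lead_coef (comp_seq f l))^-1 *
    (((comp_seq f l).[z] + cst l) * conjc (z ^+ k)))); last first.
  by apply/funext => z; rewrite hornerZ hornerD hornerC mulrA.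
rewrite (cintegralZ mK muK) ?orthogonal_comp_seq ?mulr0//.
apply: bounded_onM; last exact/bounded_on_conj/bounded_onX/bounded_on_id.
apply: bounded_onD; last exact: bounded_on_cst.
exact: bounded_on_poly.
Qed.

End orthogonality.

Theorem theorem3p3 (R : realType) (f : nat -> {poly R[i]})
    (hf : regular f)
    (mu : probability (borelC R) R)
    (hmu : is_equilibrium_measure [set z : R[i] | julia f (Some z)] mu) :
  monic_orthopoly mu 1 =
    'X + ((deg (f 1%N))%:R^-1 *
          ((f 1%N)`_(deg (f 1%N)).-1 / lead_coef (f 1%N)))%:P
  /\
  forall l : nat, (0 < l)%N ->
    monic_orthopoly mu (\prod_(1 <= i < l.+1) deg (f i))%N =
      (\prod_(1 <= i < l.+1)
          lead_coef (f i) ^+ (\prod_(i.+1 <= j < l.+1) deg (f j))%N)^-1 *: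
      (comp_seq f l +
        ((deg (f l.+1))%:R^-1 *
          ((f l.+1)`_(deg (f l.+1)).-1 / lead_coef (f l.+1)))%:P).
Proof.
have main := monic_orthopoly_comp_seq hf hmu.
split=> [|l _].
  (* This is the case l = 0: F_0 = X has degree and leading coefficient 1. *)
  by have := main 0%N; rewrite /deg /= size_polyX lead_coefX invr1 scale1r.
by rewrite -(lead_coef_comp_seq hf) -(deg_comp_seq f) main.
Qed.
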